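(* Let $p=p_n$ satisfy $n^{-1/2}(\log n)^{1/2}\ll p\ll 1$ and let $\delta_n$ be a sequence satisfying $$p^{3/4}(\log n)^{3/4}\le\delta_n,\qquad n^{-1/3}(\log n)^{2/3}+p\log(1/p)\le\delta_n,\qquad \delta_n\le 1.$$ Then $$r(\delta_n,p,n)=\Theta(1)\,\min\left\{\delta_n^{2/3}p^2n^2\log n,\ \delta_n^{1/2}pn^{3/2}\log n+\delta_np^2n^2\log(1/p)\right\}.$$
   Context: For sequences, $f\ll g$ means $f/g\to 0$ as $n\to\infty$; $\log$ is the natural logarithm; $(n)_3=n(n-1)(n-2)$; $f=\Theta(1)g$ means that $f/g$ is bounded between two positive constants for all sufficiently large $n$. $G_p\sim G(n,p)$ is the Erdős–Rényi random graph on $n$ vertices in which each edge is present independently with probability $p$. $N_\triangle(G)$ is the number of isomorphic copies of the triangle in $G$ counted with multiplicity, i.e. the number of injective maps $V(K_3)\to V(G)$ preserving edges (so $N_\triangle(K_4)=24$). Define $$r(\delta,p,n)=-\log\mathbb P\big(N_\triangle(G_p)>(1+\delta)p^3(n)_3\big).$$ *)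

(* Defs.v *)
From HB Require Import structures.
From mathcomp Require Import all_boot all_order all_algebra.
From mathcomp Require Import all_classical all_reals all_analysis.

Set Implicit Arguments.
Unset Strict Implicit.
Unset Printing Implicit Defensive.

Import Order.TTheory GRing.Theory Num.Theory.
Import numFieldNormedType.Exports.

Local Open Scope classical_set_scope.
Local Open Scope ring_scope.

Definition vpairs (n : nat) : {set {set 'I_n}} := [set e : {set 'I_n} | #|e| == 2%N]%SET.

(* A simple graph on the vertex set 'I_n is identified with its edge set, a
   subset of [vpairs n]; a graph event is a boolean predicate on edge sets. *)

(* Labelled triangles: injective edge-preserving maps from K_3 into the graph,
   so each unlabelled triangle contributes 6. *)
Definition Ntriangle (n : nat) (E : {set {set 'I_n}}) : nat :=
  #|[set f : {ffun 'I_3 -> 'I_n} | injectiveb f &&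
      [forall i : 'I_3, forall j : 'I_3,
        (i != j) ==> ([set f i; f j]%SET \in E)]]%SET|.

(* Law of G(n,p): the edge indicators are independent Bernoulli(p), so the mass
   of E is the product over all potential edges. *)
Definition Gnp_mass (R : realType) (n : nat) (p : R) (E : {set {set 'I_n}}) : R :=
  \prod_(e in vpairs n) (if e \in E then p else 1 - p).

Definition Gnp_prob (R : realType) (n : nat) (p : R)
    (A : pred {set {set 'I_n}}) : R :=
  \sum_(E : {set {set 'I_n}} | (E \subset vpairs n) && A E) Gnp_mass p E.

(* [n ^_ 3] is the falling factorial n(n-1)(n-2).  Since [ln 0 = 0], the value
   is junk when the event is null. *)
Definition upper_rate (R : realType) (delta p : R) (n : nat) : R :=
  - ln (@Gnp_prob R n p (fun E =>
          (1 + delta) * p ^+ 3 * (n ^_ 3)%:R < (Ntriangle E)%:R)).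

(* f << g, i.e. f / g -> 0.  As [x / 0 = 0] here, the quotient is explicitly
   required to be meaningful for all large n. *)
Definition much_less (R : realType) (f g : nat -> R) : Prop :=
  (\forall n \near \oo, g n != 0) /\ (f n / g n @[n --> \oo] --> 0).

(* f = Theta(1) g *)
Definition same_order (R : realType) (f g : nat -> R) : Prop :=
  exists c C : R, [/\ 0 < c, 0 < C &
    \forall n \near \oo, c <= f n / g n <= C].

(* Main.v *)
Require Import Defs.
From HB Require Import structures.
From mathcomp Require Import all_boot all_order all_algebra.
From mathcomp Require Import all_classical all_reals all_analysis.
From mathcomp Require Import zify ring lra.

Set Implicit Arguments.
Unset Strict Implicit.
Unset Printing Implicit Defensive.

Import Order.TTheory GRing.Theory Num.Theory.
Import numFieldNormedType.Exports.

Local Open Scope ring_scope.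

(** Notation for this explanation: L = ln (1/p), al = delta^(1/3),
    mu = p^3 n(n-1)(n-2) is the mean of the number X of labelled triangles,
    st = delta^(1/2) p n^(3/2), h = delta p^2 n^2 and
    phi = min (al^2 p^2 n^2, st + h).  The claimed order of magnitude is
    phi L up to a factor 9 ([target_compare]): ln n <= 4 L unless
    p > n^(-1/4), and for such large p the term h L dominates st ln n.  So two
    bounds on P(X > (1 + delta) mu) are needed, exp(- C phi L) from below and
    exp(- c phi L) from above.

    From below.  If planting a set I of edges raises the mean of X to
    (1 + 2 delta) mu, then, because X <= n^3, the event has probability at
    least p^|I| delta mu / n^3 ([Pr_tri_gt]); the polynomial factor is
    harmless.  A clique on about al p n vertices, a star with about st edges,
    or all edges between about delta p^2 n vertices and half of the others
    are such sets, and the cheapest of them has O(phi) edges.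

    From above.  Call a set I of few edges a seed if the mean of X given that
    I is present exceeds (1 + delta/2) mu.
    - High moments.  On the event that the graph contains no seed of at most
      3k edges, the k-th moment of X is at most ((1 + delta/2) mu)^k
      ([Ex_copies_pow]): expand X^k into k-tuples of triangles and add them
      one at a time.  Markov's inequality with k of order phi L / delta then
      costs exp(- c phi L) ([Pr_copies_seedless]), and it remains to exclude
      seeds.
    - The gain of a seed splits according to the number of edges that a
      triangle shares with it ([tri_mean_le]).  Triangles with one edge in the
      seed are too few, because phi L <= delta^2 p n^2; this is where
      delta >= p^(3/4) (ln n)^(3/4) is used.
    - Triangles with two edges in the seed are governed by the squares of the
      degrees.  Degrees d above a constant times np have total excess
      sum d ln (d/np) at most a small multiple of phi L, except with
      probability exp(- c phi L) ([Pr_degree_excess]), and this controls the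
      sum of squares ([high_sum_sq]: the function d / ln (d/np) is
      increasing, so the worst case is one star or a few full hubs).
    - Triangles inside the seed.  Those that meet a vertex of very high degree
      are bounded by a union bound over the neighbourhoods of these few
      vertices, followed by a weighted Chernoff bound ([Pr_hubs]).  If many
      triangles remain, pruning leaves a dense core, a subgraph all of whose
      edges lie in many triangles of the subgraph and whose degrees are
      bounded ([exists_core]).  The neighbourhoods of a few random vertices
      of a core already cover half of its edges ([exists_fingerprint]).  So
      the core is found by first choosing a short fingerprint and then finding
      many edges of the graph among the few pairs that it spans, which is
      unlikely enough to beat the number of fingerprints ([Pr_dense_core]).
      Cores with at least phi L edges only need a constant factor per edge;
      smaller ones need a factor p^c per edge and get it after removing all
      vertices of degree above n p^(1/2). *)

(** * Random subsets with independent elements *)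
Section BernoulliSubset.

Variables (R : realType) (T : finType).
Implicit Types (U A B E I J : {set T}) (p : R) (f g : {set T} -> R).

Definition subset_mass U p E : R :=
  \prod_(e in U) (if e \in E then p else 1 - p).

Definition Ex U p f : R :=
  \sum_(E : {set T} | E \subset U) subset_mass U p E * f E.

Definition Pr U p (A : pred {set T}) : R := Ex U p (fun E => (A E)%:R).

Lemma subset_mass_ge0 U p E : 0 <= p <= 1 -> 0 <= subset_mass U p E.
Proof.
move=> /andP[p0 p1]; apply: prodr_ge0 => e _.
by case: ifP => _ //; rewrite subr_ge0.
Qed.

Lemma ExD U p f g : Ex U p (fun E => f E + g E) = Ex U p f + Ex U p g.
Proof. by rewrite /Ex -big_split; apply: eq_bigr => E _; rewrite mulrDr. Qed.

Lemma ExZ U p c f : Ex U p (fun E => c * f E) = c * Ex U p f.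
Proof. by rewrite /Ex big_distrr; apply: eq_bigr => E _; rewrite mulrCA. Qed.

Lemma Ex_sum U p (I : finType) (P : pred I) (F : I -> {set T} -> R) :
  Ex U p (fun E => \sum_(i | P i) F i E) = \sum_(i | P i) Ex U p (F i).
Proof.
rewrite /Ex exchange_big; apply: eq_bigr => E _.
by rewrite big_distrr.
Qed.

Lemma eq_Ex U p f g : (forall E, E \subset U -> f E = g E) ->
  Ex U p f = Ex U p g.
Proof. by move=> fg; apply: eq_bigr => E EU; rewrite fg. Qed.

Lemma le_Ex U p f g : 0 <= p <= 1 ->
  (forall E, E \subset U -> f E <= g E) -> Ex U p f <= Ex U p g.
Proof.
move=> p01 fg; apply: ler_sum => E EU.
by apply: ler_wpM2l (fg _ EU); apply: subset_mass_ge0.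
Qed.

(** Independence in its multiplicative form: the expectation of a product over
    the elements is the product of the expectations. *)
Lemma Ex_prod U p (a b : T -> R) :
  Ex U p (fun E => \prod_(e in U) (if e \in E then a e else b e)) =
  \prod_(e in U) (p * a e + (1 - p) * b e).
Proof.
pose F e := if e \in U then p * a e else 0.
pose G e := if e \in U then (1 - p) * b e else 1.
have -> : \prod_(e in U) (p * a e + (1 - p) * b e) = \prod_e (F e + G e).
  rewrite big_mkcond; apply: eq_bigr => e _.
  by rewrite /F /G; case: ifP => //; rewrite add0r.
rewrite bigA_distr (bigID (fun E : {set T} => E \subset U)) /=.
rewrite [X in _ = _ + X]big1 ?addr0; last first.
  move=> E /fintype.subsetPn[e eE eU].
  by rewrite (bigD1 e) //= eE /F (negbTE eU) mul0r.
rewrite /Ex; apply: eq_bigr => E EU.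
rewrite /subset_mass -big_split big_mkcond /=; apply: eq_bigr => e _.
case: ifP => eU; rewrite /F /G eU; first by case: ifP.
by case: ifP => // /(fintype.subsetP EU); rewrite eU.
Qed.

Lemma Ex_cst U p c : Ex U p (fun=> c) = c.
Proof.
rewrite (@eq_Ex _ _ _ (fun E => c *
    \prod_(e in U) (if e \in E then 1 else 1))); last first.
  by move=> E _; rewrite big1 ?mulr1 // => e _; case: ifP.
by rewrite ExZ Ex_prod big1 ?mulr1 // => e _; ring.
Qed.

Lemma Ex_superset U p I : I \subset U ->
  Ex U p (fun E => (I \subset E)%:R) = p ^+ #|I|.
Proof.
move=> IU.
rewrite (@eq_Ex _ _ _ (fun E =>
    \prod_(e in U) (if e \in E then 1 else (e \notin I)%:R))); last first.
  move=> E EU; case: (boolP (I \subset E)) => [IE|/fintype.subsetPn[e eI eE]].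
    rewrite big1 // => e _; case: ifP => // eE.
    by rewrite (contraFN _ eE) //; apply: (fintype.subsetP IE).
  by rewrite (bigD1 e) ?(fintype.subsetP IU) //= (negbTE eE) eI mul0r.
rewrite Ex_prod -[X in _ = X]prodr_const big_mkcond [RHS]big_mkcond.
apply: eq_bigr => e _; case: ifP => eU.
  by case: ifP => eI /=; ring.
by case: ifP => // /(fintype.subsetP IU); rewrite eU.
Qed.

Lemma PrE U p (A : pred {set T}) :
  Pr U p A = \sum_(E : {set T} | (E \subset U) && A E) subset_mass U p E.
Proof.
rewrite /Pr /Ex big_mkcondr; apply: eq_bigr => E _.
by case: (A E); rewrite ?mulr1 ?mulr0.
Qed.

Lemma le_Pr U p (A B : pred {set T}) : 0 <= p <= 1 ->
  (forall E, E \subset U -> A E -> B E) -> Pr U p A <= Pr U p B.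
Proof.
move=> p01 AB; apply: le_Ex => // E EU.
by case: (boolP (A E)) => [/(AB _ EU) ->//|_]; rewrite ler0n.
Qed.

Lemma Pr_or U p (A B : pred {set T}) : 0 <= p <= 1 ->
  Pr U p (fun E => A E || B E) <= Pr U p A + Pr U p B.
Proof.
move=> p01; rewrite -ExD; apply: le_Ex => // E _.
by case: (A E); case: (B E) => //=; lra.
Qed.

Lemma Pr_exists U p (I : finType) (P : pred I) (A : I -> pred {set T}) :
  0 <= p <= 1 ->
  Pr U p (fun E => [exists i, P i && A i E]) <= \sum_(i | P i) Pr U p (A i).
Proof.
move=> p01; rewrite -Ex_sum; apply: le_Ex => // E _.
case: existsP => [[i /andP[Pi Ai]]|_]; last by apply: sumr_ge0.
by rewrite (bigD1 i) //= Ai lerDl sumr_ge0.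
Qed.

Lemma Ex_markov U p (A : pred {set T}) f : 0 <= p <= 1 ->
  (forall E, E \subset U -> 0 <= f E) ->
  (forall E, E \subset U -> A E -> 1 <= f E) ->
  Pr U p A <= Ex U p f.
Proof.
move=> p01 f0 f1; apply: le_Ex => // E EU.
by case: (boolP (A E)) => [/(f1 _ EU)//|_]; rewrite f0.
Qed.

End BernoulliSubset.

(** * A weighted Chernoff bound *)
Section Chernoff.

Variables (R : realType).

(** Convexity of the exponential on the segment from 0 to b, obtained by
    combining the two endpoint values with the tangent at [b * x]. *)
Lemma expR_chord (b x : R) : 0 <= x <= 1 ->
  expR (b * x) <= 1 + x * (expR b - 1).
Proof.
move=> /andP[x0 x1].
have t0 : expR (b * x) * (1 - b * x) <= 1.
  have := expR_ge1Dx (- (b * x)); rewrite expRN => /(ler_wpM2l (expR_ge0 (b * x))).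
  by rewrite mulfV ?gt_eqF ?expR_gt0.
have t1 : expR (b * x) * (1 + (b - b * x)) <= expR b.
  have := expR_ge1Dx (b - b * x) => /(ler_wpM2l (expR_ge0 (b * x))).
  by rewrite -expRD (_ : b * x + (b - b * x) = b) //; ring.
have := ler_wpM2l x0 t1.
have : (1 - x) * (expR (b * x) * (1 - b * x)) <= (1 - x) * 1.
  by apply: ler_wpM2l t0; rewrite subr_ge0.
nra.
Qed.

(** Exponential moment with parameter [(1 + a) / h].  The point of this form is
    the factor [a]: it is large when the threshold [s] is much larger than the
    mean [p * W], and then each unit of [s / h] costs [a], not a constant. *)
Lemma Pr_weight_ge (T : finType) (U : {set T}) (p : R) (w : T -> R)
    (h s a W : R) :
  0 <= p <= 1 -> 0 < h -> 0 <= a ->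
  (forall e, e \in U -> 0 <= w e <= h) -> \sum_(e in U) w e <= W ->
  expR (1 + a) * p * W <= s ->
  Pr U p (fun E => s <= \sum_(e in E) w e) <= expR (- (a * s / h)).
Proof.
move=> p01 h0 a0 wh sW eW.
have hN0 : h != 0 by rewrite gt_eqF.
have [p0 p1] := andP p01.
pose t := (1 + a) / h.
have t0 : 0 <= t by rewrite divr_ge0 ?(ltW h0) // addr_ge0.
have -> : - (a * s / h) = - (t * s) + s / h.
  by rewrite /t; field.
apply: le_trans (_ : Ex U p (fun E => expR (- (t * s)) *
   \prod_(e in U) (if e \in E then expR (t * w e) else 1)) <= _).
  apply: Ex_markov => // E EU.
    rewrite mulr_ge0 ?expR_ge0 // prodr_ge0 // => e _.
    by case: ifP => _; rewrite ?expR_ge0.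
  move=> sE.
  have -> : \prod_(e in U) (if e \in E then expR (t * w e) else 1) =
            expR (t * \sum_(e in E) w e).
    rewrite big_distrr expR_sum /= big_mkcond [RHS]big_mkcond.
    apply: eq_bigr => e _; case: ifP => eU //.
    by case: ifP => // /(fintype.subsetP EU); rewrite eU.
  rewrite -expRD -[leLHS]expR0 ler_expR addrC subr_ge0.
  exact: ler_wpM2l.
rewrite ExZ Ex_prod expRD ler_wpM2l ?expR_ge0 //.
apply: le_trans (_ : expR (\sum_(e in U) (p * expR (1 + a) / h) * w e) <= _).
  rewrite expR_sum; apply: ler_prod => e eU.
  have /andP[we0 weh] := wh e eU.
  rewrite addr_ge0 ?mulr_ge0 ?expR_ge0 ?subr_ge0 //=.
  have tw : t * w e = (1 + a) * (w e / h) by rewrite /t; field.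
  have x01 : 0 <= w e / h <= 1.
    by rewrite divr_ge0 ?(ltW h0) //= ler_pdivrMr // mul1r.
  have := expR_chord (1 + a) x01; rewrite -tw => ch.
  apply: le_trans (_ : 1 + p * (w e / h) * (expR (1 + a) - 1) <= _).
    have := ler_wpM2l p0 ch; lra.
  apply: le_trans (expR_ge1Dx _); rewrite lerD2l.
  have -> : p * expR (1 + a) / h * w e = p * (w e / h) * expR (1 + a) by field.
  apply: ler_wpM2l; first by rewrite mulr_ge0 //; case/andP: x01.
  by rewrite gerBl.
rewrite ler_expR -big_distrr /=.
have -> : p * expR (1 + a) / h * \sum_(i in U) w i =
   (expR (1 + a) * p * \sum_(i in U) w i) / h by field.
rewrite ler_pM2r ?invr_gt0 //; apply: le_trans eW.
by rewrite ler_wpM2l // mulr_ge0 ?expR_ge0.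
Qed.

End Chernoff.

(** * Moments in the absence of seeds *)
Section Seeds.

Variables (R : realType) (T : finType) (U : {set T}) (p : R).
Hypothesis p01 : 0 <= p <= 1.
Variables (I : finType) (P : pred I) (K : I -> {set T}).
Hypothesis KU : forall i, P i -> K i \subset U.

(** The family [K] of subsets stands for the triangles, given by their edge
    sets. *)
Definition copies (E : {set T}) : R := \sum_(i | P i) (K i \subset E)%:R.

(** This is the mean of [copies] given that [A] is contained in the random
    set, see [Ex_copies_superset]. *)
Definition cond_mean (A : {set T}) : R := \sum_(i | P i) p ^+ #|K i :\: A|.

Definition seedless (M : R) (m : nat) : pred {set T} := fun E =>
  [forall A : {set T}, (A \subset E) && (#|A| <= m)%N ==> (cond_mean A <= M)].

Lemma Ex_copies_superset (A : {set T}) : A \subset U ->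
  Ex U p (fun E => (A \subset E)%:R * copies E) = p ^+ #|A| * cond_mean A.
Proof.
move=> AU; rewrite /copies /cond_mean big_distrr /=.
under eq_Ex do rewrite big_distrr /=.
rewrite Ex_sum; apply: eq_bigr => i Pi.
rewrite (@eq_Ex _ _ _ _ _ (fun E => (A :|: K i \subset E)%:R)); last first.
  by move=> E _; rewrite -natrM mulnb finset.subUset.
rewrite Ex_superset ?finset.subUset ?AU ?KU // -exprD; congr (_ ^+ _).
have := subset_leq_card (finset.subsetIl (K i) A).
by rewrite cardsU cardsD [(A :&: _)%SET]finset.setIC; lia.
Qed.

End Seeds.

Section SeedMoments.

Variables (R : realType) (T : finType) (U : {set T}) (p : R).
Hypothesis p01 : 0 <= p <= 1.
Variables (I : finType) (P : pred I) (K : I -> {set T}) (r : nat).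
Hypothesis KU : forall i, P i -> K i \subset U.
Hypothesis Kr : forall i, P i -> (#|K i| <= r)%N.

Lemma copies_ge0 E : 0 <= copies R P K E.
Proof. by apply: sumr_ge0. Qed.

(** Induction on the exponent.  If [A] is a seed then the left side vanishes.
    Otherwise one factor [copies] is expanded: adding the [i]-th copy to [A]
    leaves a set within the size budget, and the resulting powers of [p] sum to
    [p ^+ #|A|] times the conditional mean of [A], which is at most [M]. *)
Lemma Ex_copies_pow (M : R) (l k : nat) (A : {set T}) :
  0 <= M -> A \subset U -> (#|A| + r * k <= r * l)%N ->
  Ex U p (fun E => (A \subset E)%:R * (seedless p P K M (r * l) E)%:R *
                   copies R P K E ^+ k) <= M ^+ k * p ^+ #|A|.
Proof.
move=> M0; elim: k A => [|k IHk] A AU Al.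
  rewrite expr0 mul1r -(Ex_superset p AU); apply: le_Ex => // E _.
  by rewrite expr0 mulr1 -natrM mulnb ler_nat; case: (A \subset E); rewrite ?leq_b1.
case: (leP (cond_mean p P K A) M) => [cM|Mc]; last first.
  rewrite (@eq_Ex _ _ _ _ _ (fun=> 0)) ?Ex_cst.
    by rewrite mulr_ge0 ?exprn_ge0 //; case/andP: p01.
  move=> E _; case: (boolP (A \subset E)) => AE; last by rewrite !mul0r.
  suff /negbTE-> : ~~ seedless p P K M (r * l) E by rewrite mulr0 mul0r.
  apply/negP => /forallP/(_ A); rewrite AE /=.
  by rewrite (leq_trans _ Al) ?leq_addr //= leNgt Mc.
apply: le_trans (_ : M ^+ k * (p ^+ #|A| * cond_mean p P K A) <= _); last first.
  rewrite exprS [M * _]mulrC -mulrA ler_wpM2l ?exprn_ge0 // mulrC.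
  by apply: ler_wpM2r cM; rewrite exprn_ge0 //; case/andP: p01.
rewrite (@eq_Ex _ _ _ _ _ (fun E => \sum_(i | P i) ((A :|: K i \subset E)%:R *
   (seedless p P K M (r * l) E)%:R * copies R P K E ^+ k))); last first.
  move=> E _; rewrite exprS; set c := copies R P K E ^+ k.
  rewrite /copies big_distrl big_distrr /=; apply: eq_bigr => i _.
  by rewrite finset.subUset -mulnb natrM; ring.
rewrite Ex_sum /cond_mean big_distrr big_distrr /=; apply: ler_sum => i Pi.
have cU : (#|A :|: K i| = #|A| + #|K i :\: A|)%N.
  have := subset_leq_card (finset.subsetIl (K i) A).
  by rewrite cardsU cardsD [(A :&: _)%SET]finset.setIC; lia.
rewrite -exprD -cU; apply: IHk; first by rewrite finset.subUset AU KU.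
have := Kr Pi; have := subset_leq_card (finset.subsetDl (K i) A).
rewrite cU; move: Al; rewrite mulnS; lia.
Qed.

Lemma Pr_copies_seedless (M y : R) (l : nat) : 0 <= M -> 0 < y ->
  Pr U p (fun E => (y < copies R P K E) && seedless p P K M (r * l) E) <=
  (M / y) ^+ l.
Proof.
move=> M0 y0.
have := @Ex_copies_pow M l l finset.set0 M0 (finset.sub0set _).
rewrite cards0 add0n leqnn expr0 mulr1 => /(_ isT) mb.
rewrite exprMn mulrC.
apply: le_trans (ler_wpM2l _ mb); last by rewrite exprn_ge0 ?invr_ge0 ?ltW.
rewrite -ExZ; apply: Ex_markov => // E _; rewrite finset.sub0set.
  by rewrite !mulr_ge0 ?exprn_ge0 ?invr_ge0 ?copies_ge0 ?(ltW y0).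
move=> /andP[yX ->]; rewrite !mul1r -exprMn exprn_ege1 //.
by rewrite mulrC ler_pdivlMr // mul1r ltW.
Qed.

End SeedMoments.

(** * Independence of disjoint blocks *)
Section Independence.

Variables (R : realType) (T : finType) (p : R).

Lemma Ex_indep (U A : {set T}) (f g : {set T} -> R) : A \subset U ->
  Ex U p (fun E => f (E :&: A) * g (E :\: A)) = Ex A p f * Ex (U :\: A) p g.
Proof.
move=> AU; rewrite /Ex big_distrlr pair_big /=.
rewrite (reindex_onto (fun q : {set T} * {set T} => q.1 :|: q.2)
                      (fun E => (E :&: A, E :\: A))) /=; last first.
  by move=> E _; rewrite finset.setID.
have key (E1 E2 : {set T}) : E1 \subset A -> E2 \subset U :\: A ->
    ((E1 :|: E2) :&: A = E1) /\ ((E1 :|: E2) :\: A = E2).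
  move=> /fintype.subsetP s1 /fintype.subsetP s2; split; apply/setP => e.
    rewrite !inE; case: (boolP (e \in E1)) => [/s1->//|_] /=.
    by case: (boolP (e \in E2)) => //= /s2; rewrite !inE => /andP[/negbTE->].
  rewrite !inE; case: (boolP (e \in E2)) => [/s2|_].
    by rewrite !inE => /andP[-> _]; rewrite orbT.
  by rewrite orbF; case: (boolP (e \in E1)) => [/s1->//|_]; rewrite andbF.
apply: eq_big => [[E1 E2]|[E1 E2]] /=.
  apply/idP/idP => [/andP[EU /eqP[k1 k2]]|/andP[s1 s2]].
    apply/andP; split; first by rewrite -k1 finset.subsetIr.
    by rewrite -k2 finset.setSD.
  have [-> ->] := key _ _ s1 s2; rewrite eqxx andbT finset.subUset.
  by rewrite (fintype.subset_trans s1 AU) (fintype.subset_trans s2 (finset.subsetDl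
    _ _)).
move=> /andP[EU /eqP[k1 k2]]; rewrite k1 k2.
suff -> : subset_mass U p (E1 :|: E2) =
          subset_mass A p E1 * subset_mass (U :\: A) p E2 by ring.
rewrite /subset_mass (bigID (mem A)) /=; congr (_ * _).
  apply: eq_big => e; first by case: (boolP (e \in A)) => //
    [/(fintype.subsetP AU)->//|]; rewrite ?andbF.
  by move=> /andP[_ eA]; rewrite -[in RHS]k1 !inE eA andbT.
apply: eq_big => e; first by rewrite inE andbC.
by move=> /andP[_ eA]; rewrite -[in RHS]k2 !inE eA.
Qed.

Lemma Ex_indep_prod (I : eqType) (A : I -> {set T}) (F : I -> {set T} -> R)
    (s : seq I) (U : {set T}) :
  uniq s -> (forall i, i \in s -> A i \subset U) ->
  (forall i j, i != j -> [disjoint A i & A j]) ->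
  Ex U p (fun E => \prod_(i <- s) F i (E :&: A i)) =
  \prod_(i <- s) Ex (A i) p (F i).
Proof.
move=> us AU dA; elim: s U us AU => [|i s IHs] U.
  by move=> _ _; rewrite big_nil; under eq_Ex do rewrite big_nil; rewrite Ex_cst.
move=> /= /andP[si us] AU.
have sub j : j \in s -> A j \subset U :\: A i.
  move=> js; rewrite finset.subsetD AU ?inE ?js ?orbT //=.
  by apply: dA; apply: contraNneq si => <-.
rewrite big_cons -(IHs _ us sub) -Ex_indep ?AU ?mem_head //.
apply: eq_Ex => E _; rewrite big_cons; congr (_ * _).
rewrite big_seq [RHS]big_seq; apply: eq_bigr => j js; congr (F j _).
have := sub j js; rewrite finset.subsetD => /andP[_ dj].
apply/setP => e; rewrite !inE andbC [RHS]andbC.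
case: (boolP (e \in A j)) => //= ej.
by rewrite (disjointFr dj ej).
Qed.

End Independence.

(** * Exponential moments of block degrees *)
Section BlockDegrees.

Variables (R : realType).

(** Up to constants, this is the cost of a binomial variable with mean [y]
    reaching the value [x], counted only beyond [C * y]. *)
Definition excess (C y : R) (x : nat) : R :=
  if C * y < x%:R then x%:R * ln (x%:R / y) else 0.

Variables (T : finType) (p C : R) (N : nat).
Hypotheses (p0 : 0 < p) (p1 : p <= 1) (N0 : (0 < N)%N).
Hypothesis C4 : expR 4 <= C.
Let y := N%:R * p.
Hypothesis small : N%:R * N.+1%:R * expR (- (C * y)) <= 1.

(** By the Chernoff bound, the probability of the value [x] is at most
    exp(- x (ln (x / y) - 1)).  As ln (x / y) >= 4 beyond [C * y], this beats
    the weight exp (x ln (x / y) / 2) by a factor exp(- x). *)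
Lemma Ex_block_excess (A : {set T}) : (#|A| <= N)%N ->
  Ex A p (fun E => expR (excess C y #|E| / 2)) <=
    1 + N.+1%:R * expR (- (C * y)).
Proof.
move=> AN; have p01 : 0 <= p <= 1 by rewrite ltW.
have y0 : 0 < y by rewrite mulr_gt0 // ltr0n.
have C0 : 0 < C by apply: lt_le_trans C4; rewrite expR_gt0.
pose P (x : 'I_N.+1) := C * y < x%:R.
apply: le_trans (_ : Ex A p (fun E => 1 + \sum_(x < N.+1 | P x)
   expR (excess C y x / 2) * (x <= #|E|)%N%:R) <= _).
  apply: le_Ex => // E EA; rewrite {1}/excess; case: ifP => [CE|_]; last first.
    rewrite mul0r expR0 lerDl sumr_ge0 //.
  have EN : (#|E| < N.+1)%N.
    by rewrite ltnS (leq_trans _ AN) // subset_leq_card.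
  rewrite (bigD1 (Ordinal EN)) //= leqnn mulr1 /excess CE.
  by rewrite addrCA lerDl addr_ge0 // sumr_ge0.
rewrite ExD Ex_cst lerD2l Ex_sum.
apply: le_trans (_ : \sum_(x < N.+1 | P x) expR (- (C * y)) <= _); last first.
  rewrite -[X in _ <= X * _](_ : \sum_(x < N.+1) 1 = _); last first.
    by rewrite sumr_const card_ord.
  rewrite big_distrl /= [leRHS](bigID P) /=.
  rewrite (eq_bigr (fun=> 1 * expR (- (C * y)))) ?lerDl; last by move=> *;
    rewrite mul1r.
  by apply: sumr_ge0 => x _; rewrite mul1r expR_ge0.
apply: ler_sum => x Px; rewrite ExZ.
have x0 : 0 < x%:R :> R by apply: lt_trans Px; rewrite mulr_gt0.
have Cx : C <= x%:R / y by rewrite ler_pdivlMr // ltW.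
have lx : 4 <= ln (x%:R / y).
  by rewrite -(expRK 4) ler_ln ?posrE ?expR_gt0 ?divr_gt0 // (le_trans C4).
have chern : Pr A p (fun E => x%:R <= \sum_(e in E) 1 :> R) <=
    expR (- ((ln (x%:R / y) - 1) * x%:R / 1)).
  apply: (@Pr_weight_ge R T A p (fun=> 1) 1 x%:R (ln (x%:R / y) - 1) N%:R) => //.
  - by rewrite subr_ge0 (le_trans _ lx) // ler1n.
  - by move=> e _; rewrite ler01 lexx.
  - by rewrite sumr_const ler_nat.
  rewrite addrCA subrr addr0 lnK ?posrE ?divr_gt0 //.
  rewrite -mulrA [p * _]mulrC -/y mulfVK // gt_eqF //.
rewrite [X in _ * X](_ : _ = Pr A p (fun E => x%:R <= \sum_(e in E) 1 :> R));
  last first.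
  by apply: eq_Ex => E _; rewrite sumr_const ler_nat.
apply: le_trans (ler_wpM2l (expR_ge0 _) chern) _.
rewrite /excess ifT // -expRD ler_expR divr1.
move: (ln _) lx Px => z lx Px; have := ltW Px; nra.
Qed.

Lemma Pr_excess_ge (U : {set T}) (I : finType) (A : I -> {set T}) (s : R) :
  (#|I| <= N)%N -> (forall i, #|A i| <= N)%N -> (forall i, A i \subset U) ->
  (forall i j, i != j -> [disjoint A i & A j]) ->
  Pr U p (fun E => s <= \sum_i excess C y #|E :&: A i|) <= expR (1 - s / 2).
Proof.
move=> IN AN AU dA; have p01 : 0 <= p <= 1 by rewrite ltW.
apply: le_trans (_ : Ex U p (fun E => expR (- (s / 2)) *
   \prod_(i <- enum I) expR (excess C y #|E :&: A i| / 2)) <= _).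
  apply: Ex_markov => // E EU.
    by rewrite mulr_ge0 ?expR_ge0 // prodr_ge0 // => i _; rewrite expR_ge0.
  move=> sE; rewrite -expR_sum -expRD -[leLHS]expR0 ler_expR -big_distrl /=.
  rewrite big_enum /=; lra.
rewrite ExZ (Ex_indep_prod p (fun i E => expR (excess C y #|E| / 2)))
  ?enum_uniq // addrC expRD ler_wpM2l ?expR_ge0 // big_enum /=.
apply: le_trans (_ : \prod_(i : I) expR (N.+1%:R * expR (- (C * y))) <= _).
  apply: ler_prod => i _; apply/andP; split.
    by apply: sumr_ge0 => E _; rewrite mulr_ge0 ?expR_ge0 ?subset_mass_ge0.
  exact: le_trans (Ex_block_excess (AN i)) (expR_ge1Dx _).
rewrite -expR_sum ler_expR sumr_const -[leLHS]mulr_natl; apply: le_trans small.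
rewrite mulrA.
apply: ler_wpM2r; first exact: expR_ge0.
by apply: ler_wpM2r; rewrite ?ler_nat.
Qed.

End BlockDegrees.

(** * Edges, degrees and labelled triangles *)
Section Graphs.

Variable n : nat.
Local Notation V := 'I_n.
Implicit Types (x y z : V) (E A : {set {set V}}).

Definition edge x y : {set V} := [set x; y]%SET.

Definition nbrs E x : {set V} := [set y | edge x y \in E]%SET.

Definition tri E : nat :=
  (\sum_x \sum_y \sum_z
     ((edge x y \in E) && (edge y z \in E) && (edge x z \in E)))%N.

Lemma edgeC x y : edge x y = edge y x.
Proof. exact: finset.setUC. Qed.

Lemma in_nbrs E x y : (y \in nbrs E x) = (edge x y \in E).
Proof. by rewrite inE. Qed.

Lemma edge_vpairs x y : (edge x y \in vpairs n) = (x != y).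
Proof. by rewrite inE cards2; case: (x == y). Qed.

Lemma edge_neq E x y : E \subset vpairs n -> edge x y \in E -> x != y.
Proof. by move=> EU /(fintype.subsetP EU); rewrite edge_vpairs. Qed.

Lemma edge_eq a b x y : a != b ->
  (edge x y == edge a b) = ((x, y) == (a, b)) || ((x, y) == (b, a)).
Proof.
move=> ab; apply/eqP/orP => [e|[] /eqP[-> ->] //]; last exact: edgeC.
have := finset.set21 x y; rewrite -/(edge x y) e !inE => xab.
have := finset.set22 x y; rewrite -/(edge x y) e !inE => yab.
have := finset.set21 a b; rewrite -/(edge a b) -e !inE => axy.
have := finset.set22 a b; rewrite -/(edge a b) -e !inE => bxy.
move: xab yab axy bxy.
case/orP => /eqP->; case/orP => /eqP->;
  rewrite ?eqxx ?(eq_sym b a) ?(negbTE ab) //; by [left|right].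
Qed.

Lemma vpairsP e : e \in vpairs n -> exists a b, a != b /\ e = edge a b.
Proof. by rewrite inE => /cards2P[a [b [ab ->]]]; exists a, b. Qed.

Lemma handshake (M : nmodType) E (f : {set V} -> M) : E \subset vpairs n ->
  \sum_x \sum_(y in nbrs E x) f (edge x y) = (\sum_(e in E) f e) *+ 2.
Proof.
move=> EU; rewrite pair_big_dep /=.
rewrite (partition_big (fun q => edge q.1 q.2) (mem E)) /=; last first.
  by move=> [x y] /=; rewrite in_nbrs.
rewrite -sumrMnl; apply: eq_bigr => e eE.
have [a [b [ab eab]]] := vpairsP (fintype.subsetP EU _ eE).
rewrite (eq_bigl (fun q => q \in [set (a, b); (b, a)]%SET)); last first.
  move=> [x y] /=; rewrite in_nbrs !inE eab -edge_eq //.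
  by case: eqP => [->|_]; rewrite ?andbF // -eab eE.
rewrite finset.big_setU1 /= ?inE; last first.
  by rewrite xpair_eqE (negbTE ab).
by rewrite big_set1 /= (edgeC b) -eab mulr2n.
Qed.

(** An edge is an unordered pair, so a sum over ordered pairs counts each edge
    twice; this double counting is used for degrees, for codegrees and for
    triangles at a vertex. *)
Lemma sum_edges (M : nmodType) E (f : {set V} -> M) : E \subset vpairs n ->
  \sum_x \sum_y (if edge x y \in E then f (edge x y) else 0) =
  (\sum_(e in E) f e) *+ 2.
Proof.
move=> EU; rewrite -handshake //; apply: eq_bigr => x _.
by rewrite -big_mkcond; apply: eq_bigl => y; rewrite in_nbrs.
Qed.

Lemma sum_deg E : E \subset vpairs n -> (\sum_x #|nbrs E x| = 2 * #|E|)%N.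
Proof.
move=> EU; transitivity (\sum_x \sum_(y in nbrs E x) 1)%N.
  by apply: eq_bigr => x _; rewrite sum1_card.
by rewrite (handshake (fun=> 1%N) EU) sum1_card mul2n -addnn.
Qed.

Lemma sum3_rot (M : nmodType) (f : V -> V -> V -> M) :
  \sum_x \sum_y \sum_z f x y z = \sum_x \sum_y \sum_z f y z x.
Proof.
rewrite -[RHS]exchange_big /=; apply: eq_bigr => x _.
by rewrite exchange_big.
Qed.

Lemma sum3_swap (M : nmodType) (f : V -> V -> V -> M) :
  \sum_x \sum_y \sum_z f x y z = \sum_x \sum_y \sum_z f x z y.
Proof. by apply: eq_bigr => x _; rewrite exchange_big. Qed.

Lemma sum3D (M : nmodType) (f g : V -> V -> V -> M) :
  \sum_x \sum_y \sum_z (f x y z + g x y z) =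
  \sum_x \sum_y \sum_z f x y z + \sum_x \sum_y \sum_z g x y z.
Proof.
rewrite -big_split; apply: eq_bigr => x _.
by rewrite -big_split; apply: eq_bigr => y _; rewrite -big_split.
Qed.

Lemma NtriangleE E : E \subset vpairs n -> Ntriangle E = tri E.
Proof.
move=> EU; rewrite /Ntriangle -sum1_card big_mkcond /=.
pose i0 : 'I_3 := @Ordinal 3 0 isT.
pose i1 : 'I_3 := @Ordinal 3 1 isT.
pose i2 : 'I_3 := @Ordinal 3 2 isT.
have I3 (P : 'I_3 -> Prop) : P i0 -> P i1 -> P i2 -> forall i, P i.
  by move=> P0 P1 P2 [[|[|[|//]]] Hi];
    [rewrite (_ : Ordinal _ = i0)|rewrite (_ : Ordinal _ = i1)
    |rewrite (_ : Ordinal _ = i2)] => //; apply: val_inj.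
pose g (t : V * V * V) : {ffun 'I_3 -> V} :=
  [ffun i => if i == i0 then t.1.1 else if i == i1 then t.1.2 else t.2].
pose h (f : {ffun 'I_3 -> V}) := (f i0, f i1, f i2).
have gh : cancel g h by move=> [[x y] z]; rewrite /h /g !ffunE.
have hg : cancel h g.
  by move=> f; apply/ffunP; apply: (I3); rewrite /g /h ffunE.
rewrite (reindex g) /=; last by exists h => t _; [apply: gh | apply: hg].
rewrite /tri pair_big pair_big /=; apply: eq_bigr => [[[x y] z]] _ /=.
rewrite inE; set t := (x, y, z).
have gE : (g t i0 = x) * (g t i1 = y) * (g t i2 = z) by rewrite /g !ffunE.
suff -> : injectiveb (g t) && [forall i, forall j,
    (i != j) ==> ([set g t i; g t j]%SET \in E)] =
    (edge x y \in E) && (edge y z \in E) && (edge x z \in E).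
  by case: ((_ && _) && _).
apply/andP/andP => [[_ /forallP H]|[/andP[xy yz] xz]].
  have := forallP (H i0) i1; have := forallP (H i1) i2.
  have := forallP (H i0) i2; rewrite !gE /= => xz yz xy.
  by rewrite /edge xy yz xz.
have nxy := edge_neq EU xy; have nyz := edge_neq EU yz.
have nxz := edge_neq EU xz.
split.
  apply/injectiveP; apply: (I3); apply: (I3); rewrite !gE // => e;
    by move: nxy nyz nxz; rewrite e eqxx.
apply/forallP; apply: (I3); apply/forallP; apply: (I3); rewrite ?eqxx //= !gE;
  rewrite -/(edge _ _) //; by rewrite edgeC.
Qed.

End Graphs.

(** * The conditional mean of the number of triangles *)
Section TriangleMean.

Variables (R : realType) (n : nat).
Local Notation V := 'I_n.
Implicit Types (x y z : V) (E A : {set {set V}}) (p : R).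

Definition distinct3 : pred (V * V * V) :=
  fun t => [&& t.1.1 != t.1.2, t.1.2 != t.2 & t.1.1 != t.2].

Definition triangle_edges (t : V * V * V) : {set {set V}} :=
  [set edge t.1.1 t.1.2; edge t.1.2 t.2; edge t.1.1 t.2]%SET.

Definition tri_mean p A : R := cond_mean p distinct3 triangle_edges A.

Lemma sum_triple (M : nmodType) (F : V * V * V -> M) :
  \sum_t F t = \sum_x \sum_y \sum_z F (x, y, z).
Proof.
rewrite pair_bigA pair_bigA /=.
by apply: eq_bigr => [[[x y] z]] _.
Qed.

Lemma triangle_edges_vpairs t :
  distinct3 t -> triangle_edges t \subset vpairs n.
Proof.
case: t => [[x y] z] /and3P[/= xy yz xz].
by rewrite !finset.subUset !finset.sub1set !edge_vpairs xy yz.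
Qed.

Lemma big_triangle_edges (M : Type) (idx : M) (op : Monoid.com_law idx)
    (f : {set V} -> M) x y z : distinct3 (x, y, z) ->
  \big[op/idx]_(e in triangle_edges (x, y, z)) f e =
  op (f (edge x y)) (op (f (edge y z)) (f (edge x z))).
Proof.
case/and3P => /= xy yz xz; rewrite /triangle_edges /=.
have e1 : edge x y != edge x z.
  by rewrite edge_eq // !xpair_eqE eqxx (negbTE yz) (negbTE xz).
have e2 : edge y z != edge x z.
  by rewrite edge_eq // !xpair_eqE (eq_sym y x) (negbTE xy) (negbTE yz).
have e3 : edge x y != edge y z.
  by rewrite edge_eq // !xpair_eqE (negbTE xy) (negbTE xz).
rewrite finset.setUC finset.big_setU1 /=; last first.
  by rewrite !inE negb_or eq_sym e1 eq_sym e2.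
rewrite finset.big_setU1 ?inE //= big_set1.
by rewrite Monoid.mulmC /= -Monoid.mulmA.
Qed.

Lemma card_triangle_edges t : distinct3 t -> #|triangle_edges t| = 3%N.
Proof.
by case: t => [[x y] z] d; rewrite -sum1_card big_triangle_edges.
Qed.

Lemma copies_tri E : E \subset vpairs n ->
  copies R distinct3 triangle_edges E = (tri E)%:R.
Proof.
move=> EU; rewrite /copies /tri big_mkcond /= sum_triple natr_sum.
apply: eq_bigr => x _; rewrite natr_sum; apply: eq_bigr => y _.
rewrite natr_sum; apply: eq_bigr => z _.
rewrite !finset.subUset !finset.sub1set /=; case: ifP => // /negP d.
case: (boolP (_ && _)) => // /andP[/andP[xy yz] xz]; case: d.
by apply/and3P; split=> /=; [apply: edge_neq xy|apply: edge_neq yz|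
  apply: edge_neq xz].
Qed.

Lemma card_distinct3 : #|distinct3| = (n ^_ 3)%N.
Proof.
rewrite -sum1_card big_mkcond /= sum_triple.
have in2 x y : x != y ->
    (\sum_z (if (x, y, z) \in distinct3 then 1 else 0) = n - 2)%N.
  move=> xy; rewrite -big_mkcond sum1_card /=.
  have := cardsC [set x; y]%SET; rewrite cards2 xy card_ord => nE.
  rewrite -[in RHS]nE addKn; apply: eq_card => z; rewrite !inE /=.
  by rewrite negb_or andbC !(eq_sym z).
transitivity (\sum_(x : V) \sum_(y : V | y != x) (n - 2))%N.
  apply: eq_bigr => x _; rewrite [RHS]big_mkcond; apply: eq_bigr => y _.
  case: eqVneq => [->|yx]; last by apply: in2; rewrite eq_sym.
  by rewrite /= big1 // => z _; rewrite unfold_in /distinct3 /= eqxx.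
under eq_bigr => x _.
  rewrite sum_nat_const (_ : #|_| = n.-1); last first.
    by have := cardC1 x; rewrite card_ord => cE; rewrite -[in RHS]cE;
      apply: eq_card => y; rewrite !inE.
  over.
rewrite sum_nat_const card_ord; case: n => [|[|[|m]]] //.
by rewrite !ffactnS ffactn0 muln1 /=; lia.
Qed.

Lemma pow_triangle_cost p A x y z : distinct3 (x, y, z) ->
  p ^+ #|triangle_edges (x, y, z) :\: A| =
  (if edge x y \in A then 1 else p) * ((if edge y z \in A then 1 else p) *
   (if edge x z \in A then 1 else p)).
Proof.
move=> d; rewrite -(big_triangle_edges _ (fun e => if e \in A then 1 else p) d).
rewrite -prodr_const big_mkcond [RHS]big_mkcond; apply: eq_bigr => e _ /=.
by rewrite inE; case: (e \in A); case: (e \in _).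
Qed.

Lemma sum_adj A x : \sum_y ((edge x y \in A)%:R : R) = #|nbrs A x|%:R.
Proof.
rewrite -sum1_card natr_sum [RHS]big_mkcond /=; apply: eq_bigr => y _.
by rewrite in_nbrs; case: (_ \in A).
Qed.

Lemma sum_deg_R A : A \subset vpairs n ->
  \sum_x (#|nbrs A x|%:R : R) = 2 * #|A|%:R.
Proof. by move=> AU; rewrite -natr_sum sum_deg // natrM. Qed.

(** The probability of a triangle given [A] is a product of three factors, each
    at most p + (indicator of the edge in A); expanding the product sorts the
    triangles by the number of their edges in [A]. *)
Lemma tri_mean_le p A : 0 <= p -> A \subset vpairs n ->
  tri_mean p A <= p ^+ 3 * (n ^_ 3)%:R + 6 * p ^+ 2 * n%:R * #|A|%:R +
    3 * p * \sum_x #|nbrs A x|%:R ^+ 2 + (tri A)%:R.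
Proof.
move=> p0 AU; pose a x y : R := (edge x y \in A)%:R.
have aC x y : a x y = a y x by rewrite /a edgeC.
pose S := fun f : V -> V -> V -> R => \sum_x \sum_y \sum_z f x y z.
have S1 : S (fun x y _ => a x y) = n%:R * (2 * #|A|%:R).
  rewrite -sum_deg_R // big_distrr /=; apply: eq_bigr => x _.
  rewrite -sum_adj big_distrr /=; apply: eq_bigr => y _.
  by rewrite sumr_const card_ord mulr_natl.
have S2 : S (fun x y z => a x y * a x z) = \sum_x #|nbrs A x|%:R ^+ 2.
  apply: eq_bigr => x _; rewrite -sum_adj expr2 big_distrl /=.
  by apply: eq_bigr => y _; rewrite big_distrr.
have rot f : S f = S (fun x y z => f y z x) := sum3_rot f.
have swp f : S f = S (fun x y z => f x z y) := sum3_swap f.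
have SD f g : S (fun x y z => f x y z + g x y z) = S f + S g := sum3D f g.
have SZ c f : S (fun x y z => c * f x y z) = c * S f.
  rewrite /S big_distrr; apply: eq_bigr => x _.
  by rewrite big_distrr; apply: eq_bigr => y _; rewrite big_distrr.
have S1b : S (fun x y z => a y z) = n%:R * (2 * #|A|%:R).
  by rewrite -S1 [RHS]rot.
have S1c : S (fun x y z => a x z) = n%:R * (2 * #|A|%:R).
  by rewrite -S1 [RHS]swp.
have S2b : S (fun x y z => a x y * a y z) = \sum_x #|nbrs A x|%:R ^+ 2.
  rewrite -S2 [RHS]rot.
  apply: eq_bigr => x _; apply: eq_bigr => y _; apply: eq_bigr => z _.
  by rewrite mulrC (aC x y).
have S2c : S (fun x y z => a y z * a x z) = \sum_x #|nbrs A x|%:R ^+ 2.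
  rewrite -S2 [RHS]rot [RHS]rot.
  apply: eq_bigr => x _; apply: eq_bigr => y _; apply: eq_bigr => z _.
  by rewrite mulrC (aC x z) (aC y z).
have S3 : S (fun x y z => a x y * a y z * a x z) = (tri A)%:R.
  rewrite /tri natr_sum; apply: eq_bigr => x _; rewrite natr_sum.
  apply: eq_bigr => y _; rewrite natr_sum; apply: eq_bigr => z _.
  by rewrite /a -!natrM !mulnb.
apply: le_trans (_ : \sum_t ((if distinct3 t then p ^+ 3 else 0) +
    (p ^+ 2 * (a t.1.1 t.1.2 + a t.1.2 t.2 + a t.1.1 t.2) +
     p * (a t.1.1 t.1.2 * a t.1.1 t.2 + a t.1.1 t.1.2 * a t.1.2 t.2 +
          a t.1.2 t.2 * a t.1.1 t.2) +
     a t.1.1 t.1.2 * a t.1.2 t.2 * a t.1.1 t.2)) <= _).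
  rewrite /tri_mean /cond_mean big_mkcond; apply: ler_sum => [[[x y] z]] _.
  case: ifP => d; last first.
    by rewrite add0r /a !(addr_ge0, mulr_ge0, exprn_ge0, ler0n).
  rewrite pow_triangle_cost // /a /=.
  have p2 := exprn_ge0 2 p0; have p3 := exprn_ge0 3 p0.
  by case: (_ \in A); case: (_ \in A); case: (_ \in A) => /=; nra.
rewrite big_split /= -big_mkcond /= sumr_const card_distinct3.
rewrite sum_triple -[X in _ + X]/(S (fun x y z =>
    (p ^+ 2 * (a x y + a y z + a x z) +
     p * (a x y * a x z + a x y * a y z + a y z * a x z) +
     a x y * a y z * a x z))) !(SD, SZ) S1 S1b S1c S2 S2b S2c S3.
by rewrite -mulr_natr; lra.
Qed.

(** Every triangle has conditional probability at least [p ^+ 3], and those in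
    [Q] have at least [p ^+ j]. *)
Lemma tri_mean_ge p A (Q : pred (V * V * V)) (j : nat) :
  0 <= p <= 1 -> (forall t, Q t -> distinct3 t) ->
  (forall t, Q t -> #|triangle_edges t :\: A| <= j)%N ->
  p ^+ 3 * (n ^_ 3)%:R + (p ^+ j - p ^+ 3) * #|Q|%:R <= tri_mean p A.
Proof.
move=> /andP[p0 p1] Qd Qj.
rewrite -card_distinct3 -sum1_card -(sum1_card Q) !natr_sum !big_distrr /=.
rewrite /tri_mean /cond_mean [X in X + _]big_mkcond [X in _ + X]big_mkcond.
rewrite [leRHS]big_mkcond -big_split; apply: ler_sum => t _ /=.
rewrite !mulr1 -[t \in Q]/(Q t) -[t \in distinct3]/(distinct3 t).
case: (boolP (Q t)) => Qt.
  by rewrite (Qd _ Qt) addrCA subrr addr0 ler_wiXn2l // Qj.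
rewrite addr0; case: ifP => // d; rewrite ler_wiXn2l //.
by rewrite -(card_triangle_edges d) subset_leq_card ?finset.subsetDl.
Qed.

End TriangleMean.

Lemma ffact3_ge (R : realType) (n : nat) : (6 <= n)%N ->
  n%:R ^+ 3 / 2 <= (n ^_ 3)%:R :> R.
Proof.
case: n => [|[|[|q]]] // q6.
have q3 : 3 <= q%:R :> R by rewrite ler_nat.
rewrite !ffactnS ffactn0 muln1 /= !natrM.
have e1 : q.+1%:R = q%:R + 1 :> R by rewrite natr1.
have e2 : q.+2%:R = q%:R + 2 :> R by rewrite -addn2 natrD.
have e3 : q.+3%:R = q%:R + 3 :> R by rewrite -addn3 natrD.
rewrite e1 e2 e3; move: (q%:R) q3 => a a3; clear -a3.
have a1 : 0 <= a + 3 by lra.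
have a2 : 0 <= a ^+ 2 / 2 - 5 / 2 by nra.
have := mulr_ge0 a1 a2; lra.
Qed.

Lemma ffact3_le (R : realType) (n : nat) : (n ^_ 3)%:R <= n%:R ^+ 3 :> R.
Proof.
rewrite -natrX ler_nat !ffactnS ffactn0 muln1 !expnS expn0 muln1.
by rewrite !leq_mul // ?leq_pred // (leq_trans (leq_pred _)) // leq_pred.
Qed.

(** * Deleting edges and vertices *)
Section Counting.

Variable n : nat.
Local Notation V := 'I_n.
Implicit Types (x y z : V) (E A : {set {set V}}) (H B : {set V}).

Definition triangle A x y z : bool :=
  (edge x y \in A) && (edge y z \in A) && (edge x z \in A).

Lemma triangle_rot A x y z : triangle A x y z = triangle A y z x.
Proof. by rewrite /triangle (edgeC x z) (edgeC x y) -andbA andbC. Qed.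

Definition codeg A (e : {set V}) : nat :=
  #|[set z | [forall x, (x \in e) ==> (edge x z \in A)]]%SET|.

Lemma codeg_edge A x y : codeg A (edge x y) = #|nbrs A x :&: nbrs A y|.
Proof.
apply: eq_card => z; rewrite !inE; apply/forallP/andP => [h|[h1 h2] v].
  by have := h x; have := h y; rewrite !inE !eqxx orbT.
by apply/implyP; rewrite !inE => /orP[] /eqP->.
Qed.

Lemma sum_triangle_codeg A x y :
  (\sum_z triangle A x y z = (edge x y \in A) * codeg A (edge x y))%N.
Proof.
rewrite codeg_edge -sum1_card [X in (_ * X)%N]big_mkcond big_distrr /=.
apply: eq_bigr => z _.
rewrite !inE /triangle; case: (edge x y \in A) => /=.
  by rewrite mul1n andbC; case: (_ && _).
by rewrite mul0n.
Qed.

Lemma sum_triangle_nbrs A x : A \subset vpairs n ->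
  (\sum_y \sum_z triangle A x y z =
     2 * #|[set e in A | e \subset nbrs A x]|)%N.
Proof.
move=> AU.
transitivity (\sum_y \sum_z (if edge y z \in A
    then (edge y z \subset nbrs A x : nat) else 0))%N.
  apply: eq_bigr => y _; apply: eq_bigr => z _.
  rewrite finset.subUset !finset.sub1set !in_nbrs /triangle.
  by case: (edge y z \in A); rewrite ?andbT ?andbF.
rewrite (sum_edges (fun e : {set V} => (e \subset nbrs A x) : nat) AU).
rewrite mul2n -addnn mulr2n -sum1_card; congr (_ + _)%N;
  by rewrite big_mkcond [RHS]big_mkcond; apply: eq_bigr => e _;
     rewrite inE; case: (e \in A); case: (_ \subset _).
Qed.

Lemma tri_remove_edge A e : A \subset vpairs n -> e \in A ->
  (tri A <= tri (A :\ e) + 6 * codeg A e)%N.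
Proof.
move=> AU eA; have eU : [set e]%SET \subset vpairs n.
  by rewrite finset.sub1set (fintype.subsetP AU).
pose T x y z := ((edge x y == e) * triangle A x y z)%N.
have ST : (\sum_x \sum_y \sum_z T x y z = 2 * codeg A e)%N.
  transitivity (\sum_x \sum_y (if edge x y \in [set e]%SET
      then codeg A (edge x y) else 0))%N.
    apply: eq_bigr => x _; apply: eq_bigr => y _.
    rewrite -big_distrr /= sum_triangle_codeg inE.
    by case: eqP => [->|]; rewrite ?eA ?mul0n ?mul1n.
  by rewrite (sum_edges (codeg A) eU) big_set1 mul2n -addnn.
apply: (@leq_trans (\sum_x \sum_y \sum_z
   (triangle (A :\ e) x y z + (T x y z + (T y z x + T z x y))))%N).
  apply: leq_sum => x _; apply: leq_sum => y _; apply: leq_sum => z _.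
  rewrite /T -(triangle_rot A z x y) -(triangle_rot A x y z).
  case: (boolP (triangle A x y z)) => [t|nt]; last first.
    suff /negbTE-> : ~~ ((edge x y \in A) && (edge y z \in A) &&
       (edge x z \in A)) by [].
    exact: nt.
  have /andP[/andP[xy yz] xz] := t; rewrite xy yz xz !muln1.
  rewrite /triangle !inE !(edgeC z x) !(edgeC z y) xy yz xz !andbT /=.
  by move: (edge x y == e) (edge y z == e) (edge x z == e) => [] [] [].
have SD := @sum3D n nat;
  rewrite !SD leq_add2l -(sum3_rot T) -(sum3_rot (fun x y z => T y z x)).
rewrite -(sum3_rot T) ST; lia.
Qed.

End Counting.

Section Pruning.

Variables (R : realType) (n : nat).
Local Notation V := 'I_n.
Implicit Types (x y z : V) (E A : {set {set V}}) (H B : {set V}).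

(** The subset that maximizes the number of triangles minus [6 * t] times the
    number of edges works: deleting one of its edges cannot increase this
    quantity, but it destroys only 6 labelled triangles per common
    neighbour of the ends of the edge. *)
Lemma exists_pruned (t : R) A : A \subset vpairs n -> 0 <= t ->
  exists A' : {set {set V}}, [/\ A' \subset A,
    (tri A)%:R - 6 * t * #|A|%:R <= (tri A')%:R &
    forall e, e \in A' -> t <= (codeg A' e)%:R].
Proof.
move=> AU t0; pose F (B : {set {set V}}) : R := (tri B)%:R - 6 * t * #|B|%:R.
pose P := [pred B : {set {set V}} | B \subset A].
have PA : P A by rewrite /= fintype.subxx.
case: (@Order.TotalTheory.arg_maxP _ _ _ A P F PA) => A' /= A'A maxA'.
exists A'; split=> // [|e eA'].
  apply: le_trans (maxA' A PA) _.
  by rewrite /F gerBl mulr_ge0 // mulr_ge0.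
have eB : A' :\ e \subset A by rewrite (fintype.subset_trans (finset.subD1set _ _)).
have /= := maxA' _ eB; rewrite /F.
have := tri_remove_edge (fintype.subset_trans A'A AU) eA'.
rewrite -(ler_nat R) natrD natrM.
rewrite (cardsD1 e A') eA' natrD /=; lra.
Qed.

Definition avoid H A : {set {set V}} := [set e in A | [disjoint e & H]]%SET.

(** A labelled triangle that meets [H] has one of its three positions in [H];
    the factor 6 accounts for the position and the order of the other two
    vertices, which form an edge inside the neighbourhood of the first. *)
Lemma tri_avoid H A : A \subset vpairs n ->
  (tri A <= tri (avoid H A) +
     6 * \sum_(e in A) #|[set x in H | e \subset nbrs A x]|)%N.
Proof.
move=> AU; pose T x y z := ((x \in H) * triangle A x y z)%N.
have ST : (\sum_x \sum_y \sum_z T x y z =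
    2 * \sum_(e in A) #|[set x in H | e \subset nbrs A x]|)%N.
  transitivity (\sum_(x in H) \sum_(e in A) 2 * (e \subset nbrs A x))%N.
    rewrite [RHS]big_mkcond; apply: eq_bigr => x _.
    transitivity ((x \in H) * \sum_y \sum_z triangle A x y z)%N.
      rewrite big_distrr; apply: eq_bigr => y _.
      by rewrite big_distrr.
    rewrite sum_triangle_nbrs //; case: (x \in H); last by rewrite mul0n.
    rewrite mul1n -big_distrr -sum1_card /=; congr (_ * _)%N.
    rewrite big_mkcond [RHS]big_mkcond; apply: eq_bigr => e _.
    by rewrite inE; case: (e \in A); case: (_ \subset _).
  rewrite exchange_big big_distrr; apply: eq_bigr => e _ /=.
  rewrite -big_distrr -sum1_card /=; congr (_ * _)%N.
  rewrite big_mkcond [RHS]big_mkcond; apply: eq_bigr => x _.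
  by rewrite inE; case: (x \in H); case: (_ \subset _).
apply: (@leq_trans (\sum_x \sum_y \sum_z
   (triangle (avoid H A) x y z + (T x y z + (T y z x + T z x y))))%N).
  apply: leq_sum => x _; apply: leq_sum => y _; apply: leq_sum => z _.
  rewrite /T -(triangle_rot A z x y) -(triangle_rot A x y z).
  case: (boolP (triangle A x y z)) => [t|nt]; last first.
    suff /negbTE-> : ~~ ((edge x y \in A) && (edge y z \in A) &&
       (edge x z \in A)) by [].
    exact: nt.
  have /andP[/andP[xy yz] xz] := t; rewrite xy yz xz !muln1.
  have dE a b : [disjoint edge a b & H] = (a \notin H) && (b \notin H).
    by rewrite finset.disjoints_subset finset.subUset !finset.sub1set !finset.in_setC.
  rewrite /triangle !inE !(edgeC z x) !(edgeC z y) xy yz xz !dE /=.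
  by move: (x \in H) (y \in H) (z \in H) => [] [] [].
have SD := @sum3D n nat;
  rewrite !SD leq_add2l -(sum3_rot T) -(sum3_rot (fun x y z => T y z x)).
rewrite -(sum3_rot T) ST; lia.
Qed.

Lemma tri_avoid_card H A : A \subset vpairs n ->
  (tri A <= tri (avoid H A) + 6 * (#|A| * #|H|))%N.
Proof.
move=> AU; apply: leq_trans (tri_avoid H AU) _.
rewrite leq_add2l leq_mul2l /= -sum_nat_const; apply: leq_sum => e _.
by apply: subset_leq_card; apply/fintype.subsetP => x; rewrite inE => /andP[].
Qed.

(** The number of edges inside the neighbourhood of a vertex of degree d is at
    most min (d^2 / 2, |A|), hence at most d (|A| / 2)^(1/2); now sum over the
    vertices. *)
Lemma tri_sqr_le A : A \subset vpairs n ->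
  (tri A)%:R ^+ 2 <= (2 * #|A|%:R) ^+ 3 :> R.
Proof.
move=> AU; set M : R := 2 * #|A|%:R.
have M0 : 0 <= M by rewrite mulr_ge0.
pose s := Num.sqrt M; have s0 : 0 <= s := sqrtr_ge0 _.
have sE : s ^+ 2 = M by rewrite sqr_sqrtr.
suff h : (tri A)%:R <= s * M.
  have : (tri A)%:R ^+ 2 <= (s * M) ^+ 2 by rewrite lerXn2r ?nnegrE ?mulr_ge0.
  by rewrite exprMn sE; congr (_ <= _); ring.
rewrite /M -sum_deg_R // big_distrr /tri natr_sum /=; apply: ler_sum => x _.
set d := #|nbrs A x|; set S : nat := (\sum_y _)%N.
have S1 : (S <= d * d)%N.
  rewrite /S -(big_mkcond (fun=> true)) /= /d -!sum1_card big_distrl /=.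
  rewrite [leqRHS]big_mkcond; apply: leq_sum => y _; rewrite in_nbrs.
  case: (edge x y \in A); last by rewrite big1.
  rewrite mul1n [leqRHS]big_mkcond; apply: leq_sum => z _; rewrite in_nbrs.
  by case: (_ \in A); case: (_ \in A).
have S2 : (S <= 2 * #|A|)%N.
  rewrite /S sum_triangle_nbrs // leq_mul2l /=; apply: subset_leq_card.
  by apply/fintype.subsetP => e; rewrite inE => /andP[].
move: S1 S2; rewrite -!(ler_nat R) !natrM -/M -sE.
have d0 : 0 <= d%:R :> R by [].
move: (S%:R) (d%:R) d0 => a b b0.
have [h|h] := leP b s; nra.
Qed.

End Pruning.

(** * Fingerprints and containers *)
Section Containers.

Variable (R : realType).

(** Weigh each set [S] by exp (b (f - |S|)), which is at least 1 when
    |S| <= f, and sum over all sets. *)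
Lemma card_small_sets (X : finType) (f b : R) : 0 <= b ->
  \sum_(S : {set X} | #|S|%:R <= f) (1 : R) <=
    expR (b * f + expR (- b) * #|X|%:R).
Proof.
move=> b0.
apply: le_trans (_ : \sum_(S : {set X}) expR (b * f) * expR (- b) ^+ #|S| <= _).
  rewrite big_mkcond; apply: ler_sum => S _; case: ifP => Sf.
    rewrite -expRM_natl -expRD -[leLHS]expR0 ler_expR.
    rewrite (_ : _ + _ = b * (f - #|S|%:R)); last by ring.
    by rewrite mulr_ge0 ?subr_ge0.
  by rewrite mulr_ge0 ?exprn_ge0 ?expR_ge0.
rewrite -big_distrr expRD /= ler_wpM2l ?expR_ge0 //.
have -> : \sum_(S : {set X}) expR (- b) ^+ #|S| = \prod_(x : X) (expR (- b) + 1).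
  rewrite bigA_distr; apply: eq_bigr => S _.
  by rewrite -prodr_const big_mkcond.
rewrite mulr_natr -sumr_const expR_sum.
apply: ler_prod => x _; rewrite addr_ge0 ?expR_ge0 //=.
by rewrite addrC expR_ge1Dx.
Qed.

Lemma Pr_union_weight (T : finType) (U : {set T}) (p : R) (X : finType)
    (Q : pred {set X}) (w : {set X} -> T -> R) (f b h s a W : R) :
  0 <= p <= 1 -> 0 < h -> 0 <= a -> 0 <= b -> expR (1 + a) * p * W <= s ->
  (forall S, Q S -> #|S|%:R <= f) ->
  (forall S, Q S -> forall e, e \in U -> 0 <= w S e <= h) ->
  (forall S, Q S -> \sum_(e in U) w S e <= W) ->
  Pr U p (fun E => [exists S, Q S && (s <= \sum_(e in E) w S e)]) <=
    expR (b * f + expR (- b) * #|X|%:R - a * s / h).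
Proof.
move=> p01 h0 a0 b0 eW Qf Qw QW.
apply: le_trans (Pr_exists U Q (fun S E => s <= \sum_(e in E) w S e) p01) _.
apply: le_trans (_ : \sum_(S | Q S) expR (- (a * s / h)) <= _).
  by apply: ler_sum => S QS; apply: (Pr_weight_ge p01 h0 a0 (Qw _ QS) (QW _ QS)).
rewrite expRD; apply: le_trans (ler_wpM2r (expR_ge0 _) (card_small_sets X f b0)).
rewrite big_distrl /=; under [leRHS]eq_bigr do rewrite mul1r.
rewrite [leLHS]big_mkcond [leRHS]big_mkcond; apply: ler_sum => S _.
case: ifP => [QS|_]; first by rewrite Qf.
by case: ifP => // _; rewrite expR_ge0.
Qed.

Variable n : nat.
Local Notation V := 'I_n.
Implicit Types (x y z : V) (E A : {set {set V}}).

(** A set of pairs encodes the family of its fibres, a list of vertex sets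
    indexed by [K]; its cardinality is the total size of the list. *)
Definition fib (K : finType) (S : {set K * V}) (i : K) : {set V} :=
  [set v | (i, v) \in S]%SET.

Definition cover_mult (K : finType) (S : {set K * V}) (e : {set V}) : nat :=
  #|[set i | e \subset fib S i]%SET|.

Lemma card_pairs_in (B : {set V}) :
  (#|[set e in vpairs n | e \subset B]| <= #|B| ^ 2)%N.
Proof.
apply: (@leq_trans #|[set edge q.1 q.2 | q in finset.setX B B]%SET|).
  apply: subset_leq_card; apply/fintype.subsetP => e.
  rewrite inE => /andP[/vpairsP[a [b [ab ->]]]].
  rewrite finset.subUset !finset.sub1set => /andP[aB bB].
  by apply/imsetP; exists (a, b) => //; rewrite inE aB bB.
by rewrite (leq_trans (leq_imset_card _ _)) // cardsX mulnn.
Qed.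

Lemma sum_cover_mult (K : finType) (S : {set K * V}) :
  (\sum_(e in vpairs n) cover_mult S e <= \sum_i #|fib S i| ^ 2)%N.
Proof.
have -> : (\sum_(e in vpairs n) cover_mult S e =
           \sum_i #|[set e in vpairs n | e \subset fib S i]%SET|)%N.
  transitivity (\sum_(e in vpairs n) \sum_i (e \subset fib S i))%N.
    apply: eq_bigr => e _; rewrite /cover_mult -sum1_card big_mkcond /=.
    by apply: eq_bigr => i _; rewrite inE; case: (_ \subset _).
  rewrite exchange_big; apply: eq_bigr => i _ /=.
  rewrite -sum1_card big_mkcond [RHS]big_mkcond; apply: eq_bigr => e _.
  by rewrite [in RHS]inE; case: (e \in _); case: (_ \subset _).
by apply: leq_sum => i _; apply: card_pairs_in.
Qed.

Lemma sum_card_fib (K : finType) (S : {set K * V}) :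
  (\sum_i #|fib S i| = #|S|)%N.
Proof.
rewrite -sum1_card [RHS](partition_big fst predT) //=.
apply: eq_bigr => i _; rewrite -sum1_card.
rewrite [RHS](reindex_onto (fun v => (i, v)) snd) /=; last first.
  by move=> [j v] /= /andP[_ /eqP->].
by apply: eq_bigl => v; rewrite !inE !eqxx !andbT.
Qed.

Lemma sum_ffun_coord (k : nat) (g : V -> R) (i : 'I_k) :
  n%:R * \sum_(r : {ffun 'I_k -> V}) g (r i) = n%:R ^+ k * \sum_v g v.
Proof.
pose F (j : 'I_k) v := if j == i then g v else 1.
have -> : \sum_(r : {ffun 'I_k -> V}) g (r i) = \sum_(r : {ffun 'I_k -> V}) \prod_j
  F j (r j).
  apply: eq_bigr => r _; rewrite (bigD1 i) //= /F eqxx big1 ?mulr1 //.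
  by move=> j /negbTE->.
rewrite -bigA_distr_bigA (bigD1 i) //= mulrCA mulrC; congr (_ * _).
  rewrite (eq_bigr (fun=> n%:R)); last first.
    move=> j /negbTE ji; rewrite /F ji sumr_const card_ord //.
  rewrite prodr_const -exprS; congr (_ ^+ _).
  have := cardC1 i; rewrite card_ord => cE.
  rewrite (_ : #|_| = k.-1) ?prednK ?(leq_ltn_trans _ (ltn_ord i)) //.
by apply: eq_bigr => v _; rewrite /F eqxx.
Qed.

Lemma sum_ffun_avoid (k : nat) (B : {set V}) :
  \sum_(r : {ffun 'I_k -> V}) ([forall i, r i \notin B]%:R : R) =
  (n%:R - #|B|%:R) ^+ k.
Proof.
transitivity (\sum_(r : {ffun 'I_k -> V}) \prod_i ((r i \notin B)%:R : R)).
  apply: eq_bigr => r _; case: (boolP [forall _, _]) => [/forallP h|].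
    by rewrite big1 // => i _; rewrite h.
  by rewrite negb_forall => /existsP[i /negbTE h]; rewrite (bigD1 i) //= h mul0r.
rewrite -(bigA_distr_bigA (fun (i : 'I_k) v => (v \notin B)%:R)) prodr_const card_ord.
congr (_ ^+ _); have := cardsC B; rewrite card_ord => cE.
have -> : n%:R = #|B|%:R + #|~: B|%:R :> R by rewrite -natrD cE.
rewrite addrC addKr -sum1_card natr_sum [RHS]big_mkcond /=.
by apply: eq_bigr => v _; rewrite inE; case: (v \in B).
Qed.

(** Take the neighbourhoods of k independent uniform vertices.  Their total size
    has mean k times the average degree.  An edge with at least t common
    neighbours is missed by all of them with probability at most
    exp(- t k / n) <= exp(- 2) < 1/4, so some choice does well for both. *)
Lemma exists_fingerprint A (t D : R) (k : nat) : A \subset vpairs n ->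
  (0 < n)%N -> 0 < t ->
  (forall e, e \in A -> t <= (codeg A e)%:R) ->
  (forall x, #|nbrs A x|%:R <= D) -> 2 * n%:R <= t * k%:R ->
  exists S : {set 'I_k * V},
    [/\ #|S|%:R * n%:R <= 4 * k%:R * #|A|%:R :> R,
        forall i, #|fib S i|%:R <= D &
        (#|A| <= 2 * #|[set e in A | [exists i, e \subset fib S i]]|)%N].
Proof.
move=> AU n0 t0 tA DA tk.
have nR : 0 < n%:R :> R by rewrite ltr0n.
have D0 : 0 <= D by apply: le_trans (DA (Ordinal n0)).
have [->|A0] := eqVneq A finset.set0.
  exists finset.set0; split; rewrite ?cards0 ?mulr0 ?mul0r //.
  by move=> i; rewrite (_ : fib _ _ = finset.set0) ?cards0 //; apply/setP => v;
    rewrite !inE.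
have m0 : 0 < #|A|%:R :> R by rewrite ltr0n card_gt0.
have k0 : 0 < k%:R :> R.
  rewrite -(pmulr_rgt0 _ t0); apply: lt_le_trans tk; rewrite mulr_gt0 //.
pose Sr (r : {ffun 'I_k -> V}) : {set 'I_k * V} :=
  [set q | q.2 \in nbrs A (r q.1)]%SET.
have fibE r i : fib (Sr r) i = nbrs A (r i) by apply/setP => v; rewrite !inE.
pose cov r := [set e in A | [exists i, e \subset fib (Sr r) i]]%SET.
pose W r : R := #|Sr r|%:R.
pose C r : R := #|A|%:R - #|cov r|%:R.
have sumW : n%:R * \sum_r W r = n%:R ^+ k * (k%:R * (2 * #|A|%:R)).
  have WE r : W r = \sum_i #|nbrs A (r i)|%:R.
    rewrite /W -sum_card_fib natr_sum; apply: eq_bigr => i _.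
    by rewrite fibE.
  rewrite (eq_bigr _ (fun r _ => WE r)) exchange_big big_distrr /=.
  rewrite (eq_bigr _ (fun i _ => sum_ffun_coord (fun v => #|nbrs A v|%:R) i)).
  by rewrite sum_deg_R // sumr_const card_ord -mulr_natl; ring.
have sumC : \sum_r C r <= #|A|%:R * (n%:R ^+ k * expR (- 2)).
  have CE r : C r = \sum_(e in A) [forall i, r i \notin
      [set z | [forall x, (x \in e) ==> (edge x z \in A)]]%SET]%:R.
    rewrite /C -!sum1_card !natr_sum [X in _ - X]big_mkcond /=.
    rewrite [X in X - _]big_mkcond /= -sumrB [RHS]big_mkcond /=.
    apply: eq_bigr => e _; rewrite inE; case: (e \in A) => /=; last by rewrite subrr.
    rewrite (_ : [forall _, _] = ~~ [exists i, e \subset fib (Sr r) i]).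
      by case: [exists _, _]; rewrite ?subrr ?subr0.
    rewrite negb_exists; apply: eq_forallb => i; rewrite fibE; congr (~~ _).
    rewrite inE; apply/forallP/fintype.subsetP => h x; have := h x.
      by rewrite in_nbrs edgeC; move/implyP.
    by rewrite in_nbrs edgeC => h'; apply/implyP.
  rewrite (eq_bigr _ (fun r _ =>
    CE r)) exchange_big /= -[X in _ <= X%:R * _]sum1_card.
  rewrite natr_sum big_distrl /=; apply: ler_sum => e eA; rewrite mul1r.
  rewrite sum_ffun_avoid -/(codeg A e).
  have cn : (codeg A e <= n)%N by rewrite -[leqRHS]card_ord max_card.
  have le1 : n%:R - (codeg A e)%:R <= n%:R * expR (- (t / n%:R)) :> R.
    have := ler_wpM2l (ltW nR) (expR_ge1Dx (- (t / n%:R))).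
    apply: le_trans; rewrite mulrDr mulr1 mulrN lerB //.
    by rewrite mulrC divfK ?gt_eqF ?tA.
  apply: le_trans (_ : (n%:R * expR (- (t / n%:R))) ^+ k <= _).
    by rewrite lerXn2r ?nnegrE ?subr_ge0 ?ler_nat ?mulr_ge0 ?expR_ge0.
  rewrite exprMn ler_wpM2l ?exprn_ge0 // -expRM_natl ler_expR mulrN lerN2.
  by rewrite mulrA ler_pdivlMr // [k%:R * t]mulrC.
have eN2 : expR (- 2) * 4 < 1 :> R.
  rewrite expRN mulrC ltr_pdivrMr ?expR_gt0 // mul1r.
  have -> : expR 2 = expR 1 ^+ 2 :> R by rewrite -expRM_natl mulr1.
  have e1 : 2 < expR 1 :> R by have := @expR_gt1Dx R 1 (oner_neq0 _).
  nra.
(* Both normalized quantities have mean at most 1, the second one strictly,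
   so they cannot sum to at least 2 for every choice. *)
have [r /andP[rW rC]] : exists r, (W r * n%:R <= 4 * k%:R * #|A|%:R) && (2 * C r <=
  #|A|%:R).
  apply/existsP; apply: contraT; rewrite negb_exists => /forallP bad.
  have big : \sum_(r : {ffun 'I_k -> V}) (2 : R) <=
     \sum_r (W r * (n%:R / (2 * k%:R * #|A|%:R)) + C r * (4 / #|A|%:R)).
    apply: ler_sum => r _; have := bad r; rewrite negb_and -!ltNge.
    have W0 : 0 <= W r by [].
    have C0 : 0 <= C r.
      by rewrite subr_ge0 ler_nat subset_leq_card //; apply/fintype.subsetP => e;
        rewrite inE => /andP[].
    have q0 : 0 <= n%:R / (2 * k%:R * #|A|%:R) :> R by rewrite divr_ge0 // !mulr_ge0.
    have q1 : 0 <= 4 / #|A|%:R :> R by rewrite divr_ge0.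
    case/orP => h.
      rewrite -[leLHS]addr0 lerD ?mulr_ge0 // mulrA ler_pdivlMr ?mulr_gt0 //.
      by apply: le_trans (ltW h); lra.
    rewrite -[leLHS]add0r lerD ?mulr_ge0 // mulrA ler_pdivlMr //.
    lra.
  move: big; rewrite [leRHS]big_split /= -!mulr_suml sumr_const card_ffun !card_ord.
  rewrite -[leLHS]mulr_natl.
  have nk : 0 < n%:R ^+ k :> R by rewrite exprn_gt0.
  have -> : (\sum_r W r) * (n%:R / (2 * k%:R * #|A|%:R)) = n%:R ^+ k.
    rewrite mulrA [X in X / _]mulrC sumW; field.
    by rewrite !gt_eqF.
  have : (\sum_r C r) * (4 / #|A|%:R) <= n%:R ^+ k * (expR (- 2) * 4).
    rewrite [leLHS]mulrA ler_pdivrMr //; have := ler_wpM2r (ler0n R 4) sumC; lra.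
  rewrite natrX => h1 h2.
  have : n%:R ^+ k * (expR (- 2) * 4) < n%:R ^+ k * 1 :> R by rewrite ltr_pM2l.
  lra.
exists (Sr r); split=> //; first by move=> i; rewrite fibE.
rewrite -(ler_nat R) natrM -/(cov r); move: rC; rewrite /C; lra.
Qed.

End Containers.

(** * Three rare events *)
Section GraphEvents.

Variables (R : realType) (n : nat) (p : R).
Hypotheses (n0 : (0 < n)%N) (p0 : 0 < p) (p1 : p <= 1).
Local Notation V := 'I_n.
Local Notation U := (vpairs n).
Implicit Types (v w x y z : V) (E A : {set {set V}}).

Let p01 : 0 <= p <= 1. Proof. by rewrite ltW. Qed.

(** Orienting each edge towards its larger end splits the degree into two parts;
    the out-degrees of different vertices are independent, and so are the
    in-degrees. *)
Definition out_edges (v : V) : {set {set V}} :=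
  [set edge v y | y in [set y : V | (v < y)%N]%SET]%SET.

Definition in_edges (v : V) : {set {set V}} :=
  [set edge v y | y in [set y : V | (y < v)%N]%SET]%SET.

Lemma out_edges_vpairs v : out_edges v \subset U.
Proof.
apply/fintype.subsetP => e /imsetP[y]; rewrite inE => vy ->.
by rewrite edge_vpairs; apply: contraTneq vy => ->; rewrite ltnn.
Qed.

Lemma in_edges_vpairs v : in_edges v \subset U.
Proof.
apply/fintype.subsetP => e /imsetP[y]; rewrite inE => vy ->.
by rewrite edge_vpairs; apply: contraTneq vy => ->; rewrite ltnn.
Qed.

Lemma card_out_edges v : (#|out_edges v| <= n)%N.
Proof. by rewrite (leq_trans (leq_imset_card _ _)) // -[leqRHS]card_ord max_card. Qed.

Lemma card_in_edges v : (#|in_edges v| <= n)%N.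
Proof. by rewrite (leq_trans (leq_imset_card _ _)) // -[leqRHS]card_ord max_card. Qed.

Lemma out_edges_disjoint v w : v != w -> [disjoint out_edges v & out_edges w].
Proof.
move=> vw; rewrite disjoint_subset; apply/fintype.subsetP => e /imsetP[y].
rewrite inE => vy ->; rewrite inE; apply/negP => /imsetP[z].
rewrite inE => wz /eqP; rewrite edge_eq; last by apply: contraTneq wz => ->;
  rewrite ltnn.
rewrite !xpair_eqE (negbTE vw) /= => /andP[/eqP vz /eqP yw].
by move: vy wz; rewrite vz yw => h1 h2; have := ltn_trans h1 h2; rewrite ltnn.
Qed.

Lemma in_edges_disjoint v w : v != w -> [disjoint in_edges v & in_edges w].
Proof.
move=> vw; rewrite disjoint_subset; apply/fintype.subsetP => e /imsetP[y].
rewrite inE => vy ->; rewrite inE; apply/negP => /imsetP[z].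
rewrite inE => wz /eqP; rewrite edge_eq; last by apply: contraTneq wz => ->;
  rewrite ltnn.
rewrite !xpair_eqE (negbTE vw) /= => /andP[/eqP vz /eqP yw].
by move: vy wz; rewrite vz yw => h1 h2; have := ltn_trans h1 h2; rewrite ltnn.
Qed.

Lemma edge_inj v : injective (edge v).
Proof.
move=> x y e; have := finset.set22 v x; rewrite -/(edge v x) e !inE.
case/orP => /eqP // xv; have := finset.set22 v y; rewrite -/(edge v y) -e !inE xv.
by rewrite orbb => /eqP.
Qed.

Lemma card_nbrs_out_in E v : E \subset U ->
  (#|nbrs E v| = #|E :&: out_edges v| + #|E :&: in_edges v|)%N.
Proof.
move=> EU.
have cE (P : pred V) : #|E :&: [set edge v y | y in [set y | P y]]%SET| =
    #|[set y in nbrs E v | P y]%SET|.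
  rewrite -(card_imset _ (@edge_inj v)); apply: eq_card => e.
  rewrite !inE; apply/andP/imsetP => [[eE /imsetP[y]]|[y]].
    by rewrite inE => Py ey; exists y; rewrite // !inE -ey eE.
  rewrite !inE => /andP[vE Py] ->; split=> //.
  by apply/imsetP; exists y; rewrite ?inE.
rewrite /out_edges /in_edges (cE (fun y => (v < y)%N)) (cE (fun y => (y < v)%N)).
rewrite -cardsUI [X in (_ = _ + X)%N](_ : _ = 0)%N; last first.
  apply/eqP; rewrite cards_eq0; apply/eqP/setP => y; rewrite !inE.
  by apply/negP => /andP[/andP[_ h1] /andP[_ h2]]; have := ltn_trans h1 h2;
    rewrite ltnn.
rewrite addn0; apply: eq_card => y; rewrite !inE -andb_orr -neq_ltn.
case: (boolP (edge v y \in E)) => //= /(edge_neq EU).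
by rewrite -(inj_eq val_inj) => ->.
Qed.

(** The larger of the two parts is at least half of the sum, so passing to it
    costs a factor 2 in the linear term and at most a factor 2 in the
    logarithm. *)
Lemma excess_split (C y : R) (d1 d2 : nat) : 0 < y -> 2 <= C ->
  excess (2 * C) y (d1 + d2) <= 4 * (excess C y d1 + excess C y d2).
Proof.
move=> y0 C2.
have ge0 d : 0 <= excess C y d.
  rewrite /excess; case: ifP => // h; rewrite mulr_ge0 // ln_ge0 //.
  by rewrite ler_pdivlMr // mul1r; apply: le_trans (ltW h);
    rewrite ler_peMl // ?ltW //; lra.
wlog d21 : d1 d2 / (d2 <= d1)%N.
  by move=> H; case: (leqP d2 d1) => [/H//|/ltnW/H]; rewrite addnC [in leRHS]addrC.
apply: le_trans (_ : 4 * excess C y d1 <= _); last by rewrite ler_pM2l ?lerDl.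
rewrite /excess; case: ifP => [h|_]; last by rewrite mulr_ge0 // ge0.
have dle : (d1 + d2)%:R <= 2 * d1%:R :> R by rewrite -natrM ler_nat mul2n -addnn
  leq_add2l.
have Cd : C * y < d1%:R by lra.
rewrite Cd.
have d0 : 0 < d1%:R :> R by apply: lt_trans Cd; rewrite mulr_gt0 //; lra.
have q2 : 2 <= d1%:R / y.
  by rewrite ler_pdivlMr //; apply: le_trans (ltW Cd); rewrite ler_pM2r.
have l0 : 0 <= ln (d1%:R / y) by rewrite ln_ge0 //; lra.
have lle : ln ((d1 + d2)%:R / y) <= 2 * ln (d1%:R / y).
  have q0 : 0 < d1%:R / y by rewrite divr_gt0.
  rewrite [leRHS]mulr_natl mulr2n -lnM ?posrE // ler_ln ?posrE ?mulr_gt0 ?invr_gt0 //.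
    apply: le_trans (_ : 2 * (d1%:R / y) <= _); last by rewrite ler_pM2r.
    by rewrite mulrA ler_pM2r ?invr_gt0.
  by apply: lt_le_trans d0 _; rewrite ler_nat leq_addr.
have : (d1 + d2)%:R * ln ((d1 + d2)%:R / y) <= (2 * d1%:R) * (2 * ln (d1%:R / y)).
  apply: le_trans (_ : (d1 + d2)%:R * (2 * ln (d1%:R / y)) <= _).
    by rewrite ler_wpM2l.
  by rewrite ler_wpM2r // mulr_ge0.
lra.
Qed.

Lemma Pr_degree_excess (C s : R) : expR 4 <= C ->
  n%:R * n.+1%:R * expR (- (C * (n%:R * p))) <= 1 ->
  Pr U p (fun E => s <= \sum_v excess (2 * C) (n%:R * p) #|nbrs E v|) <=
    2 * expR (1 - s / 16).
Proof.
move=> C4 small; set y := n%:R * p.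
have y0 : 0 < y by rewrite mulr_gt0 ?ltr0n.
have C2 : 2 <= C.
  apply: le_trans C4; have := expR_ge1Dx (4 : R); lra.
apply: le_trans (_ : Pr U p (fun E =>
   (s / 8 <= \sum_v excess C y #|E :&: out_edges v|) ||
   (s / 8 <= \sum_v excess C y #|E :&: in_edges v|)) <= _).
  apply: le_Pr => // E EU sE.
  have : s <= 4 * (\sum_v excess C y #|E :&: out_edges v| +
                   \sum_v excess C y #|E :&: in_edges v|).
    apply: le_trans sE _; rewrite -big_split big_distrr /=; apply: ler_sum => v _.
    by rewrite card_nbrs_out_in // excess_split.
  case: leP => //= h1 h2; lra.
apply: le_trans (Pr_or _ _ _ p01) _.
have -> : 1 - s / 16 = 1 - (s / 8) / 2 by lra.
rewrite mulr_natl mulr2n; apply: lerD.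
  apply: (@Pr_excess_ge _ _ _ C n p0 p1 n0 C4 small) => [|||i j];
    first by rewrite card_ord.
  - exact: card_out_edges.
  - exact: out_edges_vpairs.
  - exact: out_edges_disjoint.
apply: (@Pr_excess_ge _ _ _ C n p0 p1 n0 C4 small) => [|||i j];
  first by rewrite card_ord.
- exact: card_in_edges.
- exact: in_edges_vpairs.
- exact: in_edges_disjoint.
Qed.

Definition high_deg (D : R) E : {set V} := [set v | D < #|nbrs E v|%:R]%SET.

(** Union bound over the possible neighbourhoods of the high-degree vertices,
    encoded as a set of pairs.  For fixed neighbourhoods the last sum is a
    weighted sum of independent edge indicators with weights at most [h] and
    total weight at most [W]. *)
Lemma Pr_hubs (D f h W s b : R) : 0 < h -> 0 <= b -> expR 2 * p * W <= s ->
  Pr U p (fun E => [&& \sum_(v in high_deg D E) #|nbrs E v|%:R <= f,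
      #|high_deg D E|%:R <= h, \sum_(v in high_deg D E) #|nbrs E v|%:R ^+ 2 <= W &
      s <= \sum_(e in E) #|[set x in high_deg D E | e \subset nbrs E x]%SET|%:R]) <=
    expR (b * f + expR (- b) * n%:R ^+ 2 - s / h).
Proof.
move=> h0 b0 eW.
pose Q (S : {set V * V}) := [&& #|S|%:R <= f,
   #|[set i | fib S i != finset.set0]%SET|%:R <= h &
   \sum_i #|fib S i|%:R ^+ 2 <= W].
pose w (S : {set V * V}) (e : {set V}) : R := (cover_mult S e)%:R.
apply: le_trans (_ : Pr U p (fun E => [exists S, Q S &&
    (s <= \sum_(e in E) (if e \in U then w S e else 0))]) <= _).
  apply: le_Pr => // E EU /and4P[h1 h2 h3 h4].
  pose S := [set q | (q.1 \in high_deg D E) && (q.2 \in nbrs E q.1)]%SET.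
  have fibE v : fib S v = if v \in high_deg D E then nbrs E v else finset.set0.
    by apply/setP => u; rewrite inE inE /=; case: ifP; rewrite ?inE.
  apply/existsP; exists S; apply/andP; split.
    apply/and3P; split.
    - rewrite -sum_card_fib natr_sum; apply: le_trans h1; rewrite [leRHS]big_mkcond.
      by apply: ler_sum => v _; rewrite fibE; case: ifP => //; rewrite cards0.
    - apply: le_trans h2; rewrite ler_nat; apply: subset_leq_card.
      by apply/fintype.subsetP => v; rewrite inE fibE; case: ifP; rewrite ?eqxx.
    apply: le_trans h3; rewrite [leRHS]big_mkcond; apply: ler_sum => v _.
    by rewrite fibE; case: ifP => //; rewrite cards0 expr0n.
  apply: le_trans h4 _; apply: ler_sum => e eE; rewrite (fintype.subsetP EU _ eE).
  rewrite ler_nat; apply: subset_leq_card; apply/fintype.subsetP => v.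
  by rewrite !inE fibE => /andP[vH eN]; rewrite inE vH.
have -> : s / h = 1 * s / h by rewrite mul1r.
have -> : n%:R ^+ 2 = #|{: V * V}|%:R :> R by rewrite card_prod card_ord expr2 natrM.
apply: (@Pr_union_weight _ _ U p _ Q _ f b h s 1 W) => //.
- by move=> S /and3P[].
- move=> S /and3P[_ Sh _] e eU; rewrite eU /w ler0n /=; apply: le_trans Sh.
  rewrite ler_nat; apply: subset_leq_card; apply/fintype.subsetP => i; rewrite !inE.
  apply: contraTneq => ->; rewrite finset.subset0; have [a [c [_ ->]]] := vpairsP eU.
  by apply/negP => /eqP/setP/(_ a); rewrite !inE eqxx.
move=> S /and3P[_ _ SW]; apply: le_trans SW.
have := sum_cover_mult S; rewrite -(ler_nat R) !natr_sum => h1.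
rewrite (eq_bigr (w S)); last by move=> e ->.
apply: le_trans h1 _.
by apply: ler_sum => i _; rewrite natrX.
Qed.

Definition dense_core (t D : R) (m : nat) : pred {set {set V}} := fun E =>
  [exists A : {set {set V}}, [&& A \subset E, #|A| == m,
     [forall e in A, t <= (codeg A e)%:R] & [forall x, #|nbrs A x|%:R <= D]]].

(** Union bound over the fingerprints of [exists_fingerprint] with k between
    2n/t and 4n/t vertices.  The fingerprint has size at most 16 m / t, so it
    spans at most 16 D m / t pairs, among which the graph has m / 2 edges. *)
Lemma Pr_dense_core (t D a b : R) (m : nat) : (0 < m)%N -> 0 < t -> 0 <= a ->
  0 <= b -> 32 * expR (1 + a) * p * D <= t ->
  Pr U p (dense_core t D m) <=
    expR (b * (16 * m%:R / t) + expR (- b) * (4 * n%:R ^+ 2 / t) - a * m%:R / 2).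
Proof.
move=> m0 t0 a0 b0 eD.
have nR : 0 < n%:R :> R by rewrite ltr0n.
have [tn|nt] := leP t n%:R; last first.
  rewrite /Pr (@eq_Ex _ _ _ _ _ (fun=> 0)) ?Ex_cst ?expR_ge0 // => E EU.
  rewrite (_ : dense_core _ _ _ _ = false) //; apply/negbTE/negP;
    rewrite /dense_core => /fintype.existsP[A].
  move=> /and4P[_ /eqP Am /forall_inP tA _].
  have /card_gt0P[e eA] : (0 < #|A|)%N by rewrite Am.
  have := tA e eA; rewrite leNgt (le_lt_trans _ nt) // ler_nat.
  by rewrite -[leqRHS]card_ord max_card.
pose k := Num.truncn (4 * n%:R / t).
have q0 : 0 <= 4 * n%:R / t by rewrite divr_ge0 ?mulr_ge0 // ltW.
have [kle klt] : k%:R <= 4 * n%:R / t /\ 4 * n%:R / t < k%:R + 1.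
  by have := truncn_itv q0 => /andP[h1 h2]; rewrite natr1.
have tk4 : t * k%:R <= 4 * n%:R by move: kle; rewrite ler_pdivlMr // mulrC.
have tk : 2 * n%:R <= t * k%:R.
  move: klt; rewrite ltr_pdivrMr //; nra.
pose f := 16 * m%:R / t.
have f0 : 0 <= f by rewrite divr_ge0 ?mulr_ge0 // ltW.
have [D0|D0] := ltP D 0.
  rewrite /Pr (@eq_Ex _ _ _ _ _ (fun=> 0)) ?Ex_cst ?expR_ge0 // => E EU.
  rewrite (_ : dense_core _ _ _ _ = false) //; apply/negbTE/negP;
    rewrite /dense_core => /fintype.existsP[A].
  move=> /and4P[_ _ _ /forallP/(_ (Ordinal n0))] h.
  by have := le_lt_trans h D0; rewrite ltrn0.
pose Q (S : {set 'I_k * V}) := (#|S|%:R <= f) && [forall i, #|fib S i|%:R <= D].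
pose w (S : {set 'I_k * V}) (e : {set V}) : R := [exists i, e \subset fib S i]%:R.
apply: le_trans (_ : Pr U p (fun E => [exists S, Q S &&
    (m%:R / 2 <= \sum_(e in E) w S e)]) <= _).
  apply: le_Pr => // E EU;
    rewrite {1}/dense_core =>
      /fintype.existsP[A /and4P[AE /eqP Am /forall_inP tA /forallP DA]].
  have [S [S1 S2 S3]] := exists_fingerprint (fintype.subset_trans AE EU) n0 t0 tA
    DA tk.
  apply/existsP; exists S; apply/andP; split.
    apply/andP; split; last exact/forallP.
    rewrite /f ler_pdivlMr // -(ler_pM2r nR).
    rewrite Am in S1.
    apply: le_trans (_ : 4 * k%:R * m%:R * t <= _).
      by rewrite mulrAC ler_wpM2r // ltW.
    have -> : 4 * k%:R * m%:R * t = 4 * m%:R * (t * k%:R) by ring.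
    have -> : 16 * m%:R * n%:R = 4 * m%:R * (4 * n%:R) :> R by ring.
    by rewrite ler_wpM2l ?mulr_ge0.
  apply: le_trans (_ : \sum_(e in A) w S e <= _).
    rewrite ler_pdivrMr // mulrC -natr_sum -natrM ler_nat -Am.
    apply: leq_trans S3 _; rewrite leq_mul2l /= -sum1_card [leqRHS]big_mkcond.
    rewrite [leqLHS]big_mkcond; apply: leq_sum => e _; rewrite inE.
    by case: (e \in A); case: [exists _, _].
  rewrite [leLHS]big_mkcond [leRHS]big_mkcond; apply: ler_sum => e _.
  case: ifP => [/(fintype.subsetP AE)->//|_]; case: ifP => //.
have card0 : expR (- b) * #|{: 'I_k * V}|%:R <= expR (- b) * (4 * n%:R ^+ 2 / t).
  rewrite ler_wpM2l ?expR_ge0 // card_prod !card_ord natrM.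
  by rewrite ler_pdivlMr //; nra.
apply: le_trans (_ : expR (b * f + expR (- b) * #|{: 'I_k * V}|%:R - a * (m%:R / 2)
  / 1) <= _).
  apply: (@Pr_union_weight _ _ U p _ Q w f b 1 (m%:R / 2) a (D * f)) => //.
  - rewrite /f; apply: le_trans (_ : (32 * expR (1 + a) * p * D) * (m%:R / (2 * t))
    <= _).
      rewrite le_eqVlt; apply/orP; left; apply/eqP; field; exact: lt0r_neq0.
    apply: le_trans (_ : t * (m%:R / (2 * t)) <= _).
      by rewrite ler_wpM2r // divr_ge0 ?mulr_ge0 // ltW.
    by rewrite le_eqVlt; apply/orP; left; apply/eqP; field; exact: lt0r_neq0.
  - by move=> S /andP[].
  - by move=> S _ e _; rewrite /w; case: [exists _, _]; rewrite ?lexx ?ler01.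
  move=> S /andP[Sf /forallP SD].
  apply: le_trans (_ : \sum_i D * #|fib S i|%:R <= _); last first.
    by rewrite -big_distrr -natr_sum sum_card_fib /= ler_wpM2l.
  apply: le_trans (_ : \sum_i #|fib S i|%:R ^+ 2 <= _); last first.
    by apply: ler_sum => i _; rewrite expr2 ler_wpM2r.
  have := sum_cover_mult S; rewrite -(ler_nat R) !natr_sum => h1.
  apply: le_trans (_ : \sum_(e in U) (cover_mult S e)%:R <= _).
    apply: ler_sum => e _; rewrite /w; case: existsP => [[i ei]|_] //.
    by rewrite ler1n card_gt0; apply/set0Pn; exists i; rewrite inE.
  by apply: le_trans h1 _; apply: ler_sum => i _; rewrite natrX.
rewrite ler_expR divr1 -/f; move: card0; set u := expR _ * _; set u1 := expR _ * _;
  lra.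
Qed.

End GraphEvents.

(** * Consequences of a small total excess *)
Section ExcessConsequences.

Variables (R : realType) (n : nat).
Local Notation V := 'I_n.
Implicit Types (v w x y z : V) (E A : {set {set V}}).

(** The function ln x / x decreases for x >= e. *)
Lemma ln_div_antimono (x y : R) : expR 1 <= x -> x <= y -> x * ln y <= y * ln x.
Proof.
move=> ex xy; have x0 : 0 < x by apply: lt_le_trans ex; rewrite expR_gt0.
have y0 : 0 < y by apply: lt_le_trans xy.
have l1 : 1 <= ln x by rewrite -(expRK 1) ler_ln ?posrE ?expR_gt0.
have q1 : ln (y / x) <= y / x - 1.
  have := @le_ln1Dx R (y / x - 1); rewrite addrCA subrr addr0; apply.
  by rewrite ltrBrDl subrr divr_gt0.
rewrite -{1}(divfK (lt0r_neq0 x0) y) lnM ?posrE ?divr_gt0 //.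
have xq : x * (y / x) = y by rewrite mulrC divfK ?lt0r_neq0.
have : x * ln (y / x) <= x * (y / x - 1) by rewrite ler_pM2l.
rewrite mulrBr xq; nra.
Qed.

Variables (C y s : R).
Hypotheses (y0 : 0 < y) (C4 : expR 4 <= C).

Let C1 : expR 1 <= C.
Proof. by apply: le_trans C4; rewrite ler_expR; lra. Qed.

Lemma ln_ge1_of_excess (d : R) : C * y < d -> 1 <= ln (d / y).
Proof.
move=> h; have d0 : 0 < d.
  by apply: lt_trans h; rewrite mulr_gt0 // (lt_le_trans (expR_gt0 _) C1).
rewrite -{1}(expRK 1) ler_ln ?posrE ?expR_gt0 ?divr_gt0 //.
by rewrite ler_pdivlMr //; apply: le_trans (ltW h); rewrite ler_pM2r.
Qed.

Lemma excess_ge0 (d : nat) : 0 <= excess C y d.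
Proof.
rewrite /excess; case: ifP => // /ln_ge1_of_excess h.
by rewrite mulr_ge0 // (le_trans ler01).
Qed.

Variable E : {set {set V}}.
Hypothesis sumE : \sum_v excess C y #|nbrs E v| <= s.

Lemma high_sum_deg (D : R) : C * y <= D ->
  \sum_(v in high_deg D E) #|nbrs E v|%:R <= s.
Proof.
move=> CD; apply: le_trans sumE; rewrite big_mkcond; apply: ler_sum => v _.
case: ifP => [|_]; last exact: excess_ge0.
rewrite inE => Dd; have Cd := le_lt_trans CD Dd.
by rewrite /excess Cd ler_peMr // ln_ge1_of_excess.
Qed.

Lemma high_card (D : R) : 0 < D -> C * y <= D -> #|high_deg D E|%:R <= s / D.
Proof.
move=> D0 CD; rewrite ler_pdivlMr //; apply: le_trans (high_sum_deg CD).
rewrite -sum1_card natr_sum big_distrl /=; apply: ler_sum => v.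
by rewrite inE mul1r => /ltW.
Qed.

(** Write d^2 as (d ln (d/y)) (d / ln (d/y)) and use that the second factor
    increases with d.  Here [D0] bounds the degrees: either trivially, or
    because a larger degree alone would exceed the total excess [s]. *)
Lemma high_sum_sq (D0 l W : R) : 0 < l ->
  (n%:R <= D0) || (s < D0 * l) -> l <= ln (D0 / y) -> 0 < D0 ->
  D0 * s <= l * W -> \sum_(v in high_deg (C * y) E) #|nbrs E v|%:R ^+ 2 <= W.
Proof.
move=> l0 hD lD D00 DW; rewrite -(ler_pM2l l0); apply: le_trans DW.
have C0 : 0 < C by apply: lt_le_trans C1; rewrite expR_gt0.
apply: le_trans (ler_wpM2l (ltW D00) sumE); rewrite !big_distrr /=.
rewrite big_mkcond; apply: ler_sum => v _.
case: ifP => [|_]; last by rewrite mulr_ge0 ?excess_ge0 // ltW.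
rewrite inE => Cd; rewrite /excess Cd; set d : R := #|nbrs E v|%:R.
have d0 : 0 < d by apply: lt_trans Cd; rewrite mulr_gt0.
have l1 := ln_ge1_of_excess Cd.
have exs : d * ln (d / y) <= s.
  apply: le_trans sumE; rewrite (bigD1 v) //= {1}/excess Cd lerDl sumr_ge0 //.
  by move=> w _; apply: excess_ge0.
have dD : d <= D0.
  case/orP: hD => h; first by apply: le_trans h;
    rewrite ler_nat -[leqRHS]card_ord max_card.
  rewrite leNgt; apply/negP => Dd.
  have : D0 * l <= d * ln (d / y).
    apply: le_trans (_ : d * l <= _); first by rewrite ler_pM2r // ltW.
    rewrite ler_pM2l //; apply: le_trans lD _.
    by rewrite ler_ln ?posrE ?divr_gt0 // ler_pM2r ?invr_gt0 // ltW.
  by move=> h2; have := lt_le_trans h (le_trans h2 exs); rewrite ltxx.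
have := @ln_div_antimono (d / y) (D0 / y).
have -> : expR 1 <= d / y.
  by rewrite ler_pdivlMr //; apply: le_trans (ltW Cd); rewrite ler_pM2r.
rewrite ler_pM2r ?invr_gt0 // => /(_ isT dD).
rewrite mulrAC [leRHS]mulrAC ler_pM2r ?invr_gt0 // => h.
have dl : d * l <= D0 * ln (d / y).
  by apply: le_trans h; rewrite ler_pM2l.
rewrite expr2 mulrA [l * d]mulrC.
have := ler_wpM2r (ltW d0) dl; rewrite mulrA; lra.
Qed.

End ExcessConsequences.

(** * Excluding seeds *)
Section SeedAnalysis.

Variables (R : realType) (n : nat).
Local Notation V := 'I_n.
Local Notation U := (vpairs n).
Implicit Types (v w x y z : V) (E A : {set {set V}}).

Lemma nbrs_sub E A v : A \subset E -> nbrs A v \subset nbrs E v.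
Proof.
move=> /fintype.subsetP AE; apply/fintype.subsetP => u; rewrite !in_nbrs; exact: AE.
Qed.

Lemma nbrs_avoid E A (D : R) v : A \subset E -> 0 <= D ->
  #|nbrs (avoid (high_deg D E) A) v|%:R <= D.
Proof.
move=> AE D0; have [vH|] := boolP (v \in high_deg D E).
  rewrite (_ : nbrs _ v = finset.set0) ?cards0 //; apply/setP => u.
  rewrite !inE finset.disjoints_subset finset.subUset finset.sub1set.
  by rewrite finset.in_setC vH /= andbF.
rewrite inE -leNgt; apply: le_trans; rewrite ler_nat subset_leq_card //.
apply: nbrs_sub; apply: fintype.subset_trans AE.
by apply/fintype.subsetP => e; rewrite inE => /andP[].
Qed.

Lemma avoid_sub (B : {set V}) A : avoid B A \subset A.
Proof. by apply/fintype.subsetP => e; rewrite inE => /andP[]. Qed.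

Lemma card_sub_vpairs A : A \subset U -> (#|A| <= n ^ 2)%N.
Proof.
move=> /subset_leq_card h; apply: leq_trans h _.
have := @card_pairs_in n [set: V]%SET; rewrite cardsT card_ord; apply: leq_trans.
by apply: subset_leq_card; apply/fintype.subsetP => e eU;
  rewrite inE eU finset.subsetT.
Qed.

(** Pruning after the removal of the vertices of degree above [D] in [E]. *)
Lemma exists_core E A (D t m T T' : R) : E \subset U -> A \subset E ->
  0 <= D -> 0 <= t -> #|A|%:R <= m -> T <= (tri (avoid (high_deg D E) A))%:R ->
  T' <= T - 6 * t * m ->
  exists A' : {set {set V}}, [/\ A' \subset A, T' <= (tri A')%:R &
    dense_core t D #|A'| E].
Proof.
move=> EU AE D0 t0 Am TA TT.
have sub := avoid_sub (high_deg D E) A.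
have [A' [A'A triA' cA']] := exists_pruned
  (fintype.subset_trans sub (fintype.subset_trans AE EU)) t0.
have A'A2 := fintype.subset_trans A'A sub.
exists A'; split=> //.
  apply: le_trans triA'; apply: le_trans TT _; apply: lerB => //.
  apply: ler_wpM2l; first by rewrite mulr_ge0.
  by apply: le_trans Am; rewrite ler_nat subset_leq_card.
apply/fintype.existsP; exists A'; rewrite eqxx (fintype.subset_trans A'A2 AE) /=.
apply/andP; split; first exact/forall_inP.
apply/fintype.forallP => x; apply: le_trans (nbrs_avoid x AE D0).
by rewrite ler_nat subset_leq_card // nbrs_sub.
Qed.

Variables (p de psi K : R) (k : nat).
Hypotheses (p0 : 0 < p) (p1 : p <= 1) (de0 : 0 < de) (psi0 : 0 < psi)
  (K20000 : 20000 <= K).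
Let K0 : 0 < K. Proof. by apply: lt_le_trans K20000; rewrite ltr0n. Qed.
Let Kinv : K^-1 <= 1 / 20000.
Proof. by rewrite div1r lef_pV2; [exact: K20000|rewrite posrE;
  exact: K0|rewrite posrE ltr0n]. Qed.
Let psi6000 : psi / 6000 <= psi. Proof. have := psi0; lra. Qed.
Let N : R := n%:R.
Let S := de * p ^+ 3 * N ^+ 3 / 12.
Let m2 := psi / (288 * K * de).
Let Dh := 256 * de ^+ 2 * N ^+ 3 * p ^+ 2 / psi.
(* The constant K is a free parameter: it fixes the size of m2, and t2 is chosen
   so that pruning m2 edges destroys a quarter of S. *)
Let t2 := K * de ^+ 2 * p ^+ 3 * N ^+ 3 / psi.
Variable D1 : R.
Let t1 := S / (96 * psi).
Variable m1 : R.
Hypotheses (n6 : (6 <= n)%N) (psi_le : psi <= de ^+ 2 * p * N ^+ 2)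
  (D1y : 256 * (N * p) <= D1) (A1 : 48 * psi ^+ 2 <= S * D1)
  (m1S : (2 * m1) ^+ 3 <= (S / 16) ^+ 2) (km2 : k%:R <= m2).
Variable E : {set {set V}}.
Hypothesis EU : E \subset U.
Hypothesis C4 : expR 4 <= 256 :> R.
Hypothesis exE : \sum_v excess 256 (N * p) #|nbrs E v| <= psi / 6000.
Hypothesis sqE :
  \sum_(v in high_deg (256 * (N * p)) E) #|nbrs E v|%:R ^+ 2 <= de * p ^+ 2 * N ^+
    3 / 2000.
Hypothesis hubE : ~~ [&& \sum_(v in high_deg Dh E) #|nbrs E v|%:R <= psi,
      #|high_deg Dh E|%:R <= psi / Dh,
      \sum_(v in high_deg Dh E) #|nbrs E v|%:R ^+ 2 <= de * p ^+ 2 * N ^+ 3 / 2000 &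
      S / 12 <= \sum_(e in E) #|[set x in high_deg Dh E | e \subset nbrs E
        x]%SET|%:R].
Hypothesis core2E : forall m : nat, (0 < m)%N -> (m <= n ^ 2)%N -> psi <= m%:R ->
  ~~ dense_core t2 Dh m E.
Hypothesis core1E : forall m : nat, (0 < m)%N -> (m <= n ^ 2)%N -> m1 <= m%:R ->
  ~~ dense_core t1 D1 m E.

Let N0 : 0 < N. Proof. by rewrite ltr0n; apply: leq_trans n6. Qed.
Let S0 : 0 < S.
Proof. by rewrite /S divr_gt0 // mulr_gt0 ?exprn_gt0 // mulr_gt0 ?exprn_gt0. Qed.
Let Dhy : 256 * (N * p) <= Dh.
Proof.
rewrite /Dh ler_pdivlMr //; have := ler_wpM2l (ltW (mulr_gt0 N0 p0)) psi_le; lra.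
Qed.
Let y0 : 0 < N * p. Proof. exact: mulr_gt0. Qed.
Let y256 : 0 < 256 * (N * p). Proof. by apply: mulr_gt0 y0; rewrite ltr0n. Qed.
Let c288 : 0 < 288 :> R. Proof. by rewrite ltr0n. Qed.
Let Dh0 : 0 < Dh. Proof. exact: lt_le_trans y256 Dhy. Qed.

(** In the situation of the section, a set of at most [k] edges has fewer than S
    labelled triangles.  Hubs account for at most half of them.  The rest
    contains a core with degrees at most Dh and codegrees at least t2, which
    must have fewer than psi edges; then so few triangles meet the vertices of
    degree above D1 that a second core exists, with degrees at most D1 and
    codegrees at least t1, and it has at least m1 edges because of
    [tri_sqr_le]. *)
Lemma tri_small_subset_lt A : A \subset E -> (#|A| <= k)%N -> (tri A)%:R < S.
Proof.
move=> AE Ak; rewrite ltNge; apply/negP => SA.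
have AU := fintype.subset_trans AE EU.
have Am2 : #|A|%:R <= m2 by apply: le_trans km2; rewrite ler_nat.
have sum_deg_h := high_sum_deg y0 C4 exE Dhy.
have hub : \sum_(e in E) #|[set x in high_deg Dh E | e \subset nbrs E x]%SET|%:R <
  S / 12.
  move: hubE; rewrite !negb_and -!ltNge => /or4P[|||->//].
  - by rewrite ltNge (le_trans sum_deg_h).
  - rewrite ltNge (le_trans (high_card y0 C4 exE Dh0 Dhy)) //.
    by rewrite ler_pM2r ?invr_gt0.
  - rewrite ltNge (le_trans _ sqE) // [leLHS]big_mkcond [leRHS]big_mkcond.
    apply: ler_sum => v _; rewrite !inE; case: ifP => h; last by case: ifP.
    by rewrite ifT // (le_lt_trans Dhy).
have T1 : S / 2 <= (tri (avoid (high_deg Dh E) A))%:R.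
  have := tri_avoid (high_deg Dh E) AU;
    rewrite -(ler_nat R) natrD natrM [X in 6 * X]natr_sum => hav.
  have : \sum_(e in A) #|[set x in high_deg Dh E | e \subset nbrs A x]%SET|%:R <=
     \sum_(e in E) #|[set x in high_deg Dh E | e \subset nbrs E x]%SET|%:R :> R.
    rewrite [leLHS]big_mkcond [leRHS]big_mkcond; apply: ler_sum => e _.
    case: ifP => [eA|_]; last by case: ifP.
    rewrite (fintype.subsetP AE _ eA) ler_nat subset_leq_card //.
    apply/fintype.subsetP => x; rewrite !inE => /andP[-> /=].
    by move=> h1; apply: fintype.subset_trans h1 _; apply: nbrs_sub.
  lra.
have m20 : 0 < m2 := divr_gt0 psi0 (mulr_gt0 (mulr_gt0 c288 K0) de0).
have t20 : 0 < t2 by rewrite /t2 divr_gt0 // !mulr_gt0 ?exprn_gt0 // K0.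
have t2m2 : 6 * t2 * m2 = S / 4.
  by rewrite /t2 /m2 /S; field; rewrite !lt0r_neq0 // exprn_gt0.
have [|A2 [A2A T2 core2]] :=
  exists_core EU AE (ltW Dh0) (ltW t20) Am2 T1 (_ : S / 4 <= _).
  by rewrite t2m2; lra.
have A2E := fintype.subset_trans A2A AE.
have tri_pos (B : {set {set V}}) (T : R) : B \subset U -> 0 < T -> T <= (tri B)%:R
  -> (0 < #|B|)%N.
  move=> BU T0 TB; rewrite lt0n; apply/eqP => B0.
  have := tri_sqr_le R BU; rewrite B0 mulr0 expr0n /= => h.
  have : 0 < (tri B)%:R ^+ 2 :> R by rewrite exprn_gt0 // (lt_le_trans T0).
  by rewrite ltNge h.
have A2U := fintype.subset_trans A2E EU.
have [psim|mpsi] := leP psi #|A2|%:R.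
  have S4 : 0 < S / 4 by rewrite divr_gt0.
  have := core2E (tri_pos A2 _ A2U S4 T2) (card_sub_vpairs A2U) psim.
  by rewrite core2.
have D10 : 0 < D1 by apply: lt_le_trans D1y.
have h1 := high_card y0 C4 exE D10 D1y.
have T3 : S / 8 <= (tri (avoid (high_deg D1 E) A2))%:R.
  have := tri_avoid_card (high_deg D1 E) A2U; rewrite -(ler_nat R) natrD !natrM => h.
  have : #|A2|%:R * #|high_deg D1 E|%:R <= psi * (psi / D1) :> R.
    apply: ler_pM => //; first exact: ltW.
    by apply: le_trans h1 _; rewrite ler_pM2r ?invr_gt0.
  have : psi * (psi / D1) <= S / 48.
    rewrite mulrA ler_pdivrMr //; move: A1; rewrite expr2; lra.
  move: T2 h; lra.
have t10 : 0 < t1 by rewrite /t1 divr_gt0 // mulr_gt0.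
have t1psi : 6 * t1 * psi = S / 16.
  by rewrite /t1; field; rewrite lt0r_neq0.
have [|A4 [A4A T4 core1]] :=
  exists_core EU A2E (ltW D10) (ltW t10) (ltW mpsi) T3 (_ : S / 16 <= _).
  by rewrite t1psi; lra.
have A4U := fintype.subset_trans A4A A2U.
have S16 : 0 < S / 16 by rewrite divr_gt0.
have m1A : m1 <= #|A4|%:R.
  have h := tri_sqr_le R A4U.
  have h2 : (2 * m1) ^+ 3 <= (2 * #|A4|%:R) ^+ 3.
    apply: le_trans m1S _; apply: le_trans h.
    by rewrite lerXn2r ?nnegrE ?(ltW S16).
  rewrite leNgt; apply/negP => h3; move: h2; rewrite leNgt => /negP; apply.
  have m10 : 0 <= m1 by apply: le_trans (ltW h3).
  by rewrite ltrXn2r ?nnegrE ?mulr_ge0 // ltr_pM2l.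
have := core1E (tri_pos A4 _ A4U S16 T4) (card_sub_vpairs A4U) m1A.
by rewrite core1.
Qed.

(** The three terms of [tri_mean_le] beyond the unconditional mean are below
    1/1000, 1/500 and 1/12 of de p^3 n^3, and their sum stays below half of
    [de] times the unconditional mean. *)
Lemma seedless_of_good :
  seedless p (@distinct3 n) (@triangle_edges n)
    ((1 + de / 2) * (p ^+ 3 * (n ^_ 3)%:R)) k E.
Proof.
apply/fintype.forallP => A; apply/implyP => /andP[AE Ak].
have AU := fintype.subset_trans AE EU.
have Am2 : #|A|%:R <= m2 by apply: le_trans km2; rewrite ler_nat.
have m2le : m2 <= de * p * N ^+ 2 / (288 * K).
  rewrite /m2 ler_pdivrMr; last exact: mulr_gt0 (mulr_gt0 c288 K0) de0.
  apply: le_trans psi_le _.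
  by rewrite le_eqVlt; apply/orP; left; apply/eqP; field;
    rewrite ?lt0r_neq0 ?exprn_gt0.
apply: le_trans (tri_mean_le (ltW p0) AU) _; rewrite -/N.
have h1 := tri_small_subset_lt AE Ak.
have h2 : \sum_v #|nbrs A v|%:R ^+ 2 <= de * p ^+ 2 * N ^+ 3 / 2000 + 256 * (N * p)
  * (2 * m2).
  apply: le_trans (_ : \sum_v ((if v \in high_deg (256 * (N * p)) E then #|nbrs E
    v|%:R ^+ 2 else 0)
       + 256 * (N * p) * #|nbrs A v|%:R) <= _).
    apply: ler_sum => v _; have AEv : #|nbrs A v|%:R <= #|nbrs E v|%:R :> R.
      by rewrite ler_nat subset_leq_card // nbrs_sub.
    rewrite inE; case: ifP => [_|/negbT]; last first.
      rewrite -leNgt add0r expr2 => h; rewrite ler_wpM2r //.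
      exact: le_trans AEv h.
    rewrite -[leLHS]addr0; apply: lerD; first by rewrite lerXn2r ?nnegrE.
    exact: mulr_ge0 (ltW y256) (ler0n _ _).
  rewrite big_split /= -big_mkcond -big_distrr /= sum_deg_R //.
  apply: lerD; first exact: sqE.
  apply: ler_wpM2l (ltW y256) _ _ _; exact: ler_wpM2l Am2.
have f3 : N ^+ 3 / 2 <= (n ^_ 3)%:R := ffact3_ge R n6.
have p3 : 0 < p ^+ 3 by rewrite exprn_gt0.
have dp3 : 0 < de * p ^+ 3 by rewrite mulr_gt0.
have f3' := ler_wpM2l (ltW dp3) f3.
have p2N : 0 <= p ^+ 2 * N by rewrite mulr_ge0 ?exprn_ge0 // ltW.
have e1 : 6 * p ^+ 2 * N * #|A|%:R <= 6 * p ^+ 2 * N * (de * p * N ^+ 2 / (288 * K)).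
  apply: ler_wpM2l; first by rewrite -mulrA mulr_ge0.
  exact: le_trans Am2 m2le.
have e2 : 256 * (N * p) * (2 * m2) <= 256 * (N * p) * (2 * (de * p * N ^+ 2 / (288
  * K))).
  apply: ler_wpM2l; first exact: (ltW y256).
  exact: ler_wpM2l m2le.
have e3 := ler_wpM2l (ltW p0) (le_trans h2 (lerD (lexx _) e2)).
move: h1; rewrite /S => h1.
set Q := de * p ^+ 3 * N ^+ 3.
have Q0 : 0 < Q by rewrite mulr_gt0 ?exprn_gt0.
have -> : (1 + de / 2) * (p ^+ 3 * (n ^_ 3)%:R) = p ^+ 3 * (n ^_ 3)%:R + de * p ^+
  3 * (n ^_ 3)%:R / 2 by lra.
have e1' : 6 * p ^+ 2 * N * #|A|%:R <= Q / 1000.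
  apply: le_trans e1 _; rewrite (_ : _ * (_ / _) = (6 / 288) * K^-1 * Q); last first.
    by rewrite /Q; field; rewrite lt0r_neq0.
  by rewrite [leRHS]mulrC; apply: ler_wpM2r (ltW Q0) _ _ _; move: Kinv; lra.
have e3' : 3 * p * (\sum_v #|nbrs A v|%:R ^+ 2) <= Q / 500.
  rewrite -mulrA; apply: le_trans (ler_wpM2l (ler0n R 3) e3) _.
  rewrite (_ : 3 * _ = (3 / 2000 + 3 * 512 / 288 * K^-1) * Q); last first.
    by rewrite /Q; field; rewrite lt0r_neq0.
  by rewrite [leRHS]mulrC; apply: ler_wpM2r (ltW Q0) _ _ _; move: Kinv; lra.
move: f3'; rewrite mulrA -/Q => f3'; move: h1; rewrite -/Q => h1.
lra.
Qed.

End SeedAnalysis.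

(** * The upper tail, non-asymptotically *)
Section ExpBounds.
Variable R : realType.

(** From exp(- 1/8) >= 7/8. *)
Lemma expR1_le3 : expR 1 <= 3 :> R.
Proof.
have h : 7 / 8 <= expR (- (1 / 8)) :> R by have := expR_ge1Dx (- (1 / 8) : R); lra.
have e8 : expR (- (1 / 8)) ^+ 8 = (expR 1)^-1 :> R.
  by rewrite -expRM_natl -expRN; congr expR; field.
have h8 : (7 / 8) ^+ 8 <= (expR 1)^-1 :> R.
  by rewrite -e8 lerXn2r ?nnegrE ?expR_ge0 // divr_ge0.
rewrite -[leLHS]invrK -[leRHS]invrK lef_pV2 ?posrE ?invr_gt0 ?expR_gt0 //.
by apply: le_trans h8; lra.
Qed.

Lemma expR_nat_le (k : nat) : expR k%:R <= 3 ^+ k :> R.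
Proof.
by rewrite -[k%:R]mulr1 expRM_natl lerXn2r ?nnegrE ?expR_ge0 ?expR1_le3.
Qed.

End ExpBounds.

(** All parameters are related by explicit inequalities, so that the statement
    holds for a fixed [n].  The quantity [psi] is the exponent phi L of the
    opening paragraphs, [D0] and [l] are the data of [high_sum_sq], and the indices 1
    and 2 refer to small and large cores.  The number of triangles is compared
    with [seedless] through the five bad events of the proof: large excess,
    hubs, a large core, a small core, and many triangles without a seed. *)
Lemma Pr_tri_upper_tail (R : realType) (n : nat)
    (K c L de psi m1 D0 l p N S Dh t2 D1 t1 mu : R) :
  p = expR (- L) -> N = n%:R -> S = de * p ^+ 3 * N ^+ 3 / 12 ->
  Dh = 256 * de ^+ 2 * N ^+ 3 * p ^+ 2 / psi ->
  t2 = K * de ^+ 2 * p ^+ 3 * N ^+ 3 / psi -> D1 = N * expR (- (L / 2)) ->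
  t1 = S / (96 * psi) -> mu = p ^+ 3 * (n ^_ 3)%:R ->
  20000 <= K -> 32 * 3 ^+ 5 * 256 <= K ->
  c * (8 * 864 * K) = 1 -> c <= 1 / (96 * 1000) ->
  0 < L -> 0 < de -> de <= 1 -> 0 < psi -> 0 < m1 ->
  (6 <= n)%N -> psi <= de ^+ 2 * p * N ^+ 2 ->
  256 * (N * p) <= D1 -> 48 * psi ^+ 2 <= S * D1 ->
  (2 * m1) ^+ 3 <= (S / 16) ^+ 2 -> psi <= 128 * m1 * L ->
  N * (N + 1) * expR (- (128 * (N * p))) <= 1 ->
  0 < l -> 0 < D0 -> (N <= D0) || (psi / 6000 < D0 * l) -> l <= ln (D0 / (N * p)) ->
  D0 * (psi / 6000) <= l * (de * p ^+ 2 * N ^+ 3 / 2000) ->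
  3 * L * psi + p ^+ 3 * N ^+ 2 + psi <= (S / 12) / (psi / Dh) ->
  96 * L <= t2 -> 8 * p ^+ 3 * N ^+ 2 / t2 <= psi ->
  32 * expR (1 + L / 8) * p * D1 <= t1 -> 48 * 64 <= t1 ->
  4 * p ^+ 3 * N ^+ 2 / t1 <= L * m1 / 64 ->
  12 * N ^+ 2 <= expR (c * psi / 2) -> 864 * K <= psi ->
  Pr (vpairs n) p (fun E => (1 + de) * mu < (tri E)%:R) <= expR (- (c * psi / 2)).
Proof.
move=> pE NE SE DhE t2E D1E t1E muE K20000 K243 cE csmall L0 de0 de1 psi0 m10 n6
  psi_le D1y A1 m1S psim1 small l0 D00 hD0 lD0 DW A2 A3 A3' A4 A4' A4'' A5 A6.
have n0 : (0 < n)%N by apply: leq_trans n6.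
have N0 : 0 < N by rewrite NE ltr0n.
have p0 : 0 < p by rewrite pE expR_gt0.
have p1 : p <= 1 by rewrite pE -expR0 ler_expR oppr_le0 ltW.
have p01 : 0 <= p <= 1 by rewrite ltW.
have K0 : 0 < K by apply: lt_le_trans K20000; rewrite ltr0n.
have q0 : 0 < de * p ^+ 3 * N ^+ 3 by rewrite !mulr_gt0 ?exprn_gt0.
have S0 : 0 < S by rewrite SE divr_gt0.
have Dh0 : 0 < Dh.
  rewrite DhE; apply: divr_gt0 psi0; rewrite -!mulrA; apply: mulr_gt0;
    first by rewrite ltr0n.
  by rewrite !mulr_gt0 ?exprn_gt0.
have t20 : 0 < t2.
  rewrite t2E; apply: divr_gt0 psi0; rewrite -!mulrA; apply: (mulr_gt0 K0).
  by rewrite !mulr_gt0 ?exprn_gt0.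
have D10 : 0 < D1 by rewrite D1E mulr_gt0 ?expR_gt0.
have t10 : 0 < t1.
  by rewrite t1E; apply: (divr_gt0 S0); apply: mulr_gt0 psi0; rewrite ltr0n.
have y0 : 0 < N * p by rewrite mulr_gt0.
have K864 : 0 < 864 * K by apply: mulr_gt0 K0; rewrite ltr0n.
have c0 : 0 < c.
  have K8 : 0 < 8 * 864 * K by rewrite -mulrA; apply: mulr_gt0 K864; rewrite ltr0n.
  by rewrite -(pmulr_lgt0 _ K8) cE.
have cpsi_le : c * psi <= psi / (96 * 1000).
  by rewrite mulrC; have := ler_wpM2l (ltW psi0) csmall; clear; lra.
have cpsi : 0 <= c * psi by rewrite mulr_ge0 // ltW.
have C128 : expR 4 <= 128 :> R by have := expR_nat_le R 4; clear; lra.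
have C256 : expR 4 <= 256 :> R by move: C128; clear; lra.
have mu0 : 0 < mu by rewrite muE mulr_gt0 ?exprn_gt0 // ltr0n ffact_gt0 (leq_trans
  _ n6).
(* Seeds have at most 3 k edges, k being the integer part of k0, and 3 k0 is the
   bound m2 of the previous section. *)
pose k0 := psi / (864 * K * de).
have k0d : k0 * de = 8 * c * psi.
  have -> : k0 * de = c * (8 * 864 * K) * (k0 * de) by rewrite cE mul1r.
  by rewrite /k0; field; rewrite !lt0r_neq0.
have k0m : 3 * k0 = psi / (288 * K * de).
  by rewrite /k0; move: K0 de0; clear => K0 de0; field; rewrite !lt0r_neq0.
have k01 : 1 <= k0.
  rewrite /k0 ler_pdivlMr; last exact: (mulr_gt0 K864 de0).
  rewrite mul1r; apply: le_trans A6.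
  by apply: ler_piMr de1; exact: ltW.
clearbody k0.
have k00 : 0 <= k0 by apply: le_trans k01.
pose k := Num.truncn k0.
have [kle kgt] : k%:R <= k0 /\ k0 < k%:R + 1.
  by have := truncn_itv k00 => /andP[h1 h2]; rewrite natr1.
have khalf : k0 / 2 <= k%:R.
  have : (1 <= k)%N.
    rewrite lt0n; apply/eqP => kE; move: kgt k01; rewrite kE; clear; lra.
  by rewrite -(ler_nat R) => h; move: h kgt; clear; lra.
pose M := (1 + de / 2) * mu.
have M0 : 0 <= M by apply: mulr_ge0 (ltW mu0); move: de0; clear; lra.
pose bad1 : pred {set {set 'I_n}} :=
  fun E => psi / 6000 <= \sum_v excess 256 (N * p) #|nbrs E v|.
pose bad2 : pred {set {set 'I_n}} :=
  fun E => [&& \sum_(v in high_deg Dh E) #|nbrs E v|%:R <= psi,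
      #|high_deg Dh E|%:R <= psi / Dh,
      \sum_(v in high_deg Dh E) #|nbrs E v|%:R ^+ 2 <= de * p ^+ 2 * N ^+ 3 / 2000 &
      S / 12 <= \sum_(e in E) #|[set x in high_deg Dh E | e \subset nbrs E
        x]%SET|%:R].
pose bad3 : pred {set {set 'I_n}} := fun E => [exists m : 'I_(n ^ 2).+1,
   ((0 < m)%N && (psi <= m%:R)) && dense_core t2 Dh m E].
pose bad4 : pred {set {set 'I_n}} := fun E => [exists m : 'I_(n ^ 2).+1,
   ((0 < m)%N && (m1 <= m%:R)) && dense_core t1 D1 m E].
pose bad5 : pred {set {set 'I_n}} := fun E =>
  ((1 + de) * mu < copies R (@distinct3 n) (@triangle_edges n) E) &&
  seedless p (@distinct3 n) (@triangle_edges n) M (3 * k) E.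
have b1 : Pr (vpairs n) p bad1 <= 6 * expR (- (c * psi)).
  apply: le_trans (_ : 2 * expR (1 - (psi / 6000) / 16) <= _).
    rewrite /bad1 (_ : 256 = 2 * 128 :> R); last by clear; ring.
    by rewrite NE; apply: (Pr_degree_excess n0 p0 p1 _ C128); rewrite -natr1 -NE.
  rewrite expRD -mulrA [X in _ <= X](_ : _ = 2 * (3 * expR (- (c * psi))));
    last by clear; ring.
  rewrite ler_wpM2l // ler_pM ?expR_ge0 ?expR1_le3 // ler_expR lerN2.
  by move: cpsi_le psi0; clear; lra.
have e3 : expR (- (3 * L)) = p ^+ 3 by rewrite pE -expRM_natl; congr expR; clear;
  ring.
have L3 : 0 <= 3 * L by rewrite mulr_ge0 // ltW.
have b2 : Pr (vpairs n) p bad2 <= expR (- (c * psi)).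
  apply: le_trans (_ : expR (3 * L * psi + expR (- (3 * L)) * N ^+ 2 - (S / 12) /
    (psi / Dh)) <= _).
    have := @Pr_hubs R n p p0 p1 Dh psi (psi / Dh) (de * p ^+ 2 * N ^+ 3 / 2000) (S
      / 12) (3 * L).
    rewrite -NE -/bad2; apply => //; [by rewrite divr_gt0|].
    have e2 := expR_nat_le R 2; rewrite SE.
    have -> : expR 2 * p * (de * p ^+ 2 * N ^+ 3 / 2000) = expR 2 * (de * p ^+ 3 *
      N ^+ 3) / 2000 by clear; ring.
    have := ler_wpM2r (ltW q0) e2; move: q0; clear; lra.
  rewrite e3 ler_expR; move: A2 cpsi_le psi0; clear; lra.
have b3 : Pr (vpairs n) p bad3 <= (N ^+ 2 + 1) * expR (- (c * psi)).
  apply: le_trans (Pr_exists (vpairs n) (fun m : 'I_(n ^ 2).+1 =>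
    (0 < m)%N && (psi <= m%:R))
    (fun m => dense_core t2 Dh m) p01) _.
  apply: le_trans (_ : \sum_(m < (n ^ 2).+1) expR (- (c * psi)) <= _); last first.
    by rewrite sumr_const card_ord NE -natrX natr1 mulr_natl.
  rewrite big_mkcond; apply: ler_sum => m _; case: ifP => [/andP[m0 psim]|_];
    last exact: expR_ge0.
  apply: le_trans (Pr_dense_core n0 p0 p1 m0 t20 (ler0n R 4) L3 _) _.
    have e5 := expR_nat_le R 5; rewrite (_ : 1 + 4 = 5 :> R); last by clear; ring.
    have -> : t2 = K / 256 * (p * Dh) by rewrite t2E DhE; move: psi0;
      clear => psi0; field; rewrite lt0r_neq0.
    have := ler_wpM2r (ltW (mulr_gt0 p0 Dh0)) e5; set q := p * Dh => h.
    have qp0 : 0 < q by rewrite mulr_gt0.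
    have -> : 32 * expR 5 * p * Dh = 32 * (expR 5 * q) by rewrite /q; clear; ring.
    have h2 : 32 * 3 ^+ 5 * q <= K / 256 * q.
      by apply: ler_wpM2r (ltW qp0) _ _ _; rewrite ler_pdivlMr ?ltr0n.
    move: h h2; clear; lra.
  rewrite e3 ler_expR.
  have h1 : 3 * L * (16 * m%:R / t2) <= m%:R / 2.
    rewrite mulrA ler_pdivrMr //; have := ler_wpM2l (ler0n R m) A3; clear; lra.
  have h2 : p ^+ 3 * (4 * N ^+ 2 / t2) <= psi / 2.
    move: A3'; have -> : 8 * p ^+ 3 * N ^+ 2 / t2 = 2 * (p ^+ 3 * (4 * N ^+ 2 /
      t2)) by clear; ring.
    clear; lra.
    rewrite -NE; move: h1 h2 cpsi_le psi0 psim; clear; lra.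
have b4 : Pr (vpairs n) p bad4 <= (N ^+ 2 + 1) * expR (- (c * psi)).
  apply: le_trans (Pr_exists (vpairs n) (fun m : 'I_(n ^ 2).+1 =>
    (0 < m)%N && (m1 <= m%:R))
    (fun m => dense_core t1 D1 m) p01) _.
  apply: le_trans (_ : \sum_(m < (n ^ 2).+1) expR (- (c * psi)) <= _); last first.
    by rewrite sumr_const card_ord NE -natrX natr1 mulr_natl.
  rewrite big_mkcond; apply: ler_sum => m _; case: ifP => [/andP[m0 psim]|_];
    last exact: expR_ge0.
  have L8 : 0 <= L / 8 by rewrite divr_ge0 // ltW.
  apply: le_trans (Pr_dense_core n0 p0 p1 m0 t10 L8 L3 A4) _ => //.
  rewrite e3 ler_expR -NE.
  have Lm0 : 0 <= L * m%:R by rewrite mulr_ge0 // ltW.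
  have h1 : 3 * L * (16 * m%:R / t1) <= L * m%:R / 64.
    rewrite mulrA ler_pdivrMr //; have := ler_wpM2l Lm0 A4'; clear; lra.
  have Lm : L * m1 <= L * m%:R by rewrite ler_pM2l.
  have h2 : p ^+ 3 * (4 * N ^+ 2 / t1) <= L * m%:R / 64.
    move: A4''; have -> : 4 * p ^+ 3 * N ^+ 2 / t1 = p ^+ 3 * (4 * N ^+ 2 / t1) by
      clear; ring.
    move: Lm; clear; lra.
  move: h1 h2 Lm psim1 cpsi_le psi0; clear; lra.
have b5 : Pr (vpairs n) p bad5 <= expR (- (c * psi)).
  have y1 : 0 < (1 + de) * mu by apply: mulr_gt0 mu0; move: de0; clear; lra.
  apply: le_trans (Pr_copies_seedless p01 (@triangle_edges_vpairs n) _ k M0 y1) _.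
    by move=> t /card_triangle_edges ->.
  have q : M / ((1 + de) * mu) <= expR (- (de / 4)).
    apply: le_trans (expR_ge1Dx _); rewrite /M ler_pdivrMr //.
    rewrite mulrA ler_pM2r //; move: de0 de1; clear; nra.
  apply: le_trans (_ : expR (- (de / 4)) ^+ k <= _).
    by rewrite lerXn2r ?nnegrE ?expR_ge0 ?divr_ge0 // ltW.
  rewrite -expRM_natl ler_expR mulrN lerN2.
  have : k0 / 2 * (de / 4) <= k%:R * (de / 4) by rewrite ler_wpM2r // divr_ge0 // ltW.
  apply: le_trans; move: k0d; clear; lra.
apply: le_trans (_ : Pr (vpairs n) p (fun E =>
  bad1 E || (bad2 E || (bad3 E || (bad4 E || bad5 E)))) <= _).
  apply: le_Pr => // E EU XE.
  case: (boolP (bad1 E)) => //= /negP nb1; case: (boolP (bad2 E)) => //= nb2.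
  case: (boolP (bad3 E)) => //= nb3; case: (boolP (bad4 E)) => //= nb4.
  rewrite /bad5 copies_tri // XE /=.
  have ex : \sum_v excess 256 (N * p) #|nbrs E v| <= psi / 6000.
    by rewrite leNgt; apply/negP => /ltW.
  have hD0' : (n%:R <= D0) || (psi / 6000 < D0 * l) by rewrite -NE.
  have sq := high_sum_sq y0 C256 ex l0 hD0' lD0 D00 DW.
  have km : (3 * k)%:R <= psi / (288 * K * de).
    by rewrite -k0m natrM; apply: ler_wpM2l.
  rewrite /M muE; subst N S Dh t2 t1.
  apply: (seedless_of_good p0 de0 psi0 K20000 n6 psi_le D1y A1 m1S km EU
    C256 ex sq nb2).
  - move=> m m0 mn psim; apply: contra nb3 => dc; apply/fintype.existsP.
    have mn' : (m < (n ^ 2).+1)%N by rewrite ltnS.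
    by exists (Ordinal mn'); rewrite m0 psim.
  move=> m m0 mn psim; apply: contra nb4 => dc; apply/fintype.existsP.
  have mn' : (m < (n ^ 2).+1)%N by rewrite ltnS.
  by exists (Ordinal mn'); rewrite m0 psim.
have o4 := Pr_or (vpairs n) bad4 bad5 p01.
have o3 := Pr_or (vpairs n) bad3 (fun E => bad4 E || bad5 E) p01.
have o2 := Pr_or (vpairs n) bad2 (fun E => bad3 E || (bad4 E || bad5 E)) p01.
apply: le_trans (Pr_or _ _ _ p01) _.
apply: le_trans (_ : 12 * N ^+ 2 * expR (- (c * psi)) <= _); last first.
  apply: le_trans (ler_wpM2r (expR_ge0 _) A5) _.
  by rewrite -expRD ler_expR; clear; lra.
have N6 : 6 <= N by rewrite NE ler_nat.
have N36 : 36 <= N ^+ 2 by move: N6; clear; nra.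
have := ler_wpM2r (expR_ge0 (- (c * psi))) N36.
have e0 := expR_ge0 (- (c * psi)).
move: e0 b1 b2 b3 b4 b5 o2 o3 o4; rewrite !mulrDl !mul1r; clear; lra.
Qed.

(** * Planting a clique or a complete bipartite graph *)
Section Planting.

Variables (R : realType) (n : nat).
Local Notation V := 'I_n.
Local Notation U := (vpairs n).
Implicit Types (v w x y z : V) (E A I : {set {set V}}).

Lemma tri_le_cube E : E \subset U -> (tri E <= n ^ 3)%N.
Proof.
move=> EU; rewrite -(ler_nat R) -copies_tri // /copies.
apply: le_trans (_ : \sum_(t : V * V * V) 1 <= _).
  rewrite big_mkcond; apply: ler_sum => t _; case: ifP => // _.
  by case: (_ \subset _).
by rewrite sumr_const card_prod card_prod !card_ord ler_nat; lia.
Qed.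

(** Given [I], the count is at most (1 + de) mu outside the event and at most
    n^3 on it; compare with its conditional mean. *)
Lemma Pr_tri_gt (p de mu : R) I : 0 <= p <= 1 -> I \subset U ->
  0 <= (1 + de) * mu -> (1 + 2 * de) * mu <= tri_mean p I ->
  p ^+ #|I| * (de * mu) <= n%:R ^+ 3 * Pr U p (fun E => (1 + de) * mu < (tri E)%:R).
Proof.
move=> p01 IU mu0 mI; have [p0 _] := andP p01.
have pI := exprn_ge0 #|I| p0.
have h := Ex_copies_superset p01 (@triangle_edges_vpairs n) IU.
have : Ex U p (fun E =>
  (I \subset E)%:R * copies R (@distinct3 n) (@triangle_edges n) E) <=
   (1 + de) * mu * p ^+ #|I| + n%:R ^+ 3 * Pr U p (fun E =>
     (1 + de) * mu < (tri E)%:R).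
  rewrite -(Ex_superset p IU) -!ExZ -ExD; apply: le_Ex => // E EU.
  rewrite copies_tri //; have tn : (tri E)%:R <= n%:R ^+ 3 :> R.
    by rewrite -natrX ler_nat tri_le_cube.
  have n30 : 0 <= n%:R ^+ 3 :> R by rewrite exprn_ge0.
  case: (I \subset E) => /=; last by rewrite mul0r mulr0 add0r mulr_ge0.
  rewrite mul1r mulr1; case: leP => h2; first by rewrite mulr0 addr0.
  by rewrite mulr1; apply: le_trans tn _; rewrite lerDr.
rewrite h -/(tri_mean p I) => up; have low := ler_wpM2l pI mI.
have e : p ^+ #|I| * ((1 + 2 * de) * mu) - (1 + de) * mu * p ^+ #|I| =
  p ^+ #|I| * (de * mu) by move: (p ^+ _) => q; ring.
rewrite -[X in X <= _]e lerBlDl; exact: le_trans low up.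
Qed.

(** Every triple of distinct vertices of the clique is a triangle. *)
Lemma clique_seed (p : R) (s : nat) : 0 <= p <= 1 -> (s <= n)%N ->
  exists I : {set {set V}}, [/\ I \subset U, (#|I| <= s ^ 2)%N &
    p ^+ 3 * (n ^_ 3)%:R + (1 - p ^+ 3) * (s ^_ 3)%:R <= tri_mean p I].
Proof.
move=> p01 sn; have p3 : p ^+ 3 <= 1 by case/andP: p01 => p0 p1; rewrite exprn_ile1.
pose B := [set v : V | (v < s)%N]%SET.
have cB : #|B| = s.
  have -> : B = (widen_ord sn @: [set: 'I_s])%SET.
    apply/setP => v; rewrite inE; apply/idP/imsetP => [vs|[i _ ->]];
      last by rewrite /= ltn_ord.
    by exists (Ordinal vs) => //; apply: val_inj.
  rewrite card_imset ?cardsT ?card_ord // => i j /(congr1 val)/= ij; exact: val_inj.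
pose I := [set e in U | e \subset B]%SET.
exists I; split.
- by apply/fintype.subsetP => e; rewrite inE => /andP[].
- by rewrite -cB card_pairs_in.
pose Q (t : V * V * V) := distinct3 t && [&& t.1.1 \in B, t.1.2 \in B & t.2 \in B].
apply: le_trans (tri_mean_ge (Q := Q) (j := 0) p01 _ _); last first.
- move=> [[x y] z] /andP[/and3P[/= xy yz xz] /and3P[/= xB yB zB]].
  rewrite leqn0 cards_eq0; apply/eqP/setP => e; rewrite !inE.
  apply/negP => /andP[] /negP h; case/orP => [/orP[]|] /eqP eE; case: h;
  by rewrite eE cards2 ?xy ?yz ?xz finset.subUset !finset.sub1set ?xB ?yB ?zB.
- by move=> t /andP[].
rewrite lerD2l expr0 ler_wpM2l ?subr_ge0 // ler_nat -card_distinct3.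
pose g (t : 'I_s * 'I_s * 'I_s) : V * V * V :=
  (widen_ord sn t.1.1, widen_ord sn t.1.2, widen_ord sn t.2).
have gi : injective g.
  by move=> [[a b] c] [[a' b'] c'] [] /val_inj-> /val_inj-> /val_inj->.
rewrite -(fintype.card_image gi); apply: subset_leq_card;
  apply/fintype.subsetP => t /fintype.imageP[[[a b] c] d ->].
by rewrite unfold_in /Q /g /distinct3 /= !inE /= !ltn_ord !andbT; apply: d.
Qed.

(** A vertex on the side of size [k] and two vertices on the other side span two
    planted edges. *)
Lemma biclique_seed (p : R) (k d : nat) : 0 <= p <= 1 -> (k + d <= n)%N ->
  exists I : {set {set V}}, [/\ I \subset U, (#|I| <= k * d)%N &
    p ^+ 3 * (n ^_ 3)%:R + (p - p ^+ 3) * (k * (d * d.-1))%:R <= tri_mean p I].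
Proof.
move=> p01 kdn; have [p0 p1] := andP p01.
have kn : (k <= n)%N by apply: leq_trans kdn; rewrite leq_addr.
have ia (i : 'I_d) : (k + i < n)%N by apply: leq_trans kdn; rewrite ltn_add2l.
pose a (i : 'I_k) : V := widen_ord kn i.
pose b (i : 'I_d) : V := Ordinal (ia i).
have ai : injective a by move=> i j /(congr1 val)/= ij; apply: val_inj.
have bi : injective b by move=> i j /(congr1 val)/= /addnI ij; apply: val_inj.
have ab i j : a i != b j.
  by apply/eqP => /(congr1 val)/= e; have := ltn_ord i; rewrite e ltnNge leq_addr.
pose I := [set edge (a q.1) (b q.2) | q in [set: 'I_k * 'I_d]]%SET.
exists I; split.
- by apply/fintype.subsetP => e /imsetP[q _ ->]; rewrite edge_vpairs.
- by rewrite (leq_trans (leq_imset_card _ _)) // cardsT card_prod !card_ord.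
pose D := [set q : 'I_d * 'I_d | q.1 != q.2]%SET.
have cD : #|D| = (d * d.-1)%N.
  rewrite -sum1_card big_mkcond /=.
  transitivity (\sum_(i : 'I_d) \sum_(j : 'I_d) (if j != i then 1 else 0))%N.
    rewrite pair_bigA /=; apply: eq_bigr => [[i j]] _; by rewrite inE /= eq_sym.
  under eq_bigr => i _.
    rewrite -big_mkcond sum1_card (_ : #|_| = d.-1); last first.
      have cE := cardC1 i; rewrite card_ord in cE; rewrite -[RHS]cE.
      by apply: eq_card => j; rewrite !inE.
    over.
  by rewrite sum_nat_const card_ord.
pose g (t : 'I_k * ('I_d * 'I_d)) : V * V * V := (a t.1, b t.2.1, b t.2.2).
have gi : injective g by move=> [i [j l]] [i' [j' l']] [] /val_inj->
  /addnI/val_inj-> /addnI/val_inj->.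
pose Q (t : V * V * V) := t \in (g @: [set q | q.2 \in D])%SET.
have QE t : Q t -> exists i j l, t = (a i, b j, b l) /\ j != l.
  by move=> /imsetP[[i [j l]]]; rewrite !inE /= => jl ->; exists i, j, l.
apply: le_trans (tri_mean_ge (Q := Q) (j := 1) p01 _ _); last first.
- move=> t /QE[i [j [l [-> jl]]]].
  rewrite -(cards1 (edge (b j) (b l))); apply: subset_leq_card.
  apply/fintype.subsetP => e; rewrite !inE => /andP[/negP eI].
  case/orP => [/orP[]|] // /eqP eE; case: eI; rewrite eE.
    by apply/imsetP; exists (i, j).
  by apply/imsetP; exists (i, l).
- move=> t /QE[i [j [l [-> jl]]]].
  by rewrite /distinct3 /= !ab (inj_eq bi) jl.
rewrite lerD2l expr1 ler_wpM2l //; first by rewrite subr_ge0 -[leRHS]expr1 ler_wiXn2l.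
rewrite ler_nat -cD (_ : #|Q| = #|g @: [set q | q.2 \in D]%SET|);
  last by apply: eq_card.
rewrite card_imset // -[X in (X * _)%N](card_ord k) -cardsT -cardsX.
by apply: subset_leq_card; apply/fintype.subsetP => q; rewrite !inE.
Qed.

End Planting.

Lemma exists_nat_above (R : realType) (x : R) : 0 <= x ->
  exists2 k : nat, (0 < k)%N & x < k%:R <= x + 1.
Proof.
move=> x0; exists (Num.truncn x).+1 => //.
by have /andP[h1 h2] := truncn_itv x0; rewrite h2 -natr1 lerD2r.
Qed.

(** A clique on about 4 al p n vertices. *)
Lemma clique_planting (R : realType) (n : nat) (p al : R) :
  0 < p <= 1 / 20 -> 0 < al <= 1 -> 6 <= al * p * n%:R ->
  exists I : {set {set 'I_n}}, [/\ I \subset vpairs n,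
    #|I|%:R <= 50 * (al ^+ 2 * p ^+ 2 * n%:R ^+ 2) &
    (1 + 2 * al ^+ 3) * (p ^+ 3 * (n ^_ 3)%:R) <= tri_mean p I].
Proof.
move=> /andP[p0 p1] /andP[a0 a1] big.
set x := al * p * n%:R in big *.
have x0 : 0 <= 4 * x by move: big; clear; lra.
have n0 : 0 <= n%:R :> R by [].
have xn : x <= n%:R / 20.
  have : al * p <= 1 / 20 by move: a0 a1 p0 p1; clear; nra.
  by move/(ler_wpM2r n0); rewrite -/x; clear; lra.
have [s s0 /andP[xs sx]] := exists_nat_above x0.
have sn : (s <= n)%N.
  rewrite -(ler_nat R); move: sx xn big; clear; lra.
have s6 : (6 <= s)%N.
  rewrite -(ler_nat R); move: xs big; clear; lra.
have p01 : 0 <= p <= 1 by rewrite ltW //=; move: p1; clear; lra.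
have [I [IU Is mI]] := clique_seed p01 sn.
exists I; split=> //.
  apply: le_trans (_ : s%:R ^+ 2 <= _); first by rewrite -natrX ler_nat.
  apply: le_trans (_ : (4 * x + 1) ^+ 2 <= _);
    first by rewrite lerXn2r ?nnegrE ?addr_ge0.
  have -> : al ^+ 2 * p ^+ 2 * n%:R ^+ 2 = x ^+ 2 by rewrite /x; ring.
  move: big; clear; nra.
apply: le_trans mI; rewrite mulrDl mul1r lerD2l.
have s3 := ffact3_ge R s6.
have n3 := ffact3_le R n.
have sx3 : 64 * x ^+ 3 <= s%:R ^+ 3.
  have -> : 64 * x ^+ 3 = (4 * x) ^+ 3 by ring.
  by rewrite lerXn2r ?nnegrE // ltW.
have p3 : p ^+ 3 <= 1 / 2.
  apply: le_trans (_ : p <= _); last by move: p1; clear; lra.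
  by case/andP: p01 => ? ?; rewrite -[leRHS]expr1 ler_wiXn2l.
have q0 : 0 <= 2 * al ^+ 3 * p ^+ 3 by rewrite !mulr_ge0 ?exprn_ge0 ?ltW.
have := ler_wpM2l q0 n3.
have -> : 2 * al ^+ 3 * p ^+ 3 * n%:R ^+ 3 = 2 * x ^+ 3 by rewrite /x; ring.
rewrite mulrA => h.
have f0 : 0 <= (s ^_ 3)%:R :> R by [].
have x30 : 0 <= x ^+ 3 by rewrite exprn_ge0 //; move: big; clear; lra.
have : 1 / 2 * (s ^_ 3)%:R <= (1 - p ^+ 3) * (s ^_ 3)%:R.
  by rewrite ler_wpM2r //; move: p3; clear; lra.
move: h s3 sx3 x30; clear; lra.
Qed.

Lemma biclique_planting_mean (R : realType) (k d : nat) (p : R) :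
  0 < p <= 1 / 20 -> (2 <= d)%N ->
  p * k%:R * d%:R ^+ 2 / 4 <= (p - p ^+ 3) * (k * (d * d.-1))%:R.
Proof.
move=> /andP[p0 p1] d2.
have pp : p / 2 <= p - p ^+ 3.
  have : p ^+ 2 <= 1 / 2 by move: p0 p1; clear; nra.
  by move/(ler_wpM2l (ltW p0)); clear; rewrite -exprS; lra.
rewrite !natrM; have -> : d.-1%:R = d%:R - 1 :> R by rewrite -subn1 natrB // ltnW.
have d2' : 2 <= d%:R :> R by rewrite ler_nat.
have h : d%:R ^+ 2 / 2 <= d%:R * (d%:R - 1) :> R by move: d2'; clear; nra.
have -> : p * k%:R * d%:R ^+ 2 / 4 = p / 2 * (k%:R * (d%:R ^+ 2 / 2)) by clear; field.
apply: ler_pM => //; first by rewrite divr_ge0 // ltW.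
by rewrite ler_wpM2l.
Qed.

(** If 5 st <= n, a star with about 3 st edges fits.  Otherwise
    de p^2 n > 1/25, so that rounding the number of hubs, about 72 de p^2 n,
    up to an integer changes it only by a constant factor. *)
Lemma biclique_planting (R : realType) (n : nat) (p de st : R) :
  0 < p <= 1 / 20 -> 0 < de <= 1 -> 0 <= st ->
  st ^+ 2 = de * p ^+ 2 * n%:R ^+ 3 -> 6 <= st -> 6 <= n%:R :> R ->
  exists I : {set {set 'I_n}}, [/\ I \subset vpairs n,
    #|I|%:R <= 50 * (st + de * p ^+ 2 * n%:R ^+ 2) &
    (1 + 2 * de) * (p ^+ 3 * (n ^_ 3)%:R) <= tri_mean p I].
Proof.
move=> p0120 /andP[de0 de1] st0 stE st6 n6.
have [p0 p1] := andP p0120.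
have p01 : 0 <= p <= 1 by rewrite ltW //=; move: p1; clear; lra.
set N : R := n%:R in stE n6 *.
have N0 : 0 < N by move: n6; clear; lra.
have n3 := ffact3_le R n; rewrite -/N in n3.
have dp0 : 0 <= 2 * de * p ^+ 3 by rewrite !mulr_ge0 ?exprn_ge0 ?ltW.
have target : (2 * de) * (p ^+ 3 * (n ^_ 3)%:R) <= 2 * p * st ^+ 2.
  rewrite stE mulrA; apply: le_trans (ler_wpM2l dp0 n3) _.
  by rewrite le_eqVlt; apply/orP; left; apply/eqP; clear; ring.
have hub0 : 0 <= de * p ^+ 2 * N ^+ 2 by rewrite !mulr_ge0 ?exprn_ge0 ?ltW.
have [h5|h5] := leP (5 * st) N.
  have x0 : 0 <= 3 * st by rewrite mulr_ge0.
  have [d d0 /andP[xd dx]] := exists_nat_above x0.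
  have dn : (1 + d <= n)%N.
    by rewrite -(ler_nat R) natrD -/N; move: dx st6 h5; clear; lra.
  have d2 : (2 <= d)%N by rewrite -(ler_nat R); move: xd st6; clear; lra.
  have [I [IU Is mI]] := biclique_seed p01 dn.
  exists I; split=> //.
    apply: le_trans (_ : d%:R <= _); first by rewrite ler_nat -[d]mul1n.
    by move: dx st6 hub0; clear; lra.
  apply: le_trans mI; rewrite mulrDl mul1r lerD2l; apply: le_trans target _.
  apply: le_trans (biclique_planting_mean 1 p0120 d2).
  have : p * (3 * st) ^+ 2 <= p * d%:R ^+ 2.
    by rewrite (ler_wpM2l (ltW p0)) // lerXn2r ?nnegrE // ltW.
  have : 0 <= p * st ^+ 2 by rewrite mulr_ge0 ?exprn_ge0 // ltW.
  clear; lra.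
pose h := de * p ^+ 2 * N.
have h0 : 0 <= h by rewrite !mulr_ge0 ?exprn_ge0 ?ltW.
have hN : st ^+ 2 = h * N ^+ 2 by rewrite stE /h; clear; ring.
have h25 : 1 < 25 * h.
  have : N ^+ 2 < (5 * st) ^+ 2 by rewrite ltrXn2r ?nnegrE ?mulr_ge0 // ltW.
  have N2 : 0 < N ^+ 2 by rewrite exprn_gt0.
  have -> : (5 * st) ^+ 2 = 25 * h * N ^+ 2 by rewrite exprMn hN; clear; ring.
  by rewrite -[X in X < _]mul1r ltr_pM2r.
have hN4 : h <= N / 400.
  have : de * p ^+ 2 <= 1 / 400 by move: de0 de1 p0 p1; clear => *; nra.
  by move/(ler_wpM2r (ltW N0)); rewrite -/h; clear; lra.
have x0 : 0 <= 72 * h by rewrite mulr_ge0.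
have [k k0 /andP[xk kx]] := exists_nat_above x0.
pose d := n./2.
have dN : N / 3 <= d%:R <= N / 2.
  have : N = (odd n)%:R + 2 * d%:R by rewrite /N -{1}[n]odd_double_half natrD
    -muln2 natrM mulrC.
  by move: n6; case: (odd n) => /= *; apply/andP; split; lra.
have [dN3 dN2] := andP dN.
have kdn : (k + d <= n)%N.
  by rewrite -(ler_nat R) natrD -/N; move: kx hN4 dN2 n6; clear; lra.
have d2 : (2 <= d)%N by rewrite -(ler_nat R); move: dN3 n6; clear; lra.
have [I [IU Is mI]] := biclique_seed p01 kdn.
exists I; split=> //.
  apply: le_trans (_ : k%:R * d%:R <= _); first by rewrite -natrM ler_nat.
  apply: le_trans (_ : 97 * h * (N / 2) <= _).
    by apply: ler_pM => //; move: kx h25; clear; lra.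
  have -> : de * p ^+ 2 * N ^+ 2 = h * N by rewrite /h; clear; ring.
  have := mulr_ge0 h0 (ltW N0); move: st0; clear; lra.
apply: le_trans mI; rewrite mulrDl mul1r lerD2l; apply: le_trans target _.
apply: le_trans (biclique_planting_mean k p0120 d2).
have : (72 * h) * (N / 3) ^+ 2 <= k%:R * d%:R ^+ 2.
  apply: ler_pM => //; [by rewrite exprn_ge0 // divr_ge0 // ltW|exact: ltW|].
  by rewrite lerXn2r ?nnegrE // divr_ge0 // ltW.
move/(ler_wpM2l (ltW p0)); rewrite hN; clear; lra.
Qed.

(** The factor delta mu / n^3 left by [Pr_tri_gt] is at least p^5. *)
Lemma Pr_tri_lower_bound (R : realType) (n : nat) (L p al de st phi mu : R) :
  p = expR (- L) -> de = al ^+ 3 -> mu = p ^+ 3 * (n ^_ 3)%:R -> 0 <= L ->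
  p <= 1 / 20 -> 0 < al <= 1 -> p <= al ^+ 4 ->
  6 <= al * p * n%:R -> 0 <= st -> st ^+ 2 = de * p ^+ 2 * n%:R ^+ 3 ->
  6 <= st -> (6 <= n)%N ->
  phi = Num.min (al ^+ 2 * p ^+ 2 * n%:R ^+ 2) (st + de * p ^+ 2 * n%:R ^+ 2) ->
  5 <= phi ->
  expR (- (51 * phi * L)) <=
    Pr (vpairs n) p (fun E => (1 + de) * mu < (tri E)%:R).
Proof.
move=> pE deE muE L0 p20 a01 pa big st0 stE st6 n6 phiE phi5.
have p0 : 0 < p by rewrite pE expR_gt0.
have [a0 a1] := andP a01.
have p020 : 0 < p <= 1 / 20 by rewrite p0.
have p01 : 0 <= p <= 1 by rewrite ltW //=; move: p20; clear; lra.
have de01 : 0 < de <= 1 by rewrite deE exprn_gt0 //= exprn_ile1 // ltW.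
have [de0 de1] := andP de01.
have n6R : 6 <= n%:R :> R by rewrite ler_nat.
have [I [IU Iphi mI]] : exists I : {set {set 'I_n}}, [/\ I \subset vpairs n,
    #|I|%:R <= 50 * phi & (1 + 2 * de) * mu <= tri_mean p I].
  rewrite phiE minEle; case: ifP => _; rewrite muE.
    by rewrite deE; apply: clique_planting.
  exact: biclique_planting.
have n3 := ffact3_ge R n6.
have N3 : 0 < n%:R ^+ 3 :> R by rewrite exprn_gt0 // (lt_le_trans _ n6R).
have mu0 : 0 < mu.
  rewrite muE mulr_gt0 ?exprn_gt0 // (lt_le_trans _ n3) // divr_gt0 //.
have h0 : 0 <= (1 + de) * mu by apply: mulr_ge0 (ltW mu0); move: de0; clear; lra.
have low := Pr_tri_gt p01 IU h0 mI.
rewrite -(ler_pM2l N3); apply: le_trans low.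
have pd : p <= de.
  by apply: le_trans pa _; rewrite deE exprS ler_piMl // exprn_ge0 // ltW.
have dmu : p ^+ 5 * n%:R ^+ 3 <= de * mu.
  apply: le_trans (_ : p * (p ^+ 3 * (n%:R ^+ 3 / 2)) <= _); last first.
    rewrite muE; apply: ler_pM => //; first exact: ltW.
      by rewrite mulr_ge0 ?exprn_ge0 ?divr_ge0 // ltW.
    by apply: ler_wpM2l => //; rewrite exprn_ge0 // ltW.
  have -> : p * (p ^+ 3 * (n%:R ^+ 3 / 2)) = p ^+ 4 * (1 / 2) * n%:R ^+ 3 by clear;
    field.
  rewrite ler_pM2r // exprSr; apply: ler_wpM2l; first by rewrite exprn_ge0 // ltW.
  by move: p20; clear; lra.
rewrite mulrC; apply: le_trans (_ : p ^+ #|I| * (p ^+ 5 * n%:R ^+ 3) <= _);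
  last first.
  by rewrite ler_wpM2l // exprn_ge0 // ltW.
rewrite mulrA ler_pM2r // -exprD pE -expRM_natl ler_expR mulrN lerN2.
rewrite ler_wpM2r // natrD; move: Iphi phi5; clear; lra.
Qed.

(** * Verification of the parameter inequalities *)

(** With E = p^(1/8), the hypothesis on [M] says M L^4 E <= 1, so that every
    positive power of E beats the powers of L that occur; moreover p = E^8,
    al >= E^2 because p <= al^4, and n p^2 is a large multiple of ln n.  All
    inequalities reduce to these facts.  The logarithm of the degree ratio
    [D0 / (N * p)] is at least 2 L / 3 because delta^3 n >= 1. *)
Lemma Pr_tri_rate (R : realType) (n : nat)
    (K c M L lN p al de st phi psi mu N : R) :
  20000 <= K -> 32 * 3 ^+ 5 * 256 <= K ->
  c * (8 * 864 * K) = 1 -> c <= 1 / (96 * 1000) ->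
  [/\ 576 <= M, 96 * 1152 <= M & 48 * 64 * 1152 <= M] ->
  1 <= L -> M * L ^+ 4 <= expR (L / 8) ->
  p = expR (- L) -> N = n%:R -> N = expR lN -> 36 <= N -> 2 <= lN ->
  0 < al <= 1 -> p * lN <= al ^+ 4 -> 1 <= al ^+ 9 * N ->
  [/\ 48 * lN <= N * p ^+ 2, 8 / c * lN <= N * p ^+ 2 & 864 * K * lN <= N * p ^+ 2] ->
  de = al ^+ 3 -> mu = p ^+ 3 * (n ^_ 3)%:R ->
  0 <= st -> st ^+ 2 = de * p ^+ 2 * N ^+ 3 ->
  phi = Num.min (al ^+ 2 * p ^+ 2 * N ^+ 2) (st + de * p ^+ 2 * N ^+ 2) ->
  psi = phi * L ->
  expR (- (51 * psi)) <=
    Pr (vpairs n) p (fun E => (1 + de) * mu < (tri E)%:R) <= expR (- (c * psi / 2)).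
Proof.
move=> K20000 K243 cE csmall [M576 M96 M48] L1 ML pE NE NlN N36 lN2 a01 plN aN
  [k48 kc kK] deE muE st0 stE phiE psiE.
have [a0 a1] := andP a01.
have L0 : 0 < L by apply: lt_le_trans L1.
have p0 : 0 < p by rewrite pE expR_gt0.
have N0 : 0 < N by rewrite NlN expR_gt0.
have de0 : 0 < de by rewrite deE exprn_gt0.
have de1 : de <= 1 by rewrite deE exprn_ile1 // ltW.
have K0 : 0 < K by apply: lt_le_trans K20000; rewrite ltr0n.
have c0 : 0 < c.
  have K8 : 0 < 8 * 864 * K by apply: mulr_gt0 K0; rewrite -natrM ltr0n.
  by rewrite -(pmulr_lgt0 _ K8) cE.
pose E := expR (- (L / 8)).
have E0 : 0 < E := expR_gt0 _.
have E1 : E <= 1 by rewrite /E -expR0 ler_expR oppr_le0 divr_ge0 // ltW.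
have L41 : 1 <= L ^+ 4 by rewrite exprn_ege1.
have LE : M * (L ^+ 4 * E) <= 1.
  by rewrite mulrA /E expRN ler_pdivrMr ?expR_gt0 // mul1r.
have LEM (m : R) : 0 <= m -> m <= M -> m * (L ^+ 4 * E) <= 1.
  move=> m0 mM; apply: le_trans LE; apply: ler_wpM2r mM.
  by rewrite mulr_ge0 ?exprn_ge0 // ltW.
have pE8 : p = E ^+ 8 by rewrite pE /E -expRM_natl; congr expR; clear; field.
have gE4 : expR (- (L / 2)) = E ^+ 4 by rewrite /E -expRM_natl; congr expR; clear;
  field.
have p1 : p <= 1 by rewrite pE8 exprn_ile1 // ltW.
have lN0 : 0 < lN by apply: lt_le_trans lN2.
have pa : p <= al ^+ 4.
  apply: le_trans plN; rewrite ler_peMr ?ltW //; move: lN2; clear; lra.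
have aE : E ^+ 2 <= al.
  rewrite leNgt; apply/negP => h; move: pa; apply/negP; rewrite -ltNge pE8.
  have -> : E ^+ 8 = (E ^+ 2) ^+ 4 by rewrite -exprM.
  by rewrite ltrXn2r ?nnegrE ?exprn_ge0 // ltW.
have NpL : L <= N * p ^+ 2 /\ 2 * L <= lN.
  have Np1 : 1 <= N * p ^+ 2 by apply: le_trans k48; move: lN2; clear; lra.
  have h : 2 * L <= lN.
    move: Np1; rewrite NlN pE -expRM_natl -expRD -{1}expR0 ler_expR; clear; lra.
  split=> //; apply: le_trans k48; move: h lN2; clear; lra.
have [NpL1 lN2L] := NpL.
have pL : p * L <= al ^+ 4.
  by apply: le_trans plN; apply: ler_wpM2l; [exact: ltW|move: lN2L L1; clear; lra].
pose Q := al ^+ 2 * p ^+ 2 * N ^+ 2.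
pose h := al ^+ 3 * p ^+ 2 * N ^+ 2.
have p20 : 0 < p ^+ 2 by rewrite exprn_gt0.
have p30 : 0 < p ^+ 3 by rewrite exprn_gt0.
have N20 : 0 < N ^+ 2 by rewrite exprn_gt0.
have N30 : 0 < N ^+ 3 by rewrite exprn_gt0.
have a20 : 0 < al ^+ 2 by rewrite exprn_gt0.
have a30 : 0 < al ^+ 3 by rewrite exprn_gt0.
have Q0 : 0 < Q by rewrite !mulr_gt0.
have h0 : 0 < h by rewrite !mulr_gt0.
have hQ : h <= Q.
  rewrite /h /Q exprS -!mulrA ler_piMl //.
  by rewrite !mulr_ge0 // ltW.
have phiQ : phi <= Q by rewrite phiE ge_min lexx.
have hphi : h <= phi.
  by rewrite phiE le_min hQ deE -/h lerDr.
have phi0 : 0 < phi by apply: lt_le_trans hphi.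
have psi0 : 0 < psi by rewrite psiE mulr_gt0.
have phipsi : phi <= psi by rewrite psiE ler_peMr // ltW.
have psiQ : psi <= Q * L by rewrite psiE ler_wpM2r // ltW.
have a31N : 1 <= al ^+ 3 * N.
  apply: le_trans aN _; apply: ler_wpM2r; first exact: ltW.
  by rewrite ler_wiXn2l // ltW.
have hNp : N * p ^+ 2 <= h.
  rewrite /h (_ : _ * N ^+ 2 = (al ^+ 3 * N) * (N * p ^+ 2)); last by clear; ring.
  by rewrite ler_peMl // mulr_ge0 // ltW.
have psiNp : N * p ^+ 2 <= psi by apply: le_trans hNp (le_trans hphi phipsi).
have p3N2 : p ^+ 3 * N ^+ 2 <= h.
  rewrite /h -mulrA (_ : p ^+ 3 * N ^+ 2 = p * (p ^+ 2 * N ^+ 2)); last by clear;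
    ring.
  apply: ler_wpM2r; first by rewrite mulr_ge0 // ltW.
  by apply: le_trans pa _; rewrite ler_wiXn2l // ltW.
have p3psi : p ^+ 3 * N ^+ 2 <= psi by apply: le_trans p3N2 (le_trans hphi phipsi).
have n6 : (6 <= n)%N by rewrite -(ler_nat R) -NE; move: N36; clear; lra.
have E4L : 576 * (L ^+ 2 * E ^+ 4) <= 1.
  apply: le_trans (LEM 576 (ler0n R 576) M576).
  apply: ler_wpM2l (ler0n R 576) _ _ _.
  apply: ler_pM; [exact: exprn_ge0 (ltW L0)|exact: exprn_ge0 (ltW E0)| |].
    by rewrite ler_weXn2l.
  by rewrite -[leRHS]expr1 ler_wiXn2l // ltW.
pose tl := al * p * N / (1152 * L).
have c1152 : 0 < 1152 * L by apply: mulr_gt0 L0; rewrite ltr0n.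
pose S := de * p ^+ 3 * N ^+ 3 / 12.
pose t1 := S / (96 * psi).
have tl1 : tl <= t1.
  have psi96 : 0 < 96 * psi by apply: mulr_gt0 psi0; rewrite ltr0n.
  rewrite /tl /t1 ler_pdivlMr // mulrAC ler_pdivrMr //.
  apply: le_trans (_ : al * p * N * (96 * (Q * L)) <= _).
    by apply: ler_wpM2l; [rewrite !mulr_ge0 // ltW|apply: ler_wpM2l].
  rewrite /S /Q deE le_eqVlt; apply/orP; left; apply/eqP; clear; by field.
have E6 : 0 < E ^+ 6 by rewrite exprn_gt0.
have Ek (m : R) (j : nat) : 0 <= m -> m <= M -> m * E ^+ j.+1 <= 1.
  move=> m0 mM; apply: le_trans (LEM m m0 mM); apply: ler_wpM2l => //.
  apply: le_trans (_ : E <= _); first by rewrite -[leRHS]expr1 ler_wiXn2l // ltW.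
  by rewrite ler_peMl // ltW.
have apN : 48 * 64 * 1152 * L <= al * p * N.
  rewrite -(ler_pM2r E6).
  have cE6 : 48 * 64 * 1152 * E ^+ 6 <= 1.
    by apply: (Ek _ 5%N _ M48); rewrite -!natrM ler0n.
  apply: le_trans (_ : 1 * L <= _).
    by rewrite mulrAC; apply: ler_wpM2r cE6; exact: ltW.
  rewrite mul1r; apply: le_trans NpL1 _.
  have -> : N * p ^+ 2 = E ^+ 2 * (p * N * E ^+ 6).
    by rewrite [in LHS]expr2 {1}pE8; clear; ring.
  have -> : al * p * N * E ^+ 6 = al * (p * N * E ^+ 6) by clear; ring.
  by apply: ler_wpM2r aE; rewrite !mulr_ge0 // ltW.
have t1_big : 48 * 64 <= t1.
  apply: le_trans tl1; rewrite /tl ler_pdivlMr //.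
  by move: apN; clear; lra.
have t10 : 0 < t1 by apply: lt_le_trans t1_big; rewrite -natrM ltr0n.
pose t2 := K * de ^+ 2 * p ^+ 3 * N ^+ 3 / psi.
have psi_le : psi <= de ^+ 2 * p * N ^+ 2.
  apply: le_trans psiQ _.
  have -> : Q * L = (al ^+ 2 * p * N ^+ 2) * (p * L) by rewrite /Q; clear; ring.
  have -> : de ^+ 2 * p * N ^+ 2 = (al ^+ 2 * p * N ^+ 2) * al ^+ 4.
    by rewrite deE; clear; ring.
  by apply: ler_wpM2l pL; rewrite !mulr_ge0 // ltW.
have t2_big : K * (N * p ^+ 2) <= t2.
  rewrite /t2 ler_pdivlMr //.
  apply: le_trans (_ : K * (N * p ^+ 2) * (de ^+ 2 * p * N ^+ 2) <= _).
    by apply: ler_wpM2l psi_le; rewrite !mulr_ge0 // ltW.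
  by rewrite le_eqVlt; apply/orP; left; apply/eqP; clear; ring.
have K1 : 1 <= K by apply: le_trans K20000; rewrite ler1n.
have t2_96 : 96 * L <= t2.
  apply: le_trans t2_big; apply: le_trans (_ : N * p ^+ 2 <= _).
    by apply: le_trans k48; move: lN2L; clear; lra.
  by rewrite ler_peMl // mulr_ge0 // ltW.
(* This is n p^(1/2). *)
pose D1 := N * expR (- (L / 2)).
have A1 : 48 * psi ^+ 2 <= S * D1.
  apply: le_trans (_ : 48 * (Q * L) ^+ 2 <= _).
    by apply: ler_wpM2l => //; rewrite lerXn2r ?nnegrE ?mulr_ge0 // ltW.
  rewrite /S /D1 gE4 deE.
  pose G := al ^+ 3 * p ^+ 3 * N ^+ 4 / 12.
  have -> : 48 * (Q * L) ^+ 2 = G * (576 * (al * p * L ^+ 2)).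
    by rewrite /Q /G; clear; field.
  have -> : al ^+ 3 * p ^+ 3 * N ^+ 3 / 12 * (N * E ^+ 4) = G * E ^+ 4.
    by rewrite /G; clear; field.
  apply: ler_wpM2l; first by rewrite divr_ge0 // !mulr_ge0 ?exprn_ge0 // ltW.
  apply: le_trans (_ : 576 * (p * L ^+ 2) <= _).
    apply: ler_wpM2l; first exact: ler0n.
    by rewrite -mulrA ler_piMl // mulr_ge0 ?exprn_ge0 // ltW.
  have -> : 576 * (p * L ^+ 2) = 576 * (L ^+ 2 * E ^+ 4) * E ^+ 4.
    by rewrite pE8; clear; ring.
  by rewrite ler_piMl // exprn_ge0 // ltW.
pose m1 := Q / 128.
have m10 : 0 < m1 by apply: divr_gt0 Q0 _; rewrite ltr0n.
have m1S : (2 * m1) ^+ 3 <= (S / 16) ^+ 2.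
  have -> : (2 * m1) ^+ 3 = Q ^+ 3 / (64 ^+ 3) by rewrite /m1; clear; field.
  have -> : (S / 16) ^+ 2 = Q ^+ 3 / (9 * 64 ^+ 2).
    by rewrite /S /Q deE; clear; field.
  apply: ler_wpM2l; first by rewrite exprn_ge0 // ltW.
  rewrite lef_pV2 ?posrE; last 2 first.
  - by apply: exprn_gt0; rewrite ltr0n.
  - by apply: mulr_gt0; [rewrite ltr0n|apply: exprn_gt0; rewrite ltr0n].
  by rewrite [leRHS]exprS; apply: ler_wpM2r; [apply: exprn_ge0;
    rewrite ler0n|rewrite ler_nat].
have psim1 : psi <= 128 * m1 * L.
  apply: le_trans psiQ _; rewrite /m1 le_eqVlt; apply/orP; left; apply/eqP; clear;
    by field.
have D1y : 256 * (N * p) <= D1.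
  rewrite /D1 gE4 pE8 (_ : 256 * (N * E ^+ 8) = 256 * E ^+ 4 * (N * E ^+ 4));
    last by clear; ring.
  apply: ler_piMl; first by rewrite mulr_ge0 ?exprn_ge0 // ltW.
  apply: (Ek _ 3%N); first by rewrite ler0n.
  by apply: le_trans M576; rewrite ler_nat.
have small : N * (N + 1) * expR (- (128 * (N * p))) <= 1.
  have Np : lN <= N * p.
    apply: le_trans (_ : N * p ^+ 2 <= _).
      by apply: le_trans k48; move: lN0; clear; lra.
    by apply: ler_wpM2l; [exact: ltW|rewrite expr2 ler_piMl // ltW].
  apply: le_trans (_ : N ^+ 3 * expR (- (3 * lN)) <= _).
    apply: ler_pM; rewrite ?expR_ge0 ?mulr_ge0 ?addr_ge0 ?(ltW N0) //.
      by move: N36; clear; nra.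
    rewrite ler_expR lerN2; move: Np lN0; clear; lra.
  by rewrite {1}NlN -expRM_natl -expRD subrr expR0.
pose D0 := Num.min N st.
have st2h : st ^+ 2 = h * N by rewrite stE deE /h; clear; ring.
have st_pos : 0 < st.
  rewrite lt0r st0 andbT; apply/eqP => s0; move: st2h; rewrite s0 expr0n /=.
  by move/esym/eqP; rewrite mulf_eq0 (gt_eqF h0) (gt_eqF N0).
have D00 : 0 < D0 by rewrite lt_min N0.
pose l := 2 / 3 * L.
have l0 : 0 < l by rewrite mulr_gt0.
have phist : phi <= st + h by rewrite phiE ge_min deE -/h lexx orbT.
have hst : st < N -> h <= st.
  move=> sN; rewrite -(ler_pM2r N0) -st2h expr2; apply: ler_wpM2l => //; exact: ltW.
have sth : N <= st -> st <= h.
  by move=> Ns; rewrite -(ler_pM2r N0) -st2h expr2 ler_wpM2l.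
have hD0 : (N <= D0) || (psi / 6000 < D0 * l).
  rewrite /D0; case: (leP N st) => sN; first by rewrite lexx.
  apply/orP; right; have phi2 : psi <= 2 * st * L.
    rewrite psiE; apply: ler_wpM2r; first exact: ltW.
    by move: phist (hst sN); clear; lra.
  have : 0 < st * L by rewrite mulr_gt0.
  rewrite /l; move: phi2; clear; lra.
have lD0 : l <= ln (D0 / (N * p)).
  have y0 : 0 < N * p by rewrite mulr_gt0.
  rewrite -ler_expR lnK ?posrE ?divr_gt0 // ler_pdivlMr // /D0.
  case: (leP N st) => sN.
    rewrite pE mulrCA -expRD -[leRHS]mulr1; apply: ler_wpM2l; first exact: ltW.
    rewrite -expR0 ler_expR /l; move: L0; clear; lra.
  have h6 : (expR l * (N * p)) ^+ 6 <= st ^+ 6.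
    have -> : st ^+ 6 = (al ^+ 9 * N) * (p ^+ 6 * N ^+ 8).
      have -> : st ^+ 6 = (st ^+ 2) ^+ 3 by rewrite -exprM.
      by rewrite st2h /h; clear; ring.
    apply: le_trans (_ : p ^+ 6 * N ^+ 8 <= _); last first.
      by rewrite ler_peMl // mulr_ge0 ?exprn_ge0 // ltW.
    rewrite exprMn exprMn -expRM_natl.
    have -> : p ^+ 6 * N ^+ 8 = N ^+ 2 * (N ^+ 6 * p ^+ 6) by clear; ring.
    apply: ler_wpM2r; first by rewrite mulr_ge0 ?exprn_ge0 // ltW.
    rewrite NlN -expRM_natl ler_expR /l; move: lN2L; clear; lra.
  rewrite leNgt; apply/negP => hh; move: h6; apply/negP; rewrite -ltNge.
  by rewrite ltrXn2r ?nnegrE ?mulr_ge0 ?expR_ge0 // ltW.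
have DW : D0 * (psi / 6000) <= l * (de * p ^+ 2 * N ^+ 3 / 2000).
  have -> : de * p ^+ 2 * N ^+ 3 = h * N by rewrite deE /h; clear; ring.
  have Dphi : D0 * phi <= 2 * (h * N).
    rewrite /D0; case: (leP N st) => sN.
      have := ler_wpM2l (ltW N0) phist; have := ler_wpM2l (ltW N0) (sth sN).
      clear; lra.
    have := ler_wpM2l st0 phist; have := ler_wpM2l st0 (hst sN).
    rewrite -st2h; clear; lra.
  have := ler_wpM2r (ltW L0) Dphi; rewrite psiE /l; clear; lra.
pose Dh := 256 * de ^+ 2 * N ^+ 3 * p ^+ 2 / psi.
have A2 : 3 * L * psi + p ^+ 3 * N ^+ 2 + psi <= (S / 12) / (psi / Dh).
  have c256 : 0 < 256 :> R by rewrite ltr0n.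
  have -> : (S / 12) / (psi / Dh) = (16 / 9 * al ^+ 9 * N ^+ 6 * p ^+ 5) / psi ^+ 2.
    rewrite /S /Dh deE; move: psi0 a0 p0 N0; clear => psi0 a0 p0 N0; field.
    by rewrite !lt0r_neq0.
  rewrite ler_pdivlMr ?exprn_gt0 //.
  apply: le_trans (_ : 5 * L * psi * psi ^+ 2 <= _).
    apply: ler_wpM2r; first by rewrite exprn_ge0 // ltW.
    have : psi <= L * psi by rewrite ler_peMl // ltW.
    move: p3psi; clear; lra.
  have -> : 5 * L * psi * psi ^+ 2 = 5 * L * psi ^+ 3 by clear; ring.
  apply: le_trans (_ : 5 * L * (Q * L) ^+ 3 <= _).
    apply: ler_wpM2l; first by rewrite mulr_ge0 // ltW.
    by rewrite lerXn2r ?nnegrE ?mulr_ge0 // ltW.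
  pose G := al ^+ 6 * N ^+ 6 * p ^+ 5.
  have -> : 5 * L * (Q * L) ^+ 3 = G * (5 * (L ^+ 4 * p)) by rewrite /Q /G; clear;
    ring.
  have -> : 16 / 9 * al ^+ 9 * N ^+ 6 * p ^+ 5 = G * (16 / 9 * al ^+ 3) by rewrite
    /G; clear; ring.
  apply: ler_wpM2l; first by rewrite !mulr_ge0 ?exprn_ge0 // ltW.
  have a3E : E ^+ 6 <= al ^+ 3.
    have -> : E ^+ 6 = (E ^+ 2) ^+ 3 by rewrite -exprM.
    by rewrite lerXn2r ?nnegrE ?exprn_ge0 // ltW.
  have h5 : 5 * (L ^+ 4 * E) <= 1.
    by apply: LEM => //; apply: le_trans M576; rewrite ler_nat.
  have -> : L ^+ 4 * p = L ^+ 4 * E * E * E ^+ 6 by rewrite pE8; clear; ring.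
  have : 5 * (L ^+ 4 * E) * (E * E ^+ 6) <= 1 * (E * E ^+ 6).
    by apply: ler_wpM2r h5; rewrite mulr_ge0 // ltW.
  have : E * E ^+ 6 <= E ^+ 6 by rewrite ler_piMl // ltW.
  move: a3E (ltW E6); clear; lra.
have A3 : 8 * p ^+ 3 * N ^+ 2 / t2 <= psi.
  have t20 : 0 < t2 by apply: lt_le_trans t2_96; rewrite mulr_gt0.
  rewrite ler_pdivrMr //; apply: le_trans (_ : 8 * psi <= _).
    by rewrite -mulrA ler_wpM2l.
  rewrite mulrC; apply: ler_wpM2l; first exact: ltW.
  by apply: le_trans t2_96; move: L1; clear; lra.
have A4 : 32 * expR (1 + L / 8) * p * D1 <= t1.
  apply: le_trans tl1; rewrite /tl ler_pdivlMr // /D1 gE4 expRD.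
  have -> : expR (L / 8) = E^-1 by rewrite /E expRN invrK.
  have -> : 32 * (expR 1 / E) * p * (N * E ^+ 4) * (1152 * L) =
      (p * N * E ^+ 2) * ((32 * 1152) * (L * E) * expR 1).
    by move: E0; clear => E0; field; rewrite lt0r_neq0.
  apply: le_trans (_ : p * N * E ^+ 2 * 1 <= _).
    apply: ler_wpM2l; first by rewrite !mulr_ge0 ?exprn_ge0 // ltW.
    have LE1 : L * E <= L ^+ 4 * E.
      by apply: ler_wpM2r; [exact: ltW|rewrite -[leLHS]expr1 ler_weXn2l].
    have m0 : 0 <= 96 * 1152 :> R by rewrite -natrM ler0n.
    have h96 := LEM _ m0 M96.
    apply: le_trans h96; rewrite [leLHS](_ : _ = 32 * 1152 * ((L * E) * expR 1));
      last by clear; ring.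
    apply: le_trans (_ : 32 * 1152 * ((L ^+ 4 * E) * 3) <= _); last first.
      by rewrite le_eqVlt; apply/orP; left; apply/eqP; clear; ring.
    apply: ler_wpM2l; first by rewrite -natrM ler0n.
    by apply: ler_pM; rewrite ?expR_ge0 ?expR1_le3 // mulr_ge0 // ltW.
  rewrite mulr1; have -> : al * p * N = p * N * al by clear; ring.
  by apply: ler_wpM2l aE; rewrite mulr_ge0 // ltW.
have A4' : 4 * p ^+ 3 * N ^+ 2 / t1 <= L * m1 / 64.
  rewrite ler_pdivrMr //; apply: le_trans (_ : m1 / 64 * (48 * 64) <= _); last first.
    have m64 : 0 <= m1 / 64 by rewrite divr_ge0 // ltW.
    apply: le_trans (ler_wpM2l m64 t1_big) _; rewrite ler_wpM2r ?(ltW t10) //.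
    by rewrite ler_wpM2r ?invr_ge0 // ler_peMl // ltW.
  have aEp : 16 * p <= al ^+ 2 .
    apply: le_trans (_ : E ^+ 4 <= _); last first.
      by rewrite (_ : E ^+ 4 = (E ^+ 2) ^+ 2) ?lerXn2r ?nnegrE ?exprn_ge0 -?exprM
        // ltW.
    rewrite pE8 (_ : 16 * E ^+ 8 = 16 * E ^+ 4 * E ^+ 4); last by clear; ring.
    rewrite ler_piMl ?exprn_ge0 ?(ltW E0) //; apply: (Ek _ 3%N) => //.
    by apply: le_trans M576; rewrite ler_nat.
  have q0 : 0 <= p ^+ 2 * N ^+ 2 by rewrite mulr_ge0 // ltW.
  have := ler_wpM2r q0 aEp; move: (ltW Q0); rewrite /m1 /Q; clear; lra.
have psic : 8 / c * lN <= psi by apply: le_trans kc psiNp.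
have A5 : 12 * N ^+ 2 <= expR (c * psi / 2).
  have h4 : 4 * lN <= c * psi / 2.
    have := ler_wpM2l (ltW c0) psic.
    have -> : c * (8 / c * lN) = 8 * lN by move: c0; clear => c0; field;
      rewrite lt0r_neq0.
    clear; lra.
  apply: le_trans (_ : N ^+ 4 <= _).
    have -> : N ^+ 4 = N ^+ 2 * N ^+ 2 by rewrite -exprD.
    apply: ler_wpM2r; first exact: ltW.
    by move: N36; clear; nra.
  by rewrite NlN -expRM_natl ler_expR.
have A6 : 864 * K <= psi.
  apply: le_trans psiNp; apply: le_trans kK.
  apply: ler_peMr; last by move: lN2; clear; lra.
  by apply: mulr_ge0; [exact: ler0n|exact: ltW].
apply/andP; split; last first.
  exact: (@Pr_tri_upper_tail R n K c L de psi m1 D0 l p N S Dh t2 D1 t1 mu).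
have -> : 51 * psi = 51 * phi * L by rewrite psiE mulrA.
have Np48 : 96 <= N * p ^+ 2 by apply: le_trans k48; move: lN2; clear; lra.
apply: (@Pr_tri_lower_bound R n L p al de st phi mu) => //; rewrite -?NE //.
- exact: ltW.
- apply: le_trans (_ : E ^+ 8 <= _); first by rewrite pE8.
  have := Ek 20 7%N; rewrite ler0n => /(_ isT) h20.
  have : 20 <= M by apply: le_trans M576; rewrite ler_nat.
  by move/h20; clear; lra.
- apply: le_trans apN; apply: le_trans (_ : 48 * 64 * 1152 * 1 <= _).
    by rewrite mulr1 -!natrM ler_nat.
  by apply: ler_wpM2l L1; rewrite -!natrM ler0n.
- rewrite leNgt; apply/negP => s6.
  have : st ^+ 2 < 6 ^+ 2 by rewrite ltrXn2r ?nnegrE.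
  rewrite st2h; apply/negP; rewrite -leNgt.
  apply: le_trans (_ : 96 * 36 <= _); first by clear; lra.
  apply: ler_pM => //; apply: le_trans hNp; exact: Np48.
by apply: le_trans hphi; apply: le_trans hNp; move: Np48; clear; lra.
Qed.

(** * Comparison with the stated order of magnitude and conclusion *)

(** The two expressions differ by a factor ln n instead of L in two places.  If
    ln n > 4 L then p > n^(-1/4), and st >= n^(9/8) shows that st ln n is
    at most 8 times the hub term. *)
Lemma target_compare (R : realType) (L lN p al st N phi psi Phi : R) :
  1 <= L -> 2 * L <= lN -> p = expR (- L) -> N = expR lN ->
  0 < al <= 1 -> p <= al ^+ 4 -> 0 <= st ->
  st ^+ 2 = al ^+ 3 * p ^+ 2 * N ^+ 3 ->
  phi = Num.min (al ^+ 2 * p ^+ 2 * N ^+ 2) (st + al ^+ 3 * p ^+ 2 * N ^+ 2) ->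
  psi = phi * L ->
  Phi = Num.min (al ^+ 2 * p ^+ 2 * N ^+ 2 * lN)
                (st * lN + al ^+ 3 * p ^+ 2 * N ^+ 2 * L) ->
  psi <= Phi <= 9 * psi.
Proof.
move=> L1 lN2 pE NE /andP[a0 a1] pa st0 stE phiE psiE PhiE.
have L0 : 0 <= L by apply: le_trans L1.
have p0 : 0 < p by rewrite pE expR_gt0.
have N0 : 0 < N by rewrite NE expR_gt0.
set Q := al ^+ 2 * p ^+ 2 * N ^+ 2 in phiE PhiE.
set h := al ^+ 3 * p ^+ 2 * N ^+ 2 in phiE PhiE.
have Q0 : 0 <= Q by rewrite !mulr_ge0 ?exprn_ge0 // ltW.
have h0 : 0 < h by rewrite !mulr_gt0 ?exprn_gt0.
have hQ : h <= Q.
  rewrite /h /Q exprS -!mulrA ler_piMl // !mulr_ge0 ?exprn_ge0 // ltW //.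
have hphi : h <= phi by rewrite phiE le_min hQ lerDr.
have LlN : L <= lN by move: L1 lN2; clear; lra.
have phiQ : phi <= Q by rewrite phiE ge_min lexx.
have phist : phi <= st + h by rewrite phiE ge_min lexx orbT.
apply/andP; split.
  rewrite PhiE psiE le_min; apply/andP; split.
    by apply: ler_pM => //; apply: le_trans hphi; exact: ltW.
  apply: le_trans (ler_wpM2r L0 phist) _; rewrite mulrDl lerD2r.
  by apply: ler_wpM2l.
have [l4|l4] := leP lN (4 * L).
  have : Phi <= 4 * psi.
    rewrite psiE phiE minEle; case: ifP => _.
      have : Phi <= Q * lN by rewrite PhiE ge_min lexx.
      have := ler_wpM2l Q0 l4; clear; lra.
    have : Phi <= st * lN + h * L by rewrite PhiE ge_min lexx orbT.
    have := ler_wpM2l st0 l4; have := mulr_ge0 (ltW h0) L0; clear; lra.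
  have : 0 <= psi by rewrite psiE mulr_ge0 // (le_trans (ltW h0)).
  clear; lra.
have stN : lN / 8 * N <= st.
  apply: le_trans (_ : expR (lN / 8) * N <= _).
    apply: ler_wpM2r; first exact: ltW.
    by apply: le_trans (expR_ge1Dx _); rewrite lerDr.
  have h2 : (expR (lN / 8) * N) ^+ 2 <= st ^+ 2.
    apply: le_trans (_ : p ^+ 3 * N ^+ 3 <= _); last first.
      rewrite stE; apply: ler_wpM2r; first by rewrite exprn_ge0 // ltW.
      rewrite exprS; apply: ler_wpM2r; first by rewrite exprn_ge0 // ltW.
      by apply: le_trans pa _; rewrite ler_wiXn2l // ltW.
    rewrite NE pE -expRD -!expRM_natl -expRD ler_expR; move: l4; clear; lra.
  rewrite leNgt; apply/negP => hh; move: h2; apply/negP; rewrite -ltNge.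
  by rewrite ltrXn2r ?nnegrE ?mulr_ge0 ?expR_ge0 // ltW.
have st_pos : 0 < st.
  apply: lt_le_trans stN; rewrite mulr_gt0 // divr_gt0 //.
  by apply: lt_le_trans LlN; apply: lt_le_trans L1.
have st8 : st * lN <= 8 * h * L.
  rewrite -(ler_pM2l st_pos) mulrA -expr2 stE.
  have -> : al ^+ 3 * p ^+ 2 * N ^+ 3 * lN = 8 * h * (lN / 8 * N) by rewrite /h;
    clear; field.
  have -> : st * (8 * h * L) = 8 * h * (st * L) by clear; ring.
  apply: ler_wpM2l; first by rewrite mulr_ge0 // ltW.
  by apply: le_trans stN _; rewrite ler_peMr.
have : Phi <= st * lN + h * L by rewrite PhiE ge_min lexx orbT.
have := ler_wpM2r L0 hphi; rewrite psiE; move: st8; clear; lra.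
Qed.

Lemma Gnp_prob_tri (R : realType) (n : nat) (p a : R) :
  @Gnp_prob R n p (fun E => a < (Ntriangle E)%:R) =
  Pr (vpairs n) p (fun E => a < (tri E)%:R).
Proof.
rewrite PrE /Gnp_prob; apply: eq_big => // E.
by case: (boolP (E \subset vpairs n)) => //= EU; rewrite NtriangleE.
Qed.

Lemma powR_expn (R : realType) (x a : R) (k : nat) : (x `^ a) ^+ k = x `^ (a * k%:R).
Proof. by rewrite -powR_mulrn ?powR_ge0 // powRrM. Qed.

(** Real powers of the statement are turned into integer powers of
    delta^(1/3). *)
Lemma upper_rate_bounds (R : realType) (n : nat) (K c M L p de : R) :
  let lN := ln n%:R : R in
  20000 <= K -> 32 * 3 ^+ 5 * 256 <= K ->
  c * (8 * 864 * K) = 1 -> c <= 1 / (96 * 1000) ->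
  [/\ 576 <= M, 96 * 1152 <= M & 48 * 64 * 1152 <= M] ->
  0 < p -> L = ln (1 / p) -> 1 <= L -> M * L ^+ 4 <= expR (L / 8) ->
  (36 <= n)%N -> 2 <= lN -> de <= 1 ->
  p `^ (3 / 4) * lN `^ (3 / 4) <= de ->
  n%:R `^ (- (1 / 3)) <= de ->
  [/\ 48 * lN <= n%:R * p ^+ 2, 8 / c * lN <= n%:R * p ^+ 2 &
      864 * K * lN <= n%:R * p ^+ 2] ->
  c / 18 <= upper_rate de p n /
    Num.min (de `^ (2 / 3) * p ^+ 2 * n%:R ^+ 2 * lN)
       (de `^ (1 / 2) * p * n%:R `^ (3 / 2) * lN + de * p ^+ 2 * n%:R ^+ 2 * L) <= 51.
Proof.
move=> lN K20000 K243 cE csmall HM p0 LE L1 ML n36 lN2 de1 d1 d2 Hk.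
have NR : 36 <= n%:R :> R by rewrite ler_nat.
have N0 : 0 < n%:R :> R by apply: lt_le_trans NR.
have lN0 : 0 < lN by apply: lt_le_trans lN2.
have de0 : 0 < de by apply: lt_le_trans d2; rewrite powR_gt0.
pose al := de `^ (1 / 3).
have a0 : 0 < al by rewrite powR_gt0.
have deE : de = al ^+ 3.
  by rewrite /al powR_expn (_ : 1 / 3 * 3%:R = 1) ?powRr1 ?ltW //; field.
have a2E : de `^ (2 / 3) = al ^+ 2.
  by rewrite /al powR_expn; congr (_ `^ _); field.
have a1 : al <= 1.
  rewrite leNgt; apply/negP => h; move: de1; apply/negP; rewrite -ltNge deE.
  by rewrite exprn_egt1.
pose st := de `^ (1 / 2) * p * n%:R `^ (3 / 2).
have st0 : 0 <= st by rewrite !mulr_ge0 ?powR_ge0 // ltW.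
have stE : st ^+ 2 = de * p ^+ 2 * n%:R ^+ 3.
  rewrite /st !exprMn !powR_expn.
  rewrite (_ : 1 / 2 * 2%:R = 1); last by field.
  rewrite (_ : 3 / 2 * 2%:R = 3%:R); last by field.
  by rewrite powRr1 ?powR_mulrn // ltW.
have pE : p = expR (- L) by rewrite LE div1r lnV ?posrE // opprK lnK.
have NlN : n%:R = expR lN by rewrite lnK.
have plN : p * lN <= al ^+ 4.
  have h : (p * lN) ^+ 3 <= (al ^+ 4) ^+ 3.
    have -> : (al ^+ 4) ^+ 3 = de ^+ 4 by rewrite deE -!exprM.
    have -> : (p * lN) ^+ 3 = (p `^ (3 / 4) * lN `^ (3 / 4)) ^+ 4.
      rewrite !exprMn !powR_expn (_ : 3 / 4 * 4%:R = 3%:R); last by field.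
      by rewrite !powR_mulrn // ltW.
    by rewrite lerXn2r ?nnegrE ?mulr_ge0 ?powR_ge0 // ltW.
  rewrite leNgt; apply/negP => hh; move: h; apply/negP; rewrite -ltNge.
  by rewrite ltrXn2r ?nnegrE ?exprn_ge0 ?mulr_ge0 // ltW.
have aN : 1 <= al ^+ 9 * n%:R.
  have h : (n%:R `^ (- (1 / 3))) ^+ 3 <= de ^+ 3.
    by rewrite lerXn2r ?nnegrE ?powR_ge0 // ltW.
  have -> : al ^+ 9 = de ^+ 3 by rewrite deE -exprM.
  apply: le_trans (ler_wpM2r (ltW N0) h); rewrite powR_expn.
  rewrite (_ : - (1 / 3) * 3%:R = -1); last by field.
  by rewrite powR_inv1 ?mulVf ?gt_eqF // ltW.
have pa : p <= al ^+ 4.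
  by apply: le_trans plN; rewrite ler_peMr ?(ltW p0) //; move: lN2; clear; lra.
have lN2L : 2 * L <= lN.
  have Np1 : 1 <= n%:R * p ^+ 2.
    by case: Hk => k48 _ _; apply: le_trans k48; move: lN2; clear; lra.
  move: Np1; rewrite NlN pE -expRM_natl -expRD -{1}expR0 ler_expR; clear; lra.
pose phi := Num.min (al ^+ 2 * p ^+ 2 * n%:R ^+ 2) (st + de * p ^+ 2 * n%:R ^+ 2).
pose psi : R := phi * L.
pose mu := p ^+ 3 * (n ^_ 3)%:R.
have a01 : 0 < al <= 1 by rewrite a0.
have /andP[lo hi] := @Pr_tri_rate R n K c M L lN p al de st phi psi mu n%:R
  K20000 K243 cE csmall HM L1 ML pE erefl NlN NR lN2 a01 plN aN Hk deE erefl
  st0 stE erefl erefl.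
set Phi := Num.min _ _.
have stE' : st ^+ 2 = al ^+ 3 * p ^+ 2 * n%:R ^+ 3 by rewrite stE -deE.
have phiE' : phi = Num.min (al ^+ 2 * p ^+ 2 * n%:R ^+ 2) (st + al ^+ 3 * p ^+ 2 *
  n%:R ^+ 2).
  by rewrite /phi -deE.
have PhiE' : Phi = Num.min (al ^+ 2 * p ^+ 2 * n%:R ^+ 2 * lN)
                (st * lN + al ^+ 3 * p ^+ 2 * n%:R ^+ 2 * L).
  by rewrite /Phi a2E -/st -deE.
have /andP[psiPhi Phipsi] : psi <= Phi <= 9 * psi.
  exact: (target_compare L1 lN2L pE NlN a01 pa st0 stE' phiE' erefl PhiE').
have phi0 : 0 < phi.
  by rewrite phiE' lt_min ltr_wpDl // !mulr_gt0 ?exprn_gt0.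
have psi0 : 0 < psi by rewrite mulr_gt0 // (lt_le_trans _ L1).
have Phi0 : 0 < Phi by apply: lt_le_trans psiPhi.
have rE : upper_rate de p n = - ln (Pr (vpairs n) p (fun E =>
  (1 + de) * mu < (tri E)%:R)).
  by rewrite /upper_rate -Gnp_prob_tri /mu mulrA.
have P0 := lt_le_trans (expR_gt0 _) lo.
have lo' : - (51 * psi) <= ln (Pr (vpairs n) p (fun E => (1 + de) * mu < (tri E)%:R)).
  by rewrite -ler_expR lnK ?posrE.
have hi' : ln (Pr (vpairs n) p (fun E =>
  (1 + de) * mu < (tri E)%:R)) <= - (c * psi / 2).
  by rewrite -ler_expR lnK ?posrE.
have c0 : 0 < c.
  have K0 : 0 < K by apply: lt_le_trans K20000; rewrite ltr0n.
  have K8 : 0 < 8 * 864 * K by apply: mulr_gt0 K0; rewrite -natrM ltr0n.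
  by rewrite -(pmulr_lgt0 _ K8) cE.
rewrite ler_pdivlMr // ler_pdivrMr // rE.
have cPhi := ler_wpM2l (ltW c0) Phipsi.
move: lo' hi' psiPhi cPhi; clear; move: (ln _) (Phi) (psi) => P X Y lo hi h1 h2.
by apply/andP; split; lra.
Qed.

Lemma expR_dominates (R : realType) (M : R) : 0 <= M ->
  exists2 L0 : R, 1 <= L0 & forall L, L0 <= L -> M * L ^+ 4 <= expR (L / 8).
Proof.
move=> M0; exists (1 + M * (8 ^+ 5 * 5`!%:R)).
  by rewrite lerDl mulr_ge0 // mulr_ge0 // exprn_ge0.
move=> L L0L; have L0 : 0 <= L.
  apply: le_trans L0L; rewrite addr_ge0 // mulr_ge0 // mulr_ge0 // exprn_ge0 //.
have ML : M * (8 ^+ 5 * 5`!%:R) <= L by apply: le_trans L0L; rewrite lerDr.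
have h := @expR_ge1Dxn R (L / 8) 4 (divr_ge0 L0 (ler0n R 8)).
apply: le_trans (_ : (L / 8) ^+ 5 / 5`!%:R <= _); last first.
  by apply: le_trans h; rewrite lerDr.
have f0 : 0 < 5`!%:R :> R by rewrite ltr0n.
rewrite ler_pdivlMr // expr_div_n ler_pdivlMr ?exprn_gt0 //.
rewrite [L ^+ 5]exprSr (_ : M * L ^+ 4 * 5`!%:R * 8 ^+ 5 = L ^+ 4 * (M * (8 ^+ 5 *
  5`!%:R))); last by ring.
by apply: ler_wpM2l ML; rewrite exprn_ge0.
Qed.

Local Open Scope classical_set_scope.

Theorem theorem1p7 (R : realType) (p delta : nat -> R)
  (p01 : forall n, 0 <= p n <= 1)
  (p_lower : much_less
     (fun n => n%:R `^ (- (1 / 2)) * ln n%:R `^ (1 / 2)) p)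
  (p_upper : much_less p (fun=> 1))
  (delta_ge1 : \forall n \near \oo,
     p n `^ (3 / 4) * ln n%:R `^ (3 / 4) <= delta n)
  (delta_ge2 : \forall n \near \oo,
     n%:R `^ (- (1 / 3)) * ln n%:R `^ (2 / 3) + p n * ln (1 / p n) <= delta n)
  (delta_le1 : \forall n \near \oo, delta n <= 1) :
  same_order
    (fun n => upper_rate (delta n) (p n) n)
    (fun n => Num.min
       (delta n `^ (2 / 3) * p n ^+ 2 * n%:R ^+ 2 * ln n%:R)
       (delta n `^ (1 / 2) * p n * n%:R `^ (3 / 2) * ln n%:R
        + delta n * p n ^+ 2 * n%:R ^+ 2 * ln (1 / p n))).
Proof.
pose K : R := 20000 + 32 * 3 ^+ 5 * 256.
have K243 : 32 * 3 ^+ 5 * 256 <= K by rewrite /K lerDr ler0n.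
have K20000 : 20000 <= K.
  by rewrite /K lerDl; apply: mulr_ge0; rewrite ?ler0n // mulr_ge0 ?exprn_ge0 ?ler0n.
clearbody K.
have K0 : 0 < K by apply: lt_le_trans K20000; rewrite ltr0n.
have K8 : 0 < 8 * 864 * K by apply: mulr_gt0 K0; rewrite -natrM ltr0n.
pose c := (8 * 864 * K)^-1.
have cE : c * (8 * 864 * K) = 1 by apply: mulVf; exact: lt0r_neq0 K8.
have csmall : c <= 1 / (96 * 1000).
  have h : 0 < 96 * 1000 :> R by apply: mulr_gt0; rewrite ltr0n.
  rewrite div1r lef_pV2; [|rewrite posrE; exact: K8|rewrite posrE; exact: h].
  by move: K20000; clear; lra.
have c0 : 0 < c by rewrite invr_gt0.
clearbody c.
pose M : R := 576 + (96 * 1152 + 48 * 64 * 1152).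
have M1 : 0 <= 576 :> R by rewrite ler0n.
have M2 : 0 <= 96 * 1152 :> R by apply: mulr_ge0; rewrite ler0n.
have M3 : 0 <= 48 * 64 * 1152 :> R by rewrite -!natrM ler0n.
have HM : [/\ 576 <= M, 96 * 1152 <= M & 48 * 64 * 1152 <= M].
  rewrite /M; move: (576 : R) (96 * 1152 : R) (48 * 64 * 1152 : R) M1 M2 M3.
  by clear=> a b d a0 b0 d0; split; lra.
have M0 : 0 <= M by case: HM => h _ _; apply: le_trans h.
clearbody M.
have [L0 L01 HL] := expR_dominates M0.
pose kap : R := 48 + 8 / c + 864 * K.
have q1 : 0 <= 8 / c by rewrite divr_ge0 // ltW.
have q2 : 0 <= 864 * K by apply: mulr_ge0; [rewrite ler0n|exact: ltW].
have kap48 : 48 <= kap by rewrite /kap -addrA lerDl addr_ge0.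
have kapc : 8 / c <= kap by move: q2; rewrite /kap; clear; lra.
have kapK : 864 * K <= kap by move: q1; rewrite /kap; clear; lra.
clearbody kap.
have kap1 : 1 <= kap by apply: le_trans kap48; rewrite ler1n.
have kap0 : 0 < kap by apply: lt_le_trans kap1.
case: p_lower => p_neq0 p_low; case: p_upper => _ p_up.
exists (c / 18), 51; split; [by rewrite divr_gt0|by rewrite ltr0n|].
have evlow : \forall n \near \oo,
    `|n%:R `^ (- (1 / 2)) * ln n%:R `^ (1 / 2) / p n| <= kap^-1.
  by apply: (cvgr0_norm_le _ p_low); rewrite invr_gt0.
have evup : \forall n \near \oo, `|p n / 1| <= expR (- L0).
  by apply: (cvgr0_norm_le _ p_up); rewrite expR_gt0.
near=> n.
have n36 : (36 <= n)%N by near: n; exact: nbhs_infty_ge.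
have lN2 : 2 <= ln n%:R :> R.
  have : (Num.truncn (expR 2 : R)).+1%:R <= n%:R :> R.
    by rewrite ler_nat; near: n; exact: nbhs_infty_ge.
  move=> h; rewrite -ler_expR lnK ?posrE; last by rewrite ltr0n (leq_trans _ n36).
  apply: le_trans h; have /andP[_ h] := truncn_itv (expR_ge0 (2 : R)).
  exact: ltW.
have pn0 : p n != 0 by near: n.
have p0 : 0 < p n by rewrite lt0r pn0; case/andP: (p01 n).
have plow : `|n%:R `^ (- (1 / 2)) * ln n%:R `^ (1 / 2) / p n| <= kap^-1 by near: n.
have pup : `|p n / 1| <= expR (- L0) by near: n.
have d1 : p n `^ (3 / 4) * ln n%:R `^ (3 / 4) <= delta n by near: n.
have d2 : n%:R `^ (- (1 / 3)) * ln n%:R `^ (2 / 3) + p n * ln (1 / p n) <= delta n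
  by near: n.
have de1 : delta n <= 1 by near: n.
have N0 : 0 < n%:R :> R by rewrite ltr0n (leq_trans _ n36).
have lN0 : 0 < ln n%:R :> R by apply: lt_le_trans lN2.
have LL : L0 <= ln (1 / p n).
  rewrite div1r lnV ?posrE // lerNr -ler_expR lnK ?posrE //.
  by move: pup; rewrite divr1 gtr0_norm.
have L1 : 1 <= ln (1 / p n) by apply: le_trans LL.
have np2 : kap * ln n%:R <= n%:R * p n ^+ 2.
  move: plow; rewrite ger0_norm; last first.
    by rewrite divr_ge0 ?mulr_ge0 ?powR_ge0 // ltW.
  rewrite ler_pdivrMr // => h.
  have h2 : (n%:R `^ (- (1 / 2)) * ln n%:R `^ (1 / 2)) ^+ 2 <= (kap^-1 * p n) ^+ 2.
    by rewrite lerXn2r ?nnegrE ?mulr_ge0 ?powR_ge0 ?invr_ge0 // ltW.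
  move: h2; rewrite !exprMn !powR_expn.
  rewrite (_ : - (1 / 2) * 2%:R = -1); last by field.
  rewrite (_ : 1 / 2 * 2%:R = 1); last by field.
  rewrite powRr1 ?(ltW lN0) // powR_inv1 ?(ltW N0) // => h2.
  have kk : 0 < kap ^+ 2 by rewrite exprn_gt0.
  have := ler_wpM2l (mulr_ge0 (ltW kk) (ltW N0)) h2.
  rewrite (_ : kap ^+ 2 * n%:R * (n%:R^-1 * ln n%:R) = kap ^+ 2 * ln n%:R);
    last first.
    by field; rewrite gt_eqF.
  rewrite (_ : kap ^+ 2 * n%:R * (kap^-1 ^+ 2 * p n ^+ 2) = n%:R * p n ^+ 2);
    last first.
    by field; rewrite gt_eqF.
  apply: le_trans; rewrite expr2 -mulrA ler_peMl // mulr_ge0 // ltW //.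
have d2' : n%:R `^ (- (1 / 3)) <= delta n.
  apply: le_trans d2; apply: le_trans (_ : n%:R `^ (- (1 / 3)) * ln n%:R `^ (2 / 3)
    <= _).
    have l1 : 1 <= ln n%:R :> R by move: lN2; clear; lra.
    have q : 1 `^ (2 / 3) <= ln n%:R `^ (2 / 3) :> R.
      by apply: ge0_ler_powR; rewrite ?nnegrE ?divr_ge0 ?(ltW lN0).
    by rewrite powR1 in q; rewrite ler_peMr ?powR_ge0.
  by rewrite lerDl mulr_ge0 // ?(ltW p0) // (le_trans _ L1).
have Hk : [/\ 48 * ln n%:R <= n%:R * p n ^+ 2, 8 / c * ln n%:R <= n%:R * p n ^+ 2 &
      864 * K * ln n%:R <= n%:R * p n ^+ 2].
  by split; apply: le_trans np2; apply: ler_wpM2r => //; exact: ltW.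
exact: (upper_rate_bounds K20000 K243 cE csmall HM p0 erefl L1 (HL _ LL) n36 lN2
  de1 d1 d2' Hk).
Unshelve. all: by end_near. Qed.
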